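(* Let $a\in\mathbb{R}$ and $s>0$. Then the limit $$\lim_{N\to\infty}\sum_{n=1}^N(-1)^n\left(1-\frac nN\right)\frac{r_3(n)}{(a^2+n)^s}$$ exists and $$M_{a,s}=\lim_{N\to\infty}\sum_{n=1}^N(-1)^n\left(1-\frac nN\right)\frac{r_3(n)}{(a^2+n)^s}.$$
   Context: For $n\in\mathbb{N}$, $r_3(n)$ denotes the number of integer points $(i,j,k)\in\mathbb{Z}^3$ with $i^2+j^2+k^2=n$. The generalized Madelung constant $M_{a,s}$ is the value of the alternating lattice sum $$\sum_{(i,j,k)\in\mathbb{Z}^3\setminus\{0\}}\frac{(-1)^{i+j+k}}{(a^2+i^2+j^2+k^2)^s}$$ understood as summation by expanding rectangles, i.e. $$M_{a,s}:=\lim_{(I,J,K)\to\infty}\ \sum_{\substack{(i,j,k)\in\mathbb{Z}^3\setminus\{0\}\\ |i|\le I,\ |j|\le J,\ |k|\le K}}\frac{(-1)^{i+j+k}}{(a^2+i^2+j^2+k^2)^s},$$ where $I,J,K\in\mathbb{N}$ and the triple limit is taken as $\min\{I,J,K\}\to\infty$. This limit exists and is finite for every $a\in\mathbb{R}$, $s>0$. *)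

(* Defs.v *)
From mathcomp Require Import all_boot all_order all_algebra.
From mathcomp Require Import finmap.
From mathcomp Require Import all_classical all_reals all_analysis.

Set Implicit Arguments.
Unset Strict Implicit.
Unset Printing Implicit Defensive.

Import Order.TTheory GRing.Theory Num.Theory.
Import numFieldNormedType.Exports.

Local Open Scope classical_set_scope.
Local Open Scope ring_scope.

Definition sqsum (p : int * int * int) : int :=
  p.1.1 ^+ 2 + p.1.2 ^+ 2 + p.2 ^+ 2.

(* [fset_set] is meaningful on finite sets only; see [finite_sphere]. *)
Definition r3 (n : nat) : nat :=
  #|` fset_set [set p : int * int * int | sqsum p = n%:Z]|%fset.

Definition punctured_box (I J K : nat) : set (int * int * int) :=
  [set p | [/\ p != (0, 0, 0), `|p.1.1| <= I%:Z, `|p.1.2| <= J%:Z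
             & `|p.2| <= K%:Z]].

(* The base of the power is positive, since (i, j, k) != (0, 0, 0): the
   convention for [powR] at 0 plays no role. *)
Definition box_sum (R : realType) (a s : R) (N : nat * nat * nat) : R :=
  \sum_(p \in punctured_box N.1.1 N.1.2 N.2)
    (-1) ^ (p.1.1 + p.1.2 + p.2) / (a ^+ 2 + (sqsum p)%:~R) `^ s.

(* This is the limit as min(I, J, K) tends to infinity, see [near_oo3]. *)
Definition madelung (R : realType) (a s : R) : R :=
  lim (box_sum a s N @[N --> (\oo, \oo, \oo)]).

Definition cesaro_sum (R : realType) (a s : R) (N : nat) : R :=
  \sum_(1 <= n < N.+1)
    (-1) ^+ n * (1 - n%:R / N%:R) * ((r3 n)%:R / (a ^+ 2 + n%:R) `^ s).

Lemma finite_int_ball (n : nat) : finite_set [set i : int | `|i| <= n%:Z].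
Proof.
apply: (@sub_finite_set _ _
  ((fun m : nat => m%:Z) @` `I_n.+1 `|` (fun m : nat => - m%:Z) @` `I_n.+1)).
- case=> m /= le_mn; [left; exists m|right; exists m.+1] => //=.
- by rewrite finite_setU; split; apply: finite_image; exact: finite_II.
Qed.

Lemma finite_box (I J K : nat) : finite_set (punctured_box I J K).
Proof.
apply: (@sub_finite_set _ _ (([set i : int | `|i| <= I%:Z] `*`
  [set i : int | `|i| <= J%:Z]) `*` [set i : int | `|i| <= K%:Z])).
- by move=> p [].
- by do 2 ?apply: finite_setX; exact: finite_int_ball.
Qed.

Lemma finite_sphere (n : nat) :
  finite_set [set p : int * int * int | sqsum p = n%:Z].
Proof.
have le_sq (i : int) : `|i| <= i ^+ 2.
  rewrite -real_normK ?num_real // expr2 -abszE -PoszM lez_nat.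
  by case: (absz i) => // m; exact: leq_pmull.
apply: (@sub_finite_set _ _ (([set i : int | `|i| <= n%:Z] `*`
  [set i : int | `|i| <= n%:Z]) `*` [set i : int | `|i| <= n%:Z])).
- move=> [[i j] k]; rewrite /sqsum /= => <-; split; [split|] => /=.
  + by apply: (le_trans (le_sq i)); rewrite -addrA lerDl addr_ge0 ?sqr_ge0.
  + by apply: (le_trans (le_sq j)); rewrite addrAC lerDr addr_ge0 ?sqr_ge0.
  + by apply: (le_trans (le_sq k)); rewrite lerDr addr_ge0 ?sqr_ge0.
- by do 2 ?apply: finite_setX; exact: finite_int_ball.
Qed.

Lemma near_oo3 (P : set (nat * nat * nat)) :
  (\forall N \near (\oo, \oo, \oo), P N) <->
  exists m : nat, forall I J K : nat,
    (m <= I)%N -> (m <= J)%N -> (m <= K)%N -> P (I, J, K).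
Proof.
split=> [[[A C] /= [[[A1 A2] /= [[i _ iA1] [j _ jA2]] sA] [k _ kC]] sP]|[m mP]].
  exists (maxn i (maxn j k)) => I J K; rewrite !geq_max.
  move=> /andP[iI _] /and3P[_ jJ _] /and3P[_ _ kK].
  by apply: sP; split; [apply: sA; split; [exact: iA1|exact: jA2]|exact: kC].
exists ([set N | (m <= N.1)%N /\ (m <= N.2)%N], [set K | (m <= K)%N]) => /=.
  split; last by exists m.
  by exists ([set I | (m <= I)%N], [set J | (m <= J)%N]); [split; exists m|].
by move=> [[I J] K] [[mI mJ] mK]; exact: mP.
Qed.

(* Main.v *)
(** Write [a_n = (-1)^n r_3(n)] and [A(N) = sum_{n<N} (N-n) a_n]. Everything rests on the bound
    [A(N) = O(N (log N)^3)].

    [A(N)] is the alternating sum over [Z^3] of the truncated paraboloid [(N - |x|^2)_+]. Up to an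
    error [O(N)], it is the integral of this function against [k(x_1) k(x_2) k(x_3)], where [k] is a
    normalised odd power of the cosine, of large exponent: it changes sign under translation by one
    step of the lattice, and its mass concentrates near the lattice points. Expanding [k] into
    cosines of odd frequencies, with bounded coefficients, leaves the Fourier transform of the
    paraboloid. That one is rotation invariant, hence computed along an axis, where it is
    [O(N / |xi|^3)]; and [|xi|^3 >= |xi_1 xi_2 xi_3|] turns the sum over the frequencies into the
    cube of a harmonic sum. The resulting estimate is an inequality between integers, so it may be
    proved over one model of the real numbers and used over any other.

    Summing by parts twice against [f(n) = (a^2+n)^(-s)], whose second differences are
    [O(n^(-s-2))], shows that the means [tau_N = sum_{n<N} (1 - n/N) a_n f(n)] converge to some [l].

    For the boxes, call a sequence [k]-monotone when its differences of order at most [k] alternate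
    in sign. For a 3-monotone [phi], Leibniz' criterion applied in each variable shows that the
    alternating sums of [phi(i^2+j^2+k^2)] over two boxes containing the box of half-side [m] differ
    by at most [54 phi(m)]. This applies to [f w_N], where [w_N(n)] is the average over
    [1 <= M <= N+1] of [(1 - n/M)_+]: a large box then gives the average of the first means [tau_M],
    which tends to [l], while [w_N] tends to 1. So the alternating sums of [f] itself over boxes
    are within [54 f(m)] of [l]. *)

From Stdlib Require Reals ZArith Lra Lia Psatz FunctionalExtensionality.
From Coquelicot Require Coquelicot.

Module RieszBound.
Import Reals ZArith Lra Lia Psatz FunctionalExtensionality Coquelicot.
Local Open Scope R_scope.

(** * Riemann integrals of bounded Lipschitz functions *)

Definition cont (f : R -> R) := forall x, continuous f x.

(* [RInt] with codomain [R], so that [ring] and [lra] recognise the type of the integrals. *)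
Definition Int (f : R -> R) (a b : R) : R := RInt f a b.

Lemma cont_ex_RInt f a b : cont f -> ex_RInt f a b.
Proof. intros H; apply (ex_RInt_continuous (V := R_CompleteNormedModule)); intros; apply H. Qed.

Lemma contD f g : cont f -> cont g -> cont (fun x => f x + g x).
Proof. intros F G x; exact (continuous_plus (V := R_NormedModule) f g x (F x) (G x)). Qed.

Lemma contB f g : cont f -> cont g -> cont (fun x => f x - g x).
Proof. intros F G x; exact (continuous_minus (V := R_NormedModule) f g x (F x) (G x)). Qed.

Lemma contZ c f : cont f -> cont (fun x => c * f x).
Proof. intros F x; exact (continuous_scal_r (V := R_NormedModule) c f x (F x)). Qed.

Lemma contM f g : cont f -> cont g -> cont (fun x => f x * g x).
Proof. intros F G x; exact (continuous_mult (K := R_AbsRing) f g x (F x) (G x)). Qed.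

Lemma cont_const c : cont (fun _ => c).
Proof. intros x; apply continuous_const. Qed.

Lemma cont_id : cont (fun x => x).
Proof. intros x; apply continuous_id. Qed.

Lemma cont_comp f g : cont f -> cont g -> cont (fun x => g (f x)).
Proof. intros F G x; apply (continuous_comp f g x (F x) (G _)). Qed.

Lemma cont_ext f g : (forall x, f x = g x) -> cont f -> cont g.
Proof. intros E F x; exact (continuous_ext f g x E (F x)). Qed.

Lemma IntD f g a b : cont f -> cont g ->
  Int (fun x => f x + g x) a b = Int f a b + Int g a b.
Proof. intros; apply (RInt_plus (V := R_CompleteNormedModule)); apply cont_ex_RInt; auto. Qed.

Lemma IntB f g a b : cont f -> cont g ->
  Int (fun x => f x - g x) a b = Int f a b - Int g a b.
Proof. intros; apply (RInt_minus (V := R_CompleteNormedModule)); apply cont_ex_RInt; auto. Qed.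

Lemma IntZ c f a b : cont f -> Int (fun x => c * f x) a b = c * Int f a b.
Proof. intros; apply (RInt_scal (V := R_CompleteNormedModule)); apply cont_ex_RInt; auto. Qed.

Lemma Int_cat f a b c : cont f -> Int f a b + Int f b c = Int f a c.
Proof. intros; apply (RInt_Chasles (V := R_CompleteNormedModule)); apply cont_ex_RInt; auto. Qed.

Lemma Int_eq (f g : R -> R) a b : (forall x, f x = g x) -> Int f a b = Int g a b.
Proof. intros H; apply RInt_ext; intros; apply H. Qed.

Lemma Int_const c a b : Int (fun _ => c) a b = (b - a) * c.
Proof. exact (RInt_const (V := R_CompleteNormedModule) a b c). Qed.

Lemma Int_point f a : Int f a a = 0.
Proof. exact (RInt_point (V := R_CompleteNormedModule) a f). Qed.

Lemma Int_swap f a b : cont f -> Int f a b = - Int f b a.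
Proof. intros H; pose proof (Int_cat f a b a H); rewrite Int_point in H0; lra. Qed.

(** Keeping the factor [u] on the left makes the substitution valid for every [u], negative values
    included. *)
Lemma Int_affine f u v a b : cont f ->
  u * Int (fun y => f (u * y + v)) a b = Int f (u * a + v) (u * b + v).
Proof.
intros H; rewrite <- IntZ.
- apply (RInt_comp_lin (V := R_CompleteNormedModule) f u v a b), cont_ex_RInt; auto.
- apply (cont_comp (fun y => u * y + v)); auto.
  apply contD; [apply contZ, cont_id|apply cont_const].
Qed.

Lemma Int_bound f a b M : a <= b -> cont f ->
  (forall t, a <= t <= b -> Rabs (f t) <= M) -> Rabs (Int f a b) <= (b - a) * M.
Proof. intros; apply abs_RInt_le_const; auto; apply cont_ex_RInt; auto. Qed.

Lemma Int_le f g a b : a <= b -> cont f -> cont g ->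
  (forall t, a <= t <= b -> f t <= g t) -> Int f a b <= Int g a b.
Proof.
intros ab cf cg H; apply RInt_le; auto; try (apply cont_ex_RInt; auto).
intros; apply H; lra.
Qed.

Lemma Int_FTC F f a b : cont f -> (forall x, is_derive F x (f x)) ->
  Int f a b = F b - F a.
Proof.
intros H HF; apply is_RInt_unique.
apply (is_RInt_derive (V := R_CompleteNormedModule) F f); intros; [apply HF|apply H].
Qed.

Lemma Int_eq0 (f : R -> R) a b : (forall x, Rmin a b < x < Rmax a b -> f x = 0) -> Int f a b = 0.
Proof.
intros H; rewrite <- (Rmult_0_r (b - a)), <- (Int_const 0).
apply RInt_ext; auto.
Qed.

Lemma Int_supp_wide f a b m M : cont f -> a <= b -> m <= a -> b <= M ->
  (forall x, x <= a -> f x = 0) -> (forall x, b <= x -> f x = 0) ->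
  Int f m M = Int f a b.
Proof.
intros H ab ma bM fa fb.
rewrite <- (Int_cat f m a M), <- (Int_cat f a b M) by auto.
rewrite (Int_eq0 f m a), (Int_eq0 f b M); [ring| |].
- intros x; rewrite Rmin_left by lra; intros; apply fb; lra.
- intros x; rewrite Rmax_right by lra; intros; apply fa; lra.
Qed.

(** Both sides equal the integral over the hull of the two intervals. This absorbs the change of the
    limits of integration in affine substitutions. *)
Lemma Int_supp f a b c d : cont f -> a <= b -> c <= d ->
  (forall x, x <= a -> f x = 0) -> (forall x, b <= x -> f x = 0) ->
  (forall x, x <= c -> f x = 0) -> (forall x, d <= x -> f x = 0) ->
  Int f a b = Int f c d.
Proof.
intros.
rewrite <- (Int_supp_wide f a b (Rmin a c) (Rmax b d)); auto using Rmin_l, Rmax_l.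
apply Int_supp_wide; auto using Rmin_r, Rmax_r.
Qed.

(** * Bounded Lipschitz functions and the exchange of iterated integrals *)

Definition distR (x y : R) := Rabs (x - y).
Definition distprod {T : Type} (d : T -> T -> R) (p q : T * R) :=
  d (fst p) (fst q) + Rabs (snd p - snd q).
(* Bounded functions that are Lipschitz for [d]. Being stable under products, Lipschitz changes of
   variables and integration of the last variable, this class provides all the continuity and
   integrability that is needed below. *)
Definition bdlip {T : Type} (d : T -> T -> R) (f : T -> R) :=
  exists K, 0 <= K /\ (forall p, Rabs (f p) <= K) /\
    forall p q, Rabs (f p - f q) <= K * d p q.

Lemma bdlip_cont f : bdlip distR f -> cont f.
Proof.
intros [K [K0 [_ HK]]] x.
apply continuity_pt_filterlim; intros e he.
exists (e / (K + 1)); split; [apply Rdiv_lt_0_compat; lra|].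
intros y [_ hy]; simpl in *; unfold Rdist in *.
apply Rle_lt_trans with (1 := HK y x); unfold distR.
apply Rle_lt_trans with ((K + 1) * Rabs (y - x)); [pose proof (Rabs_pos (y - x)); nra|].
apply Rlt_le_trans with ((K + 1) * (e / (K + 1))); [apply Rmult_lt_compat_l; lra|].
right; field; lra.
Qed.

Lemma bdlip_comp {T T'} (d : T -> T -> R) (d' : T' -> T' -> R) (phi : T -> T') f C :
  1 <= C -> (forall p q, d' (phi p) (phi q) <= C * d p q) ->
  bdlip d' f -> bdlip d (fun p => f (phi p)).
Proof.
intros hC H [K [K0 [HK1 HK2]]]; exists (K * C); split; [nra|split; intros].
- apply Rle_trans with (1 := HK1 _); nra.
- apply Rle_trans with (1 := HK2 _ _); rewrite Rmult_assoc; apply Rmult_le_compat_l; auto.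
Qed.

Lemma bdlip_mul {T} (d : T -> T -> R) f g : bdlip d f -> bdlip d g -> bdlip d (fun p => f p * g p).
Proof.
intros [K [K0 [HK1 HK2]]] [L [L0 [HL1 HL2]]]; exists (2 * K * L).
split; [nra|split; intros].
- rewrite Rabs_mult; generalize (Rmult_le_compat _ _ _ _ (Rabs_pos _) (Rabs_pos _) (HK1 p) (HL1 p)); nra.
- replace (f p * g p - f q * g q) with (f p * (g p - g q) + g q * (f p - f q)) by ring.
  apply Rle_trans with (1 := Rabs_triang _ _); rewrite !Rabs_mult.
  generalize (Rmult_le_compat _ _ _ _ (Rabs_pos _) (Rabs_pos _) (HK1 p) (HL2 p q)).
  generalize (Rmult_le_compat _ _ _ _ (Rabs_pos _) (Rabs_pos _) (HL1 q) (HK2 p q)).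
  nra.
Qed.

Lemma bdlip_add {T} (d : T -> T -> R) f g : bdlip d f -> bdlip d g -> bdlip d (fun p => f p + g p).
Proof.
intros [K [K0 [HK1 HK2]]] [L [L0 [HL1 HL2]]]; exists (K + L).
split; [lra|split; intros].
- apply Rle_trans with (1 := Rabs_triang _ _); specialize (HK1 p); specialize (HL1 p); lra.
- replace (f p + g p - (f q + g q)) with ((f p - f q) + (g p - g q)) by ring.
  apply Rle_trans with (1 := Rabs_triang _ _); specialize (HK2 p q); specialize (HL2 p q); lra.
Qed.

Lemma bdlip_scal {T} (d : T -> T -> R) c f : bdlip d f -> bdlip d (fun p => c * f p).
Proof.
intros [K [K0 [HK1 HK2]]]; exists (Rabs c * K); pose proof (Rabs_pos c).
split; [nra|split; intros].
- rewrite Rabs_mult; apply Rmult_le_compat_l; auto.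
- rewrite <- Rmult_minus_distr_l, Rabs_mult, Rmult_assoc; apply Rmult_le_compat_l; auto.
Qed.

Lemma bdlip_ext {T} (d : T -> T -> R) f g : (forall p, f p = g p) -> bdlip d f -> bdlip d g.
Proof.
intros E [K [K0 [HK1 HK2]]]; exists K; split; [auto|split; intros]; rewrite <- !E; auto.
Qed.

Lemma bdlip_slice {T} (d : T -> T -> R) (f : T * R -> R) (p : T) :
  (forall q, d q q = 0) -> bdlip (distprod d) f -> bdlip distR (fun x => f (p, x)).
Proof.
intros d0; apply (bdlip_comp distR (distprod d) (fun x => (p, x)) f 1); [lra|].
intros x y; unfold distprod, distR; simpl; rewrite d0; lra.
Qed.

Lemma bdlip_Int {T} (d : T -> T -> R) (f : T * R -> R) a b :
  (forall q, d q q = 0) -> a <= b -> bdlip (distprod d) f ->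
  bdlip d (fun p => Int (fun x => f (p, x)) a b).
Proof.
intros d0 ab H.
assert (C : forall p, cont (fun x => f (p, x))) by (intros; apply bdlip_cont, (bdlip_slice d); auto).
destruct H as [K [K0 [HK1 HK2]]]; exists ((b - a) * K).
split; [nra|split; intros].
- apply Int_bound; auto.
- rewrite <- IntB by auto.
  rewrite Rmult_assoc; apply Int_bound; auto.
  + apply contB; apply C.
  + intros t _; apply Rle_trans with (1 := HK2 _ _); unfold distprod; simpl.
    rewrite Rminus_diag, Rabs_R0; lra.
Qed.

Lemma distR_refl x : distR x x = 0.
Proof. unfold distR; rewrite Rminus_diag; apply Rabs_R0. Qed.

Lemma distprod_refl {T} (d : T -> T -> R) : (forall q, d q q = 0) -> forall q, distprod d q q = 0.
Proof. intros H q; unfold distprod; rewrite H, Rminus_diag, Rabs_R0; ring. Qed.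

(** The difference quotients at step [h] are at most [C * |h|], so [J] has derivative 0 everywhere
    and the mean value theorem applies. *)
Lemma quadratic_const J C a b : a <= b -> 0 <= C ->
  (forall x y, x <= y -> Rabs (J y - J x) <= C * (y - x) ^ 2) -> J b = J a.
Proof.
intros ab ball_const H.
assert (D : forall x, derivable_pt_lim J x 0).
{ intros x e he.
  assert (hd : 0 < e / (C + 1)) by (apply Rdiv_lt_0_compat; lra).
  exists (mkposreal _ hd); intros h h0 hh; simpl in hh.
  assert (E : Rabs (J (x + h) - J x) <= C * h ^ 2).
  { destruct (Rle_or_lt 0 h).
    - replace (h ^ 2) with ((x + h - x) ^ 2) by ring; apply H; lra.
    - rewrite Rabs_minus_sym; replace (h ^ 2) with ((x - (x + h)) ^ 2) by ring; apply H; lra. }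
  rewrite Rminus_0_r; unfold Rdiv; rewrite Rabs_mult, Rabs_inv.
  assert (ha : 0 < Rabs h) by (apply Rabs_pos_lt; auto).
  apply Rmult_lt_reg_r with (Rabs h); auto.
  rewrite Rmult_assoc, Rinv_l, Rmult_1_r by lra.
  apply Rle_lt_trans with (1 := E).
  rewrite <- (pow2_abs h).
  apply Rle_lt_trans with ((C + 1) * Rabs h ^ 2); [pose proof (pow2_ge_0 (Rabs h)); nra|].
  apply Rlt_le_trans with (((C + 1) * (e / (C + 1))) * Rabs h).
  - replace ((C + 1) * Rabs h ^ 2) with (((C + 1) * Rabs h) * Rabs h) by ring.
    apply Rmult_lt_compat_r; auto; apply Rmult_lt_compat_l; lra.
  - right; field; lra. }
destruct (Rle_lt_or_eq_dec a b ab) as [lt|<-]; [|reflexivity].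
destruct (MVT_cor2 J (fun _ => 0) a b lt (fun c _ => D c)) as [c [E _]]; lra.
Qed.

(* The two iterated integrals, as functions of the upper limit of [x], differ by a function whose
   increments are quadratic, hence by a constant. *)
Lemma fubini f a b c d : a <= b -> c <= d -> bdlip (distprod distR) f ->
  Int (fun x => Int (fun y => f (x, y)) c d) a b =
  Int (fun y => Int (fun x => f (x, y)) a b) c d.
Proof.
intros ab cd H.
assert (Cy : forall x, cont (fun y => f (x, y)))
  by (intros; apply bdlip_cont, (bdlip_slice distR); auto using distR_refl).
assert (H' : bdlip (distprod distR) (fun p => f (snd p, fst p))).
{ apply (bdlip_comp (distprod distR) (distprod distR) (fun p => (snd p, fst p)) f 1); auto; [lra|].
  intros; unfold distprod, distR; simpl; lra. }
assert (Cx : forall y, cont (fun x => f (x, y)))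
  by (intros y; apply bdlip_cont; exact (bdlip_slice distR _ y distR_refl H')).
assert (CI : cont (fun x => Int (fun y => f (x, y)) c d))
  by (apply bdlip_cont, (bdlip_Int distR); auto using distR_refl).
assert (CJ : forall u v, u <= v -> cont (fun y => Int (fun x => f (x, y)) u v))
  by (intros; apply bdlip_cont; exact (bdlip_Int distR _ u v distR_refl H0 H')).
assert (CJ' : forall u v, cont (fun y => Int (fun x => f (x, y)) u v)).
{ intros u v; destruct (Rle_or_lt u v); auto.
  apply (cont_ext (fun y => (-1) * Int (fun x => f (x, y)) v u)).
  - intros y; rewrite (Int_swap _ u v); auto; ring.
  - apply contZ, CJ; lra. }
set (J := fun X => Int (fun x => Int (fun y => f (x, y)) c d) a X -
   Int (fun y => Int (fun x => f (x, y)) a X) c d).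
destruct H as [K [K0 [HK1 HK2]]].
assert (E : J b = J a).
{ apply quadratic_const with (2 * K * (d - c)); auto; [nra|].
  intros u v uv.
  (* The function [f (u, y)], constant in [x], contributes the same amount to both iterated
     integrals over the strip between [u] and [v], so it can be subtracted. What is left has size at
     most [K * (v - u)], on a strip of width [v - u]. *)
  assert (EJ : J v - J u = Int (fun x => Int (fun y => f (x, y)) c d - Int (fun y => f (u, y)) c d) u v -
     Int (fun y => Int (fun x => f (x, y) - f (u, y)) u v) c d).
  { rewrite IntB; auto; [|apply cont_const].
    rewrite (Int_eq (fun y => Int (fun x => f (x, y) - f (u, y)) u v)
       (fun y => (Int (fun x => f (x, y)) a v - Int (fun x => f (x, y)) a u) - (v - u) * f (u, y))).
    2: { intros y; rewrite IntB; auto; [|apply cont_const].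
      rewrite Int_const.
      rewrite <- (Int_cat _ a u v) by auto; ring. }
    rewrite IntB; [rewrite IntB; auto; rewrite IntZ; auto | |].
    - rewrite Int_const; unfold J.
      rewrite <- (Int_cat (fun x => Int (fun y => f (x, y)) c d) a u v) by auto.
      ring.
    - apply contB; apply CJ'.
    - apply contZ, Cy. }
  rewrite EJ; apply Rle_trans with (1 := Rabs_triang _ _); rewrite Rabs_Ropp.
  assert (A1 : Rabs (Int (fun x => Int (fun y => f (x, y)) c d - Int (fun y => f (u, y)) c d) u v)
     <= (v - u) * ((d - c) * (K * (v - u)))).
  { apply Int_bound; auto.
    - apply contB; [apply CI|apply cont_const].
    - intros x hx; rewrite <- IntB by auto; apply Int_bound; auto.
      + apply contB; apply Cy.
      + intros y _; apply Rle_trans with (1 := HK2 _ _); apply Rmult_le_compat_l; auto.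
        unfold distprod, distR; simpl; rewrite Rminus_diag, Rabs_R0, Rabs_pos_eq; lra. }
  assert (A2 : Rabs (Int (fun y => Int (fun x => f (x, y) - f (u, y)) u v) c d)
     <= (d - c) * ((v - u) * (K * (v - u)))).
  { apply Int_bound; auto.
    - apply bdlip_cont.
      apply (bdlip_ext distR (fun y => Int (fun x => (fun q => f (snd q, fst q) + (-1) * f (u, fst q)) (y, x)) u v)).
      { intros y; apply Int_eq; intros x; simpl; ring. }
      apply (bdlip_Int distR (fun q => f (snd q, fst q) + (-1) * f (u, fst q)) u v distR_refl uv).
      apply bdlip_add; [exact H'|]; apply (bdlip_scal _ _ (fun q => f (u, fst q))).
      apply (bdlip_comp (distprod distR) (distprod distR) (fun q => (u, fst q)) f 1); [lra| |exists K; auto].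
      intros p q; unfold distprod, distR; simpl; rewrite Rminus_diag, Rabs_R0.
      pose proof (Rabs_pos (snd p - snd q)); lra.
    - intros y _; apply Int_bound; auto.
      + apply contB; [apply Cx|apply cont_const].
      + intros x hx; apply Rle_trans with (1 := HK2 _ _); apply Rmult_le_compat_l; auto.
        unfold distprod, distR; simpl; rewrite Rminus_diag, Rabs_R0, Rabs_pos_eq; lra. }
  nra. }
unfold J in E.
rewrite Int_point in E.
rewrite (Int_eq (fun y => Int (fun x => f (x, y)) a a) (fun _ => 0)) in E.
2: { intros y; apply Int_point. }
rewrite (Int_eq0 (fun _ => 0)) in E by auto.
lra.
Qed.

(** * Rotation invariance *)

Lemma cos_lip x y : Rabs (cos x - cos y) <= Rabs (x - y).
Proof.
destruct (MVT_gen cos y x (fun t => - sin t)) as [c [_ E]].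
- intros; apply is_derive_cos.
- intros; apply continuity_pt_filterlim, continuous_cos.
- rewrite E, Rabs_mult, Rabs_Ropp.
  assert (Rabs (sin c) <= 1) by (apply Rabs_le, SIN_bound).
  pose proof (Rabs_pos (x - y)); nra.
Qed.

Lemma bdlip_cos_lin {T} (d : T -> T -> R) (l : T -> R) C :
  1 <= C -> (forall p q, Rabs (l p - l q) <= C * d p q) -> bdlip d (fun p => cos (l p)).
Proof.
intros C1 H; exists C; split; [lra|split; intros].
- apply Rle_trans with 1; auto; apply Rabs_le, COS_bound.
- apply Rle_trans with (1 := cos_lip _ _); auto.
Qed.

Lemma bdlip_cos c : bdlip distR (fun x => cos (c * x)).
Proof.
apply (bdlip_cos_lin _ _ (1 + Rabs c)); [pose proof (Rabs_pos c); lra|].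
intros p q; unfold distR; rewrite <- Rmult_minus_distr_l, Rabs_mult; pose proof (Rabs_pos (p - q)); lra.
Qed.

Lemma bdlip_fst {T} (d : T -> T -> R) f : bdlip d f -> bdlip (distprod d) (fun p => f (fst p)).
Proof.
apply (bdlip_comp (distprod d) d fst f 1); [lra|intros p q; unfold distprod].
pose proof (Rabs_pos (snd p - snd q)); lra.
Qed.

Lemma bdlip_snd {T} (d : T -> T -> R) f : (forall p q, 0 <= d p q) -> bdlip distR f ->
  bdlip (distprod d) (fun p => f (snd p)).
Proof.
intros d0; apply (bdlip_comp (distprod d) distR snd f 1); [lra|intros p q; unfold distprod, distR].
pose proof (d0 (fst p) (fst q)); lra.
Qed.

Lemma distR_ge0 p q : 0 <= distR p q.
Proof. apply Rabs_pos. Qed.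

Lemma distprod_ge0 {T} (d : T -> T -> R) : (forall p q, 0 <= d p q) -> forall p q, 0 <= distprod d p q.
Proof. intros H p q; unfold distprod; pose proof (H (fst p) (fst q)); pose proof (Rabs_pos (snd p - snd q)); lra. Qed.

(** These maps, which fix the first coordinate, are the substitutions into which [Int_rotate] splits
    a rotation. *)
Lemma bdlip_shear f c e : bdlip (distprod distR) f -> bdlip (distprod distR) (fun p => f (fst p, c * snd p + e * fst p)).
Proof.
pose proof (Rabs_pos c); pose proof (Rabs_pos e).
apply (bdlip_comp (distprod distR) (distprod distR) (fun p => (fst p, c * snd p + e * fst p)) f (1 + Rabs c + Rabs e)); [lra|].
intros [x y] [x' y']; unfold distprod, distR; simpl.
replace (c * y + e * x - (c * y' + e * x')) with (c * (y - y') + e * (x - x')) by ring.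
pose proof (Rabs_triang (c * (y - y')) (e * (x - x'))); rewrite !Rabs_mult in *.
pose proof (Rabs_pos (x - x')); pose proof (Rabs_pos (y - y')); nra.
Qed.

Lemma Int_odd f B : cont f -> (forall x, f (- x) = - f x) -> Int f (- B) B = 0.
Proof.
intros cf H; pose proof (Int_affine f (-1) 0 (- B) B cf) as E.
rewrite (Int_eq _ (fun y => (-1) * f y)) in E.
2: { intros x; replace (-1 * x + 0) with (- x) by ring; rewrite H; ring. }
rewrite IntZ in E by auto.
replace (-1 * - B + 0) with B in E by ring; replace (-1 * B + 0) with (- B) in E by ring.
rewrite (Int_swap f B) in E by auto; lra.
Qed.

Lemma cont_cos_lin a b : cont (fun y => cos (a + b * y)).
Proof.
apply bdlip_cont, (bdlip_cos_lin _ _ (1 + Rabs b)); [pose proof (Rabs_pos b); lra|].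
intros p q; unfold distR; replace (a + b * p - (a + b * q)) with (b * (p - q)) by ring.
rewrite Rabs_mult; pose proof (Rabs_pos (p - q)); lra.
Qed.

Lemma cont_sin_lin b : cont (fun y => sin (b * y)).
Proof.
apply (cont_comp (fun y => b * y) sin); [apply contZ, cont_id|].
intros x; apply continuous_sin.
Qed.

(* The rotation taking [(al, be)] to [(rho, 0)] splits into two affine substitutions of one
   variable: [y = (rho * u - al * x) / be] at fixed [x], then, after exchanging the integrals,
   [x = (be * v + al * u) / rho] at fixed [u]. The support of [G] keeps all ranges equal to
   [[-B, B]]. *)
Lemma Int_rotate G S al be B :
  0 < S <= B -> 0 < be ->
  bdlip (distprod distR) (fun p => G (fst p ^ 2 + snd p ^ 2)) ->
  (forall r, S ^ 2 <= r -> G r = 0) ->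
  Int (fun x => Int (fun y => G (x ^ 2 + y ^ 2) * (cos (al * x) * cos (be * y))) (- B) B) (- B) B =
  Int (fun u => cos (sqrt (al ^ 2 + be ^ 2) * u) * Int (fun v => G (u ^ 2 + v ^ 2)) (- B) B) (- B) B.
Proof.
intros SB be0 H G0.
set (rho := sqrt (al ^ 2 + be ^ 2)).
assert (rho2 : rho ^ 2 = al ^ 2 + be ^ 2) by (apply pow2_sqrt; nra).
assert (rho0 : 0 < rho) by (apply sqrt_lt_R0; nra).
(* The integrand in the variables [(x, u)]: the substitution is chosen so that
   [al * x + be * y = rho * u], and the phase depends on [u] alone. *)
set (m := fun p : R * R => G (fst p ^ 2 + (rho / be * snd p + - (al / be) * fst p) ^ 2) * cos (rho * snd p)).
assert (Hm : bdlip (distprod distR) m).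
{ apply (bdlip_mul (distprod distR) (fun p => G (fst p ^ 2 + (rho / be * snd p + - (al / be) * fst p) ^ 2))
    (fun p => cos (rho * snd p))).
  - exact (bdlip_shear _ (rho / be) (- (al / be)) H).
  - apply (bdlip_snd distR (fun x => cos (rho * x))); [apply distR_ge0|apply bdlip_cos]. }
assert (CG : forall x, cont (fun y => G (x ^ 2 + y ^ 2)))
  by (intros; apply bdlip_cont, (bdlip_slice distR (fun p => G (fst p ^ 2 + snd p ^ 2))); auto using distR_refl).
assert (Cc : forall x, cont (fun y => G (x ^ 2 + y ^ 2) * cos (al * x + be * y)))
  by (intros; apply contM; auto; apply cont_cos_lin).
assert (sq_out : forall x, x <= - S \/ S <= x -> S ^ 2 <= x ^ 2) by (intros x [|]; nra).
(* The product of cosines is [cos (al * x + be * y) + sin (al * x) * sin (be * y)], and the second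
   term is odd in [y], so it integrates to 0. *)
assert (E1 : forall x, Int (fun y => G (x ^ 2 + y ^ 2) * (cos (al * x) * cos (be * y))) (- B) B =
  rho / be * Int (fun u => m (x, u)) (- B) B).
{ intros x.
  rewrite (Int_eq _ (fun y => G (x ^ 2 + y ^ 2) * cos (al * x + be * y) +
      sin (al * x) * (G (x ^ 2 + y ^ 2) * sin (be * y)))) by (intros y; rewrite cos_plus; ring).
  rewrite IntD, IntZ; auto.
  2: apply contM; auto; apply cont_sin_lin.
  2: apply contZ, contM; auto; apply cont_sin_lin.
  rewrite (Int_odd (fun y => G (x ^ 2 + y ^ 2) * sin (be * y))).
  2: apply contM; auto; apply cont_sin_lin.
  2: { intros y; replace (be * - y) with (- (be * y)) by ring; rewrite sin_neg.
    replace ((- y) ^ 2) with (y ^ 2) by ring; ring. }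
  rewrite Rmult_0_r, Rplus_0_r.
  assert (p0 : 0 < rho / be) by (apply Rdiv_lt_0_compat; auto).
  assert (key : forall u, x ^ 2 + (rho / be * u + - (al / be) * x) ^ 2 = u ^ 2 + ((al * u - rho * x) / be) ^ 2).
  { intros u.
    replace (x ^ 2 + (rho / be * u + - (al / be) * x) ^ 2) with
     ((be ^ 2 * x ^ 2 + rho ^ 2 * u ^ 2 - 2 * rho * al * u * x + al ^ 2 * x ^ 2) / be ^ 2) by (field; lra).
    replace (u ^ 2 + ((al * u - rho * x) / be) ^ 2) with
     ((be ^ 2 * u ^ 2 + al ^ 2 * u ^ 2 - 2 * al * rho * u * x + rho ^ 2 * x ^ 2) / be ^ 2) by (field; lra).
    rewrite rho2; f_equal; ring. }
  rewrite (Int_eq (fun u => m (x, u)) (fun u => G (x ^ 2 + (rho / be * u + - (al / be) * x) ^ 2) *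
      cos (al * x + be * (rho / be * u + - (al / be) * x)))).
  2: { intros u; unfold m; simpl fst; simpl snd; f_equal; f_equal; field; lra. }
  rewrite (Int_affine (fun y => G (x ^ 2 + y ^ 2) * cos (al * x + be * y))) by auto.
  (* The substitution does not map [[- B, B]] to itself. Beyond the ends of the image, however, [u]
     lies outside [[- B, B]], and [x ^ 2 + y ^ 2 >= u ^ 2], so that [G] vanishes there. *)
  assert (key' : forall y, x ^ 2 + y ^ 2 = ((be * y + al * x) / rho) ^ 2 + ((al * ((be * y + al * x) / rho) - rho * x) / be) ^ 2).
  { intros y; rewrite <- key; f_equal; f_equal; field; lra. }
  apply Int_supp; auto; try lra.
  - assert (rho / be * - B <= rho / be * B) by nra; lra.
  - intros y hy; rewrite G0; [ring|]; assert (S ^ 2 <= y ^ 2) by (apply sq_out; lra); nra.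
  - intros y hy; rewrite G0; [ring|]; assert (S ^ 2 <= y ^ 2) by (apply sq_out; lra); nra.
  - intros y hy; rewrite key', G0; [ring|].
    assert ((be * y + al * x) / rho <= - B).
    { replace (- B) with ((be * (rho / be * - B + - (al / be) * x) + al * x) / rho) by (field; lra).
      apply Rmult_le_compat_r; [left; apply Rinv_0_lt_compat; auto|nra]. }
    assert (S ^ 2 <= ((be * y + al * x) / rho) ^ 2) by (apply sq_out; lra).
    pose proof (pow2_ge_0 ((al * ((be * y + al * x) / rho) - rho * x) / be)); lra.
  - intros y hy; rewrite key', G0; [ring|].
    assert (B <= (be * y + al * x) / rho).
    { replace B with ((be * (rho / be * B + - (al / be) * x) + al * x) / rho) at 1 by (field; lra).
      apply Rmult_le_compat_r; [left; apply Rinv_0_lt_compat; auto|nra]. }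
    assert (S ^ 2 <= ((be * y + al * x) / rho) ^ 2) by (apply sq_out; lra).
    pose proof (pow2_ge_0 ((al * ((be * y + al * x) / rho) - rho * x) / be)); lra. }
rewrite (Int_eq _ _ _ _ E1), IntZ.
2: apply bdlip_cont, (bdlip_Int distR); auto using distR_refl; lra.
rewrite (fubini m) by (auto; lra).
rewrite <- IntZ.
2: { apply bdlip_cont, (bdlip_Int distR (fun p => m (snd p, fst p))); auto using distR_refl; [lra|].
  apply (bdlip_comp (distprod distR) (distprod distR) (fun p => (snd p, fst p)) m 1); auto; [lra|].
  intros; unfold distprod, distR; simpl; lra. }
apply Int_eq; intros u.
assert (p0 : 0 < be / rho) by (apply Rdiv_lt_0_compat; auto).
assert (Cx : cont (fun x => G (x ^ 2 + (rho / be * u + - (al / be) * x) ^ 2))).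
{ apply bdlip_cont, (bdlip_slice distR (fun p => G (snd p ^ 2 + (rho / be * fst p + - (al / be) * snd p) ^ 2))); auto using distR_refl.
  apply (bdlip_comp (distprod distR) (distprod distR) (fun p => (snd p, fst p))
     (fun p => G (fst p ^ 2 + (rho / be * snd p + - (al / be) * fst p) ^ 2)) 1); [lra| |].
  - intros; unfold distprod, distR; simpl; lra.
  - exact (bdlip_shear _ (rho / be) (- (al / be)) H). }
rewrite (Int_eq (fun x => m (x, u)) (fun x => cos (rho * u) * G (x ^ 2 + (rho / be * u + - (al / be) * x) ^ 2)))
  by (intros; unfold m; simpl fst; simpl snd; ring).
rewrite IntZ by auto.
assert (key : forall v, (be / rho * v + al / rho * u) ^ 2 +
   (rho / be * u + - (al / be) * (be / rho * v + al / rho * u)) ^ 2 = u ^ 2 + v ^ 2).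
{ intros v.
  replace (rho / be * u + - (al / be) * (be / rho * v + al / rho * u))
   with ((rho ^ 2 * u - al ^ 2 * u - al * be * v) / (rho * be)) by (field; lra).
  rewrite rho2.
  replace ((al ^ 2 + be ^ 2) * u - al ^ 2 * u - al * be * v) with (be * (be * u - al * v)) by ring.
  replace ((be / rho * v + al / rho * u) ^ 2 + (be * (be * u - al * v) / (rho * be)) ^ 2)
   with (((al ^ 2 + be ^ 2) * (u ^ 2 + v ^ 2)) / rho ^ 2) by (field; lra).
  rewrite <- rho2; field; lra. }
rewrite (Int_eq (fun v => G (u ^ 2 + v ^ 2)) (fun v =>
  (fun x => G (x ^ 2 + (rho / be * u + - (al / be) * x) ^ 2)) (be / rho * v + al / rho * u)))
  by (intros v; cbv beta; rewrite key; reflexivity).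
pose proof (Int_affine _ (be / rho) (al / rho * u) (- B) B Cx) as E.
assert (E' : Int (fun x => G (x ^ 2 + (rho / be * u + - (al / be) * x) ^ 2))
    (be / rho * - B + al / rho * u) (be / rho * B + al / rho * u) =
  Int (fun x => G (x ^ 2 + (rho / be * u + - (al / be) * x) ^ 2)) (- B) B).
{ assert (key' : forall x, x ^ 2 + (rho / be * u + - (al / be) * x) ^ 2 = u ^ 2 + ((rho * x - al * u) / be) ^ 2).
  { intros x; rewrite <- key; replace (be / rho * ((rho * x - al * u) / be) + al / rho * u) with x by (field; lra); reflexivity. }
  apply Int_supp; auto; try lra.
  - assert (be / rho * - B <= be / rho * B) by nra; lra.
  - intros x hx; rewrite key', G0; [ring|].
    assert ((rho * x - al * u) / be <= - B).
    { replace (- B) with ((rho * (be / rho * - B + al / rho * u) - al * u) / be) by (field; lra).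
      apply Rmult_le_compat_r; [left; apply Rinv_0_lt_compat; auto|nra]. }
    assert (S ^ 2 <= ((rho * x - al * u) / be) ^ 2) by (apply sq_out; lra).
    pose proof (pow2_ge_0 u); lra.
  - intros x hx; rewrite key', G0; [ring|].
    assert (B <= (rho * x - al * u) / be).
    { replace B with ((rho * (be / rho * B + al / rho * u) - al * u) / be) at 1 by (field; lra).
      apply Rmult_le_compat_r; [left; apply Rinv_0_lt_compat; auto|nra]. }
    assert (S ^ 2 <= ((rho * x - al * u) / be) ^ 2) by (apply sq_out; lra).
    pose proof (pow2_ge_0 u); lra.
  - intros x hx; rewrite G0; [ring|]; assert (S ^ 2 <= x ^ 2) by (apply sq_out; lra).
    pose proof (pow2_ge_0 (rho / be * u + - (al / be) * x)); lra.
  - intros x hx; rewrite G0; [ring|]; assert (S ^ 2 <= x ^ 2) by (apply sq_out; lra).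
    pose proof (pow2_ge_0 (rho / be * u + - (al / be) * x)); lra. }
(* The Jacobians [rho / be] and [be / rho] of the two substitutions cancel. *)
rewrite <- E', <- E; field; lra.
Qed.

(** * The transform of the truncated paraboloid *)

Definition pos (x : R) := Rmax 0 x.

Lemma pos_ge0 x : 0 <= pos x.
Proof. apply Rmax_l. Qed.

Lemma pos_eq x : 0 <= x -> pos x = x.
Proof. intros; apply Rmax_right; auto. Qed.

Lemma pos_eq0 x : x <= 0 -> pos x = 0.
Proof. intros; apply Rmax_left; auto. Qed.

Lemma pos_le x y : x <= y -> 0 <= y -> pos x <= y.
Proof. intros; apply Rmax_lub; auto. Qed.

(** Where the truncated parabola is positive, [|x| < S], so its slope is at most [2 * S] in absolute
    value. *)
Lemma pos_sq_lip S c x y : 0 <= S -> c <= S ^ 2 ->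
  Rabs (pos (c - x ^ 2) - pos (c - y ^ 2)) <= 2 * S * Rabs (x - y).
Proof.
intros S0.
assert (W : forall x y, c <= S ^ 2 -> Rabs x <= Rabs y ->
   Rabs (pos (c - x ^ 2) - pos (c - y ^ 2)) <= 2 * S * Rabs (x - y)).
{ clear x y; intros x y cS xy.
  assert (xy2 : x ^ 2 <= y ^ 2)
    by (rewrite <- (pow2_abs x), <- (pow2_abs y); pose proof (Rabs_pos x); nra).
  assert (T : Rabs y - Rabs x <= Rabs (x - y))
    by (rewrite Rabs_minus_sym; apply Rabs_triang_inv).
  pose proof (Rabs_pos x) as ax; pose proof (Rabs_pos (x - y)).
  rewrite <- (pow2_abs x), <- (pow2_abs y) in *.
  set (a := Rabs x) in *; set (b := Rabs y) in *.
  destruct (Rle_or_lt c (a ^ 2)).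
  { rewrite !pos_eq0, Rminus_diag, Rabs_R0 by nra; nra. }
  assert (aS : a <= S) by nra.
  rewrite (pos_eq (c - a ^ 2)) by lra.
  destruct (Rle_or_lt c (b ^ 2)).
  - rewrite (pos_eq0 (c - b ^ 2)), Rminus_0_r, Rabs_pos_eq by lra.
    destruct (Rle_or_lt b S); nra.
  - assert (b <= S) by nra.
    rewrite pos_eq, Rabs_pos_eq by lra; nra. }
intros cS; destruct (Rle_or_lt (Rabs x) (Rabs y)); auto.
rewrite Rabs_minus_sym, (Rabs_minus_sym x); apply W; auto; lra.
Qed.

Definition ball_bump Q (p : R * R * R) :=
  pos (Q - fst (fst p) ^ 2 - snd (fst p) ^ 2 - snd p ^ 2).

(** The three coordinates are changed one at a time, each change being controlled by
    [pos_sq_lip]. *)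
Lemma ball_bump_lip S p q : 0 < S ->
  Rabs (ball_bump (S ^ 2) p - ball_bump (S ^ 2) q) <= 2 * S * distprod (distprod distR) p q.
Proof.
intros S0; assert (S2 : 0 <= S ^ 2) by nra; revert p q.
intros [[x y] z] [[x' y'] z']; unfold ball_bump, distprod, distR; simpl fst; simpl snd.
  pose proof (Rabs_pos (x - x')); pose proof (Rabs_pos (y - y')); pose proof (Rabs_pos (z - z')).
  pose proof (pow2_ge_0 x); pose proof (pow2_ge_0 y); pose proof (pow2_ge_0 z).
  pose proof (pow2_ge_0 x'); pose proof (pow2_ge_0 y'); pose proof (pow2_ge_0 z').
  assert (A := pos_sq_lip S (S ^ 2 - x ^ 2 - y ^ 2) z z' ltac:(lra) ltac:(lra)).
  assert (A' := pos_sq_lip S (S ^ 2 - x ^ 2 - z' ^ 2) y y' ltac:(lra) ltac:(lra)).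
  assert (A'' := pos_sq_lip S (S ^ 2 - y' ^ 2 - z' ^ 2) x x' ltac:(lra) ltac:(lra)).
  replace (S ^ 2 - x ^ 2 - z' ^ 2 - y ^ 2) with (S ^ 2 - x ^ 2 - y ^ 2 - z' ^ 2) in A' by ring.
  replace (S ^ 2 - x ^ 2 - z' ^ 2 - y' ^ 2) with (S ^ 2 - x ^ 2 - y' ^ 2 - z' ^ 2) in A' by ring.
  replace (S ^ 2 - y' ^ 2 - z' ^ 2 - x ^ 2) with (S ^ 2 - x ^ 2 - y' ^ 2 - z' ^ 2) in A'' by ring.
  replace (S ^ 2 - y' ^ 2 - z' ^ 2 - x' ^ 2) with (S ^ 2 - x' ^ 2 - y' ^ 2 - z' ^ 2) in A'' by ring.
  set (u0 := pos (S ^ 2 - x ^ 2 - y ^ 2 - z ^ 2)) in *.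
  set (u1 := pos (S ^ 2 - x ^ 2 - y ^ 2 - z' ^ 2)) in *.
  set (u2 := pos (S ^ 2 - x ^ 2 - y' ^ 2 - z' ^ 2)) in *.
  set (u3 := pos (S ^ 2 - x' ^ 2 - y' ^ 2 - z' ^ 2)) in *.
  replace (u0 - u3) with ((u0 - u1) + ((u1 - u2) + (u2 - u3))) by ring.
  pose proof (Rabs_triang (u0 - u1) ((u1 - u2) + (u2 - u3))).
  pose proof (Rabs_triang (u1 - u2) (u2 - u3)).
  nra.
Qed.

Lemma bdlip_ball S : 0 < S -> bdlip (distprod (distprod distR)) (ball_bump (S ^ 2)).
Proof.
intros S0; exists (S ^ 2 + 2 * S).
assert (S2 : 0 <= S ^ 2) by nra.
split; [nra|split].
- intros [[x y] z]; unfold ball_bump; simpl fst; simpl snd; rewrite Rabs_pos_eq by apply pos_ge0.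
  pose proof (pow2_ge_0 x); pose proof (pow2_ge_0 y); pose proof (pow2_ge_0 z).
  pose proof (pos_le (S ^ 2 - x ^ 2 - y ^ 2 - z ^ 2) (S ^ 2)); lra.
- intros p q; apply Rle_trans with (1 := ball_bump_lip S p q S0).
  apply Rmult_le_compat_r; [|lra].
  unfold distprod, distR; pose proof (Rabs_pos (fst (fst p) - fst (fst q))).
  pose proof (Rabs_pos (snd (fst p) - snd (fst q))); pose proof (Rabs_pos (snd p - snd q)); lra.
Qed.

(** For [t >= 0], this is the integral of [t - v ^ 2] over [|v| <= sqrt t], see [Int_pos_sq]. *)
Definition pow32 t := 4 / 3 * (t * sqrt t).

(** With [a] and [b] the square roots, [b ^ 3 - a ^ 3] and [b ^ 2 - a ^ 2] share the factor [b - a];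
    comparing the cofactors avoids differentiating the square root at 0. *)
Lemma pow32_lip S s t : 0 <= S -> 0 <= s <= S ^ 2 -> 0 <= t <= S ^ 2 ->
  Rabs (pow32 s - pow32 t) <= 4 * S * Rabs (s - t).
Proof.
intros S0.
assert (W : forall s t, 0 <= s <= S ^ 2 -> 0 <= t <= S ^ 2 -> s <= t ->
  Rabs (pow32 s - pow32 t) <= 4 * S * Rabs (s - t)).
{ clear s t; intros s t hs ht st; unfold pow32.
  assert (hb : sqrt t <= S) by (rewrite <- (sqrt_pow2 S) by auto; apply sqrt_le_1_alt; lra).
  assert (hab := sqrt_le_1_alt _ _ st); assert (ha := sqrt_pos s).
  rewrite <- (pow2_sqrt s) at 1 3 by lra; rewrite <- (pow2_sqrt t) at 1 3 by lra.
  set (a := sqrt s) in *; set (b := sqrt t) in *.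
  assert (0 <= b ^ 2 - a ^ 2) by nra.
  assert (a ^ 3 <= b ^ 3) by (apply pow_incr; lra).
  rewrite (Rabs_minus_sym (a ^ 2)), (Rabs_minus_sym (4 / 3 * (a ^ 2 * a))), (Rabs_pos_eq (b ^ 2 - a ^ 2)) by auto.
  rewrite Rabs_pos_eq by nra.
  assert (b ^ 3 - a ^ 3 <= 2 * S * (b ^ 2 - a ^ 2)); [|nra].
  replace (b ^ 3 - a ^ 3) with ((b - a) * (a ^ 2 + a * b + b ^ 2)) by ring.
  replace (2 * S * (b ^ 2 - a ^ 2)) with ((b - a) * (2 * S * (a + b))) by ring.
  apply Rmult_le_compat_l; [lra|nra]. }
intros hs ht; destruct (Rle_or_lt s t); auto.
rewrite Rabs_minus_sym, (Rabs_minus_sym s); apply W; auto; lra.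
Qed.

Lemma bdlip_pow32 {T} (d : T -> T -> R) f S : 0 <= S -> (forall p, f p <= S ^ 2) ->
  bdlip d (fun p => pos (f p)) -> bdlip d (fun p => pow32 (pos (f p))).
Proof.
intros S0 fS [K [K0 [HK1 HK2]]]; exists ((4 * S + 1) * K).
assert (P0 : forall p, 0 <= pos (f p) <= S ^ 2)
  by (intros p; split; [apply pos_ge0|apply pos_le; [apply fS|nra]]).
assert (z : pow32 0 = 0) by (unfold pow32; ring).
split; [nra|split].
- intros p; rewrite <- (Rminus_0_r (pow32 _)), <- z.
  apply Rle_trans with (1 := pow32_lip S (pos (f p)) 0 S0 (P0 p) ltac:(nra)).
  rewrite Rminus_0_r; specialize (HK1 p); pose proof (Rabs_pos (pos (f p))); nra.
- intros p q; apply Rle_trans with (1 := pow32_lip S _ _ S0 (P0 p) (P0 q)).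
  specialize (HK2 p q); pose proof (Rabs_pos (pos (f p) - pos (f q))); nra.
Qed.

Lemma cont_pos_sq c : cont (fun v => pos (c - v ^ 2)).
Proof.
apply (cont_comp (fun v => c - v ^ 2) pos).
- apply contB; [apply cont_const|].
  apply (cont_ext (fun v => v * v)); [intros; ring|apply contM; apply cont_id].
- intros y; apply continuity_pt_filterlim; intros e he; exists e; split; auto.
  intros z [_ hz]; simpl in *; unfold Rdist in *; apply Rle_lt_trans with (2 := hz).
  unfold pos, Rmax; destruct (Rle_dec 0 z), (Rle_dec 0 y); unfold Rabs; repeat destruct Rcase_abs; lra.
Qed.

Lemma Int_ext (f g : R -> R) a b : a <= b -> (forall x, a < x < b -> f x = g x) -> Int f a b = Int g a b.
Proof.
intros ab H; apply RInt_ext; intros x; rewrite Rmin_left, Rmax_right by auto; apply H.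
Qed.

Lemma Int_pos_sq S c B : 0 < S <= B -> c <= S ^ 2 ->
  Int (fun v => pos (c - v ^ 2)) (- B) B = pow32 (pos c).
Proof.
intros SB cS; unfold pow32; destruct (Rle_or_lt c 0) as [c0|c0].
- rewrite (pos_eq0 c c0), (Int_eq _ (fun _ => 0)), Int_const; [ring|].
  intros x; apply pos_eq0; nra.
- assert (q0 := sqrt_lt_R0 c c0); assert (q2 := pow2_sqrt c ltac:(lra)).
  rewrite (pos_eq c) by lra.
  set (r := sqrt c) in *; clearbody r.
  rewrite (Int_supp _ _ _ (- r) r); try lra.
  + rewrite (Int_ext _ (fun v => c - v ^ 2)) by (try lra; intros; apply pos_eq; nra).
    assert (cv : cont (fun v => c - v ^ 2)).
    { apply contB; [apply cont_const|].
      apply (cont_ext (fun v => v * v)); [intros; ring|apply contM; apply cont_id]. }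
    rewrite (Int_FTC (fun v => c * v - v ^ 3 / 3)); auto.
    * rewrite <- q2; field.
    * intros x; auto_derive; auto; field.
  + apply cont_pos_sq.
  + intros x h; apply pos_eq0; nra.
  + intros x h; apply pos_eq0; nra.
  + intros x h; apply pos_eq0; nra.
  + intros x h; apply pos_eq0; nra.
Qed.

Lemma cont_pow32_sq S c : 0 <= S -> c <= S ^ 2 -> cont (fun v => pow32 (pos (c - v ^ 2))).
Proof.
intros S0 cS; apply bdlip_cont, (bdlip_pow32 distR (fun v => c - v ^ 2) S); auto.
- intros x; pose proof (pow2_ge_0 x); lra.
- exists (S ^ 2 + 2 * S); split; [pose proof (pow2_ge_0 S); lra|split].
  + intros x; rewrite Rabs_pos_eq by apply pos_ge0; pose proof (pow2_ge_0 x).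
    pose proof (pos_le (c - x ^ 2) (S ^ 2) ltac:(lra) (pow2_ge_0 S)); lra.
  + intros x y; apply Rle_trans with (1 := pos_sq_lip S c x y S0 cS).
    unfold distR; apply Rmult_le_compat_r; [apply Rabs_pos|pose proof (pow2_ge_0 S); lra].
Qed.

(** The integral of the paraboloid [1 - |x|^2] over the unit disc, that is [PI / 2]. *)
Definition ball_const := Int (fun t => pow32 (pos (1 - t ^ 2))) (- 1) 1.

Lemma ball_const_bound : Rabs ball_const <= 3.
Proof.
apply Rle_trans with ((1 - - 1) * (4 / 3)); [|lra].
apply Int_bound; [lra|apply (cont_pow32_sq 1); lra|].
intros t ht; unfold pow32.
assert (0 <= 1 - t ^ 2 <= 1) by nra.
rewrite pos_eq by lra.
pose proof (sqrt_pos (1 - t ^ 2)).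
assert (sqrt (1 - t ^ 2) <= 1) by (apply Rle_trans with (sqrt 1); [apply sqrt_le_1_alt; lra|rewrite sqrt_1; lra]).
rewrite Rabs_pos_eq; nra.
Qed.

(** Scaling the variable by [sqrt c] pulls out [c ^ (3/2)] from the integrand and [c ^ (1/2)] from
    the length. Thus integrating the paraboloid over two variables leaves the square of a truncated
    parabola. *)
Lemma Int_pow32_sq S c B : 0 < S <= B -> c <= S ^ 2 ->
  Int (fun v => pow32 (pos (c - v ^ 2))) (- B) B = ball_const * pos c ^ 2.
Proof.
intros SB cS; destruct (Rle_or_lt c 0) as [c0|c0].
- rewrite (pos_eq0 c c0), (Int_eq _ (fun _ => 0)), Int_const; [ring|].
  intros x; rewrite pos_eq0; [unfold pow32; ring|nra].
- assert (q0 := sqrt_lt_R0 c c0); assert (q2 := pow2_sqrt c ltac:(lra)).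
  rewrite (pos_eq c) by lra; set (r := sqrt c) in *.
  assert (cf := cont_pow32_sq S c ltac:(lra) cS).
  assert (z : forall x, c - x ^ 2 <= 0 -> pow32 (pos (c - x ^ 2)) = 0)
    by (intros x h; rewrite pos_eq0 by auto; unfold pow32; ring).
  rewrite (Int_supp _ _ _ (- r) r); try lra; auto.
  + pose proof (Int_affine _ r 0 (- 1) 1 cf) as E.
    replace (r * - 1 + 0) with (- r) in E by ring; replace (r * 1 + 0) with r in E by ring.
    rewrite <- E; unfold ball_const.
    rewrite (Int_eq _ (fun t => (c * r) * pow32 (pos (1 - t ^ 2)))).
    * rewrite IntZ; [rewrite <- q2; ring|apply (cont_pow32_sq 1); lra].
    * intros t; replace (c - (r * t + 0) ^ 2) with (c * (1 - t ^ 2)) by (rewrite <- q2; ring).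
      unfold pow32; destruct (Rle_or_lt (1 - t ^ 2) 0).
      -- rewrite !pos_eq0; nra.
      -- rewrite !pos_eq by nra; rewrite sqrt_mult by lra; fold r; ring.
  + intros x h; apply z; nra.
  + intros x h; apply z; nra.
  + intros x h; apply z; nra.
  + intros x h; apply z; nra.
Qed.

(** Repeated integration by parts gives the explicit primitive [A]. Since [(S ^ 2 - u ^ 2) ^ 2] has
    double zeros at the ends, the boundary terms start at order [rho ^ (-3)]; there are three of
    them, bounded by 16, 48 and 48 times [S ^ 2 / rho ^ 3]. *)
Lemma cos_transform_bound S rho B : 1 <= S <= B -> 1 <= rho ->
  Rabs (Int (fun u => cos (rho * u) * pos (S ^ 2 - u ^ 2) ^ 2) (- B) B) <= 112 * S ^ 2 / rho ^ 3.
Proof.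
intros SB r1.
assert (cf : cont (fun u => cos (rho * u) * pos (S ^ 2 - u ^ 2) ^ 2)).
{ apply contM; [apply bdlip_cont, bdlip_cos|].
  apply (cont_ext (fun v => pos (S ^ 2 - v ^ 2) * pos (S ^ 2 - v ^ 2))); [intros; ring|].
  apply contM; apply cont_pos_sq. }
rewrite (Int_supp _ _ _ (- S) S); auto; try lra.
2-5: intros x h; rewrite pos_eq0 by nra; ring.
rewrite (Int_ext _ (fun u => cos (rho * u) * (S ^ 2 - u ^ 2) ^ 2)).
2: lra.
2: intros x h; rewrite pos_eq by nra; reflexivity.
set (A := fun u => (S ^ 2 - u ^ 2) ^ 2 * sin (rho * u) / rho
  - 4 * u * (S ^ 2 - u ^ 2) * cos (rho * u) / rho ^ 2
  - (12 * u ^ 2 - 4 * S ^ 2) * sin (rho * u) / rho ^ 3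
  - 24 * u * cos (rho * u) / rho ^ 4 + 24 * sin (rho * u) / rho ^ 5).
rewrite (Int_FTC A).
- unfold A.
  replace ((- S) ^ 2) with (S ^ 2) by ring; rewrite Rminus_diag.
  replace (rho * - S) with (- (rho * S)) by ring; rewrite sin_neg, cos_neg.
  pose proof (SIN_bound (rho * S)) as hs; pose proof (COS_bound (rho * S)) as hc.
  set (s := sin (rho * S)) in *; set (c := cos (rho * S)) in *.
  match goal with |- Rabs ?X <= _ => replace X with
    ((- 16 * S ^ 2 * s - 48 * S * c / rho + 48 * s / rho ^ 2) / rho ^ 3) by (field; lra) end.
  unfold Rdiv at 1; rewrite Rabs_mult.
  rewrite (Rabs_pos_eq (/ _)) by (left; apply Rinv_0_lt_compat, pow_lt; lra).
  apply Rmult_le_compat_r; [left; apply Rinv_0_lt_compat, pow_lt; lra|].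
  assert (i1 : 0 < / rho <= 1).
  { split; [apply Rinv_0_lt_compat; lra|rewrite <- Rinv_1; apply Rinv_le_contravar; lra]. }
  assert (i2 : 0 < / rho ^ 2 <= 1).
  { split; [apply Rinv_0_lt_compat, pow_lt; lra|rewrite <- Rinv_1; apply Rinv_le_contravar; nra]. }
  unfold Rdiv.
  assert (b1 : Rabs (- 16 * S ^ 2 * s) <= 16 * S ^ 2) by (apply Rabs_le; split; nra).
  assert (b2 : Rabs (48 * S * c * / rho) <= 48 * S ^ 2).
  { rewrite !Rabs_mult, (Rabs_pos_eq 48), (Rabs_pos_eq S), (Rabs_pos_eq (/ rho)) by lra.
    assert (Rabs c <= 1) by (apply Rabs_le; lra); pose proof (Rabs_pos c).
    assert (Rabs c * / rho <= 1) by nra.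
    assert (0 <= Rabs c * / rho) by nra. rewrite Rmult_assoc; nra. }
  assert (b3 : Rabs (48 * s * / rho ^ 2) <= 48 * S ^ 2).
  { rewrite !Rabs_mult, (Rabs_pos_eq 48), (Rabs_pos_eq (/ rho ^ 2)) by lra.
    assert (Rabs s <= 1) by (apply Rabs_le; lra); pose proof (Rabs_pos s).
    assert (Rabs s * / rho ^ 2 <= 1) by nra. rewrite Rmult_assoc; nra. }
  apply Rle_trans with (1 := Rabs_triang _ _).
  pose proof (Rabs_triang (- 16 * S ^ 2 * s) (- (48 * S * c * / rho))) as T.
  rewrite Rabs_Ropp in T; unfold Rminus; lra.
- apply contM; [apply bdlip_cont, bdlip_cos|].
  apply (cont_ext (fun v => (S ^ 2 - v * v) * (S ^ 2 - v * v))); [intros; ring|].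
  assert (cont (fun v => S ^ 2 - v * v)) by (apply contB; [apply cont_const|apply contM; apply cont_id]).
  apply contM; auto.
- intros x; unfold A; auto_derive; auto; field; lra.
Qed.

(** A first rotation, at fixed [x], takes [(q2, q3)] to [(r1, 0)]; a second one takes [(q1, r1)] to
    [(rho, 0)]. After each, the variable free of oscillation is integrated out. As [rho] is the norm
    of the frequency, it exceeds each [q], so [rho ^ 3 >= q1 * q2 * q3]; the constant is
    [336 = 3 * 112]. *)
Lemma ball_transform_bound S B q1 q2 q3 : 1 <= S <= B -> 1 <= q1 -> 1 <= q2 -> 1 <= q3 ->
  Rabs (Int (fun x => Int (fun y => Int (fun z =>
     ball_bump (S ^ 2) (x, y, z) * (cos (q1 * x) * (cos (q2 * y) * cos (q3 * z)))) (- B) B) (- B) B) (- B) B)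
   <= 336 * S ^ 2 / (q1 * q2 * q3).
Proof.
intros SB h1 h2 h3.
assert (HF := bdlip_ball S ltac:(lra)).
assert (D0 := distprod_refl distR distR_refl).
assert (S2 : 0 <= S ^ 2) by nra.
assert (Cz : forall x y, cont (fun z => ball_bump (S ^ 2) (x, y, z)))
  by (intros x y; apply bdlip_cont; exact (bdlip_slice (distprod distR) _ (x, y) D0 HF)).
set (r1 := sqrt (q2 ^ 2 + q3 ^ 2)).
assert (r1sq : r1 ^ 2 = q2 ^ 2 + q3 ^ 2) by (apply pow2_sqrt; nra).
assert (r10 : 0 < r1) by (apply sqrt_lt_R0; nra).
assert (E1 : forall x, Int (fun y => Int (fun z =>
     ball_bump (S ^ 2) (x, y, z) * (cos (q1 * x) * (cos (q2 * y) * cos (q3 * z)))) (- B) B) (- B) B =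
   Int (fun u => pow32 (pos (S ^ 2 - (x ^ 2 + u ^ 2))) * (cos (q1 * x) * cos (r1 * u))) (- B) B).
{ intros x.
  assert (Hx : bdlip (distprod distR) (fun p => ball_bump (S ^ 2) (x, fst p, snd p))).
  { apply (bdlip_comp (distprod distR) (distprod (distprod distR)) (fun p => (x, fst p, snd p)) (ball_bump (S ^ 2)) 1); auto; [lra|].
    intros p q; unfold distprod, distR; simpl; rewrite Rminus_diag, Rabs_R0; lra. }
  set (G := fun r => pos (S ^ 2 - x ^ 2 - r)).
  assert (HG : bdlip (distprod distR) (fun p => G (fst p ^ 2 + snd p ^ 2))).
  { apply (bdlip_ext _ (fun p => ball_bump (S ^ 2) (x, fst p, snd p))); auto.
    intros p; unfold ball_bump, G; simpl fst; simpl snd; f_equal; ring. }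
  rewrite (Int_eq _ (fun y => cos (q1 * x) * Int (fun z => G (y ^ 2 + z ^ 2) * (cos (q2 * y) * cos (q3 * z))) (- B) B)).
  2: { intros y; rewrite <- IntZ.
    - apply Int_eq; intros z; unfold ball_bump, G; simpl fst; simpl snd.
      replace (S ^ 2 - x ^ 2 - (y ^ 2 + z ^ 2)) with (S ^ 2 - x ^ 2 - y ^ 2 - z ^ 2) by ring; ring.
    - apply contM.
      + apply bdlip_cont; exact (bdlip_slice distR _ y distR_refl HG).
      + apply contZ, bdlip_cont, bdlip_cos. }
  assert (HGc : bdlip (distprod distR) (fun p => G (fst p ^ 2 + snd p ^ 2) * (cos (q2 * fst p) * cos (q3 * snd p)))).
  { apply (bdlip_mul (distprod distR) (fun p => G (fst p ^ 2 + snd p ^ 2)) (fun p => cos (q2 * fst p) * cos (q3 * snd p))); auto.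
    apply (bdlip_mul (distprod distR) (fun p => cos (q2 * fst p)) (fun p => cos (q3 * snd p))).
    - exact (bdlip_fst distR _ (bdlip_cos q2)).
    - exact (bdlip_snd distR _ distR_ge0 (bdlip_cos q3)). }
  rewrite IntZ.
  2: { apply bdlip_cont; exact (bdlip_Int distR _ (- B) B distR_refl ltac:(lra) HGc). }
  rewrite (Int_rotate G S q2 q3 B); auto; try lra.
  2: { intros r hr; apply pos_eq0; pose proof (pow2_ge_0 x); lra. }
  fold r1.
  rewrite <- IntZ.
  2: { apply contM; [apply bdlip_cont, bdlip_cos|apply bdlip_cont; exact (bdlip_Int distR _ (- B) B distR_refl ltac:(lra) HG)]. }
  apply Int_eq; intros u.
  rewrite (Int_eq (fun v => G (u ^ 2 + v ^ 2)) (fun v => pos (S ^ 2 - (x ^ 2 + u ^ 2) - v ^ 2)))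
    by (intros v; unfold G; f_equal; ring).
  rewrite (Int_pos_sq S); try lra.
  pose proof (pow2_ge_0 x); pose proof (pow2_ge_0 u); lra. }
rewrite (Int_eq _ _ _ _ E1).
assert (H2 : bdlip (distprod distR) (fun p => (fun r => pow32 (pos (S ^ 2 - r))) (fst p ^ 2 + snd p ^ 2))).
{ apply (bdlip_pow32 (distprod distR) (fun p => S ^ 2 - (fst p ^ 2 + snd p ^ 2)) S); [lra| |].
  - intros p; pose proof (pow2_ge_0 (fst p)); pose proof (pow2_ge_0 (snd p)); lra.
  - apply (bdlip_ext _ (fun p => ball_bump (S ^ 2) (fst p, snd p, 0))).
    + intros p; unfold ball_bump; simpl fst; simpl snd; f_equal; ring.
    + apply (bdlip_comp (distprod distR) (distprod (distprod distR)) (fun p => (fst p, snd p, 0)) (ball_bump (S ^ 2)) 1); auto; [lra|].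
      intros p q; unfold distprod, distR; simpl; rewrite Rminus_diag, Rabs_R0; lra. }
rewrite (Int_rotate (fun r => pow32 (pos (S ^ 2 - r))) S q1 r1 B); auto; try lra.
2: { intros r hr; rewrite pos_eq0 by lra; unfold pow32; ring. }
set (rho := sqrt (q1 ^ 2 + r1 ^ 2)).
assert (rsq : rho ^ 2 = q1 ^ 2 + r1 ^ 2) by (apply pow2_sqrt; nra).
assert (rho0 : 0 < rho) by (apply sqrt_lt_R0; nra).
rewrite r1sq in rsq.
rewrite (Int_eq _ (fun u => ball_const * (cos (rho * u) * pos (S ^ 2 - u ^ 2) ^ 2))).
2: { intros u.
  rewrite (Int_eq _ (fun v => pow32 (pos (S ^ 2 - u ^ 2 - v ^ 2))))
    by (intros v; do 2 f_equal; ring).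
  rewrite (Int_pow32_sq S); [ring|lra|pose proof (pow2_ge_0 u); lra]. }
rewrite IntZ.
2: { apply contM; [apply bdlip_cont, bdlip_cos|].
  apply (cont_ext (fun v => pos (S ^ 2 - v ^ 2) * pos (S ^ 2 - v ^ 2))); [intros; ring|].
  apply contM; apply cont_pos_sq. }
rewrite Rabs_mult.
assert (q1r : q1 <= rho) by nra.
assert (q2r : q2 <= rho) by nra.
assert (q3r : q3 <= rho) by nra.
assert (T := cos_transform_bound S rho B SB ltac:(lra)).
pose proof ball_const_bound as hC; pose proof (Rabs_pos ball_const) as hC0.
assert (U : 112 * S ^ 2 / rho ^ 3 <= 112 * S ^ 2 / (q1 * q2 * q3)).
{ apply Rmult_le_compat_l; [lra|]; apply Rinv_le_contravar.
  - apply Rmult_lt_0_compat; [nra|lra].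
  - replace (rho ^ 3) with (rho * rho * rho) by ring.
    apply Rmult_le_compat; try lra; [nra|]; apply Rmult_le_compat; lra. }
apply Rle_trans with (3 * (112 * S ^ 2 / (q1 * q2 * q3))); [|right; field; lra].
apply Rmult_le_compat; auto; [apply Rabs_pos|lra].
Qed.

(** * Powers of the cosine as an alternating kernel *)

(** The Wallis integral, which normalises the kernel; the quotient [moment n / mass n] measures how
    far the kernel spreads around a lattice point. *)
Definition mass n := Int (fun t => cos t ^ n) (- (PI / 2)) (PI / 2).
Definition moment n := Int (fun t => Rabs t * cos t ^ n) (- (PI / 2)) (PI / 2).

(* [coef n j = 'C(n, j) / 2 ^ n]. *)
Fixpoint coef (n j : nat) : R :=
  match n, j with
  | O, O => 1
  | O, S _ => 0
  | S m, O => coef m 0 / 2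
  | S m, S i => (coef m i + coef m (S i)) / 2
  end.

Lemma coef_out n j : (n < j)%nat -> coef n j = 0.
Proof.
revert j; induction n as [|n IH]; intros [|j] H; simpl; try lia; auto.
rewrite !IH by lia; field.
Qed.

Lemma coef_sum n (g : nat -> R) :
  sum_f_R0 (fun j => coef (S n) j * g j) (S n) =
  (sum_f_R0 (fun j => coef n j * g j) n + sum_f_R0 (fun j => coef n j * g (S j)) n) / 2.
Proof.
rewrite (decomp_sum (fun j => coef (S n) j * g j)) by lia; simpl pred.
assert (E : sum_f_R0 (fun j => coef n j * g j) n =
  coef n 0 * g 0%nat + sum_f_R0 (fun j => coef n (S j) * g (S j)) n).
{ replace (coef n 0 * g 0%nat + sum_f_R0 (fun j => coef n (S j) * g (S j)) n) with (sum_f_R0 (fun j => coef n j * g j) (S n))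
    by (rewrite (decomp_sum (fun j => coef n j * g j)) by lia; reflexivity).
  rewrite tech5, coef_out by lia; ring. }
rewrite E.
replace (sum_f_R0 (fun j => coef (S n) (S j) * g (S j)) n) with
  ((sum_f_R0 (fun j => coef n j * g (S j)) n + sum_f_R0 (fun j => coef n (S j) * g (S j)) n) / 2).
{ simpl; field. }
rewrite <- sum_plus; unfold Rdiv; rewrite Rmult_comm, scal_sum.
apply sum_eq; intros i _; simpl; field.
Qed.

Lemma cos_pow_expand n t :
  cos t ^ n = sum_f_R0 (fun j => coef n j * cos ((INR n - 2 * INR j) * t)) n.
Proof.
induction n as [|n IH].
- simpl; replace ((0 - 2 * 0) * t) with 0 by ring; rewrite cos_0; ring.
- rewrite (coef_sum n (fun j => cos ((INR (S n) - 2 * INR j) * t))).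
  rewrite <- sum_plus; simpl pow; rewrite IH.
  unfold Rdiv; rewrite (Rmult_comm _ (/ 2)), !scal_sum.
  apply sum_eq; intros i _; rewrite !S_INR.
  replace ((INR n + 1 - 2 * INR i) * t) with ((INR n - 2 * INR i) * t + t) by ring.
  replace ((INR n + 1 - 2 * (INR i + 1)) * t) with ((INR n - 2 * INR i) * t - t) by ring.
  rewrite cos_plus, cos_minus; field.
Qed.

Lemma cont_cos_pow n : cont (fun t => cos t ^ n).
Proof.
induction n; simpl; [apply cont_const|].
apply (contM cos (fun t => cos t ^ n)); auto.
intros x; apply continuous_cos.
Qed.

Lemma cont_cos c : cont (fun t => cos (c * t)).
Proof. apply bdlip_cont, bdlip_cos. Qed.

Lemma cos_ge0_half t : - (PI / 2) <= t <= PI / 2 -> 0 <= cos t.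
Proof. intros; apply cos_ge_0; lra. Qed.

Lemma half_le : - (PI / 2) <= PI / 2.
Proof. pose proof PI_RGT_0; lra. Qed.

Definition cos_moment n q := Int (fun t => cos t ^ n * cos (q * t)) (- (PI / 2)) (PI / 2).

Lemma cos_moment_S n q : cos_moment (S n) q = (cos_moment n (q + 1) + cos_moment n (q - 1)) / 2.
Proof.
unfold cos_moment.
match goal with |- _ = ?X / 2 => replace (X / 2) with (/ 2 * X) by field end.
rewrite <- IntD, <- IntZ.
- apply Int_eq; intros t; simpl pow.
  replace ((q + 1) * t) with (q * t + t) by ring; replace ((q - 1) * t) with (q * t - t) by ring.
  rewrite cos_plus, cos_minus; field.
- apply contD; apply contM; auto using cont_cos_pow, cont_cos.
- apply contM; auto using cont_cos_pow, cont_cos.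
- apply contM; auto using cont_cos_pow, cont_cos.
Qed.

Lemma sin_INR_PI k : sin (INR k * PI) = 0.
Proof. apply sin_eq_0_1; exists (Z.of_nat k); rewrite <- INR_IZR_INZ; reflexivity. Qed.

Lemma cos_moment_0 k : cos_moment 0 (2 * INR (S k)) = 0.
Proof.
unfold cos_moment; set (q := 2 * INR (S k)).
assert (q0 : q <> 0) by (unfold q; rewrite S_INR; pose proof (pos_INR k); lra).
rewrite (Int_eq _ (fun t => cos (q * t))) by (intros; simpl; ring).
rewrite (Int_FTC (fun t => sin (q * t) / q)).
- replace (q * - (PI / 2)) with (- (q * (PI / 2))) by ring; rewrite sin_neg.
  replace (q * (PI / 2)) with (INR (S k) * PI) by (unfold q; field).
  rewrite sin_INR_PI; field; auto.
- apply cont_cos.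
- intros x; auto_derive; auto; field; auto.
Qed.

(** The product formula for cosines lowers the exponent to 0 and leaves nonzero even frequencies,
    whose cosines integrate to 0 over a length [PI]. *)
Lemma cos_moment_out n i : cos_moment n (INR n + 2 * INR (S i)) = 0.
Proof.
revert i; induction n as [|n IH]; intros i.
- simpl (INR 0); rewrite Rplus_0_l; apply cos_moment_0.
- rewrite cos_moment_S.
  replace (INR (S n) + 2 * INR (S i) + 1) with (INR n + 2 * INR (S (S i))) by (rewrite !S_INR; ring).
  replace (INR (S n) + 2 * INR (S i) - 1) with (INR n + 2 * INR (S i)) by (rewrite (S_INR n); ring).
  rewrite !IH; field.
Qed.

(** The recursion [cos_moment_S] is Pascal's rule for [coef], so the coefficients of the expansion
    of the cosine power are its Fourier integrals over half a period. *)
Lemma cos_moment_coef n j : cos_moment n (INR n - 2 * INR j) = PI * coef n j.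
Proof.
revert j; induction n as [|n IH]; intros j.
- destruct j as [|j].
  + unfold cos_moment; rewrite (Int_eq _ (fun _ => 1)), Int_const; [simpl; field|].
    intros t; simpl; replace ((0 - 2 * 0) * t) with 0 by ring; rewrite cos_0; ring.
  + transitivity (cos_moment 0 (2 * INR (S j))); [|rewrite cos_moment_0; simpl; ring].
    apply Int_eq; intros t; rewrite <- (cos_neg (_ * t)).
    replace (- ((INR 0 - 2 * INR (S j)) * t)) with (2 * INR (S j) * t) by (simpl (INR 0); ring).
    reflexivity.
- rewrite cos_moment_S.
  replace (INR (S n) - 2 * INR j - 1) with (INR n - 2 * INR j) by (rewrite S_INR; ring).
  destruct j as [|j].
  + replace (INR (S n) - 2 * INR 0 + 1) with (INR n + 2 * INR 1) by (rewrite (S_INR n), INR_1; simpl (INR 0); ring).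
    rewrite cos_moment_out, IH; simpl; field.
  + replace (INR (S n) - 2 * INR (S j) + 1) with (INR n - 2 * INR j) by (rewrite !S_INR; ring).
    rewrite !IH; simpl; field.
Qed.

(** The cosine is nonnegative on the interval of integration, so every Fourier integral is at most
    the mass. After normalisation by the mass, all coefficients are bounded by [1 / PI], uniformly
    in [n]. *)
Lemma coef_bound n j : Rabs (coef n j) <= mass n / PI.
Proof.
pose proof PI_RGT_0 as pi0.
assert (cP := fun q => contM _ _ (cont_cos_pow n) (cont_cos q)).
assert (E : Rabs (cos_moment n (INR n - 2 * INR j)) <= mass n).
{ unfold cos_moment, mass.
  assert (H : forall t, - (PI / 2) <= t <= PI / 2 ->
     Rabs (cos t ^ n * cos ((INR n - 2 * INR j) * t)) <= cos t ^ n).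
  { intros t ht; rewrite Rabs_mult, Rabs_pos_eq by (apply pow_le, cos_ge0_half; auto).
    assert (0 <= cos t ^ n) by (apply pow_le, cos_ge0_half; auto).
    assert (Rabs (cos ((INR n - 2 * INR j) * t)) <= 1) by (apply Rabs_le, COS_bound); nra. }
  apply Rabs_le; split.
  - replace (- Int (fun t => cos t ^ n) (- (PI / 2)) (PI / 2)) with
      (Int (fun t => (-1) * cos t ^ n) (- (PI / 2)) (PI / 2)) by (rewrite IntZ; [ring|apply cont_cos_pow]).
    apply Int_le; auto using half_le, contZ, cont_cos_pow.
    intros t ht; specialize (H t ht); apply Rabs_le_between in H; lra.
  - apply Int_le; auto using half_le, cont_cos_pow.
    intros t ht; specialize (H t ht); apply Rabs_le_between in H; lra. }
rewrite cos_moment_coef, Rabs_mult, Rabs_pos_eq in E by lra.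
apply Rmult_le_reg_l with PI; auto.
replace (PI * (mass n / PI)) with (mass n) by (field; lra); auto.
Qed.

(* Wallis' recursion, from the derivative of [sin t * cos t ^ (S n)]. *)
Lemma mass_rec n : (INR n + 2) * mass (S (S n)) = (INR n + 1) * mass n.
Proof.
unfold mass; rewrite <- !IntZ by apply cont_cos_pow.
apply Rminus_diag_uniq; rewrite <- IntB by (apply contZ, cont_cos_pow).
rewrite (Int_FTC (fun t => sin t * cos t ^ S n)).
- simpl; rewrite cos_neg, cos_PI2; ring.
- apply contB; apply contZ, cont_cos_pow.
- intros t; auto_derive; auto; simpl pred; pose proof (S_INR n) as E0; simpl INR in E0; rewrite E0.
  assert (E : sin t * sin t = 1 - cos t * cos t) by (pose proof (sin2_cos2 t); unfold Rsqr in *; lra).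
  simpl pow; transitivity (cos t * (cos t * cos t ^ n) - (INR n + 1) * (sin t * sin t) * cos t ^ n);
   [ring|rewrite E; ring].
Qed.

(** By Wallis' recursion and [(2x+2)^2 >= (2x+1)(2x+3)], the quantity on the right does not decrease
    with [D], and it equals 4 at [D = 0]. So the mass is at least of order [D ^ (-1/2)], while the
    first moment is of order [1 / D]. *)
Lemma mass_lower D : 0 < mass (2 * D + 1) /\ 4 <= mass (2 * D + 1) ^ 2 * (2 * INR D + 1).
Proof.
induction D as [|D [IH0 IH]].
- assert (E : mass (2 * 0 + 1) = 2).
  { unfold mass; simpl; rewrite (Int_eq _ cos) by (intros; ring).
    rewrite (Int_FTC sin); [rewrite sin_neg, sin_PI2; ring| |].
    - intros x; apply continuous_cos.
    - intros x; apply is_derive_sin. }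
  rewrite E; simpl; lra.
- pose proof (mass_rec (2 * D + 1)) as E.
  replace (2 * S D + 1)%nat with (S (S (2 * D + 1))) by lia.
  rewrite S_INR; rewrite plus_INR, mult_INR in E; simpl INR in E; pose proof (pos_INR D) as d0.
  set (u := mass (S (S (2 * D + 1)))) in *; set (w := mass (2 * D + 1)) in *; set (x := INR D) in *.
  assert (Eu : u = (2 * x + 2) / (2 * x + 3) * w).
  { apply Rmult_eq_reg_l with (2 * x + 3); [|lra].
    transitivity ((2 * x + 2) * w); [nra|field; lra]. }
  split.
  + rewrite Eu; apply Rmult_lt_0_compat; auto; apply Rdiv_lt_0_compat; lra.
  + apply Rle_trans with (1 := IH).
    replace (u ^ 2 * (2 * (x + 1) + 1)) with (w ^ 2 * ((2 * x + 2) ^ 2 / (2 * x + 3))) by (rewrite Eu; field; lra).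
    apply Rmult_le_compat_l; [apply pow2_ge_0|].
    apply Rmult_le_reg_r with (2 * x + 3); [lra|].
    unfold Rdiv; rewrite Rmult_assoc, Rinv_l by lra; nra.
Qed.

Lemma t_cos_le_sin t : 0 <= t <= PI / 2 -> t * cos t <= sin t.
Proof.
intros ht.
assert (c : cont (fun x => x * sin x)) by (apply contM; [apply cont_id|intros x; apply continuous_sin]).
assert (E : Int (fun x => x * sin x) 0 t = sin t - t * cos t).
{ rewrite (Int_FTC (fun x => sin x - x * cos x)); auto.
  - rewrite sin_0; ring.
  - intros x; auto_derive; auto; ring. }
assert (0 <= Int (fun x => x * sin x) 0 t); [|lra].
replace 0 with (Int (fun _ => 0) 0 t) at 1 by (rewrite Int_const; ring).
apply Int_le; auto using cont_const; [lra|].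
intros x hx; pose proof (sin_ge_0 x); nra.
Qed.

(** One factor of the cosine is spent on [t * cos t <= sin t], which leaves the exact derivative
    [sin t * cos t ^ n]. Each half of the interval gives [1 / (n + 1)]. *)
Lemma moment_upper n : moment (S n) <= 2 / (INR n + 1).
Proof.
pose proof PI_RGT_0 as pi0; pose proof (pos_INR n).
assert (ca : cont Rabs) by (intros x; apply continuity_pt_filterlim, Rcontinuity_abs).
assert (c : cont (fun t => Rabs t * cos t ^ S n)) by (apply contM; [auto|apply cont_cos_pow]).
assert (cs : cont (fun t => sin t * cos t ^ n)) by (apply contM; [intros x; apply continuous_sin|apply cont_cos_pow]).
assert (P : forall t, is_derive (fun t => - cos t ^ S n / (INR n + 1)) t (sin t * cos t ^ n)).
{ intros t; auto_derive; auto; simpl pred; pose proof (S_INR n) as E0; simpl INR in E0; rewrite E0; field; lra. }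
unfold moment; rewrite <- (Int_cat _ _ 0 _ c).
assert (A : Int (fun t => Rabs t * cos t ^ S n) 0 (PI / 2) <= 1 / (INR n + 1)).
{ apply Rle_trans with (Int (fun t => sin t * cos t ^ n) 0 (PI / 2)).
  - apply Int_le; auto; [lra|]; intros t ht; rewrite Rabs_pos_eq by lra; simpl pow.
    assert (0 <= cos t ^ n) by (apply pow_le, cos_ge0_half; lra).
    pose proof (t_cos_le_sin t ht); nra.
  - rewrite (Int_FTC _ _ _ _ cs P); rewrite cos_PI2, cos_0, pow1, pow_i by lia; right; field; lra. }
assert (B : Int (fun t => Rabs t * cos t ^ S n) (- (PI / 2)) 0 <= 1 / (INR n + 1)).
{ apply Rle_trans with (Int (fun t => (-1) * (sin t * cos t ^ n)) (- (PI / 2)) 0).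
  - apply Int_le; auto using contZ; [lra|]; intros t ht; rewrite Rabs_left1 by lra; simpl pow.
    assert (0 <= cos t ^ n) by (apply pow_le, cos_ge0_half; lra).
    pose proof (t_cos_le_sin (- t) ltac:(lra)) as T; rewrite cos_neg, sin_neg in T; nra.
  - rewrite IntZ by auto; rewrite (Int_FTC _ _ _ _ cs P).
    rewrite cos_neg, cos_PI2, cos_0, pow1, pow_i by lia; right; field; lra. }
unfold Rdiv in *; lra.
Qed.

(** The sum of [1 / |q|] over the odd integers [q] with [|q| <= 2 * D + 1], which are the
    frequencies of the kernel. *)
Definition freq_sum D := sum_f_R0 (fun j => / Rabs (INR (2 * D + 1) - 2 * INR j)) (2 * D + 1).

Lemma freq_sum_bound D : freq_sum D <= 2 + ln (2 * INR D + 1).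
Proof.
induction D as [|D IH].
- unfold freq_sum; simpl; rewrite Rmult_0_r, Rplus_0_l, ln_1.
  rewrite (Rabs_pos_eq (1 - 0)), (Rabs_left1 (1 - 2 * 1)) by lra.
  replace (1 - 0) with 1 by ring; replace (- (1 - 2 * 1)) with 1 by ring; lra.
- pose proof (pos_INR D) as d0.
  assert (E : freq_sum (S D) = freq_sum D + 2 / (2 * INR D + 3)).
  { unfold freq_sum; replace (2 * S D + 1)%nat with (S (S (2 * D + 1))) by lia.
    rewrite tech5, decomp_sum by lia; simpl pred.
    rewrite (sum_eq (fun i => / Rabs (INR (S (S (2 * D + 1))) - 2 * INR (S i)))
       (fun j => / Rabs (INR (2 * D + 1) - 2 * INR j))).
    2: { intros i _; rewrite !S_INR; do 2 f_equal; ring. }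
    change (D + (D + 0) + 1)%nat with (2 * D + 1)%nat.
    set (s := sum_f_R0 (fun j : nat => / Rabs (INR (2 * D + 1) - 2 * INR j)) (2 * D + 1)).
    assert (N : INR (S (S (2 * D + 1))) = 2 * INR D + 3)
      by (rewrite !S_INR, plus_INR, mult_INR; simpl INR; ring).
    rewrite N; change (INR 0) with 0.
    rewrite (Rabs_pos_eq (_ - 2 * 0)), (Rabs_left1 (_ - 2 * (_ + 3))) by lra.
    field; lra. }
  rewrite E, S_INR.
  (* The inequality [ln (1 - x) <= - x] at [x = 2 / (2D + 3)], where [1 - x = (2D + 1) / (2D + 3)];
     the logarithms then telescope. *)
  assert (L : 2 / (2 * INR D + 3) <= ln (2 * (INR D + 1) + 1) - ln (2 * INR D + 1)).
  { rewrite <- ln_div by lra.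
    rewrite <- (Ropp_involutive (ln _)), <- ln_Rinv by (apply Rdiv_lt_0_compat; lra).
    assert (X : ln (/ ((2 * (INR D + 1) + 1) / (2 * INR D + 1))) <= - (2 / (2 * INR D + 3))).
    { replace (/ ((2 * (INR D + 1) + 1) / (2 * INR D + 1))) with (1 + - (2 / (2 * INR D + 3))) by (field; lra).
      pose proof (exp_ineq1_le (- (2 / (2 * INR D + 3)))) as T.
      rewrite <- (ln_exp (- (2 / (2 * INR D + 3)))) at 2.
      apply ln_le; auto.
      assert (2 / (2 * INR D + 3) < 1); [|lra].
      apply Rmult_lt_reg_r with (2 * INR D + 3); [lra|unfold Rdiv; rewrite Rmult_assoc, Rinv_l; lra]. }
    lra. }
  lra.
Qed.

(** * Alternating lattice sums as integrals *)

(* The lattice is [PI * Z], so that the characters of sign change are cosines of odd frequency. *)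
Fixpoint altsum (f : R -> R) (L : nat) : R :=
  match L with
  | O => f 0
  | S l => altsum f l + (-1) ^ S l * (f (INR (S l) * PI) + f (- (INR (S l) * PI)))
  end.

Lemma altsum_S f l : altsum f (S l) =
  altsum f l + (-1) ^ S l * (f (INR (S l) * PI) + f (- (INR (S l) * PI))).
Proof. reflexivity. Qed.

(** Half a step beyond the last lattice point, so that [[- radius L, radius L]] splits into
    [2 * L + 1] cells centred at the lattice points. *)
Definition radius (L : nat) := INR L * PI + PI / 2.

Lemma radius_ge0 L : 0 < radius L.
Proof. unfold radius; pose proof PI_RGT_0; pose proof (pos_INR L); nra. Qed.

Lemma altsumB f g L : altsum (fun x => f x - g x) L = altsum f L - altsum g L.
Proof. induction L as [|L IH]; [simpl; ring|rewrite !altsum_S, IH; ring]. Qed.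

Lemma altsumZ c f L : altsum (fun x => c * f x) L = c * altsum f L.
Proof. induction L as [|L IH]; [simpl; ring|rewrite !altsum_S, IH; ring]. Qed.

Lemma altsum_bound f M L : (forall x, Rabs (f x) <= M) -> Rabs (altsum f L) <= (2 * INR L + 1) * M.
Proof.
intros H; induction L as [|L IH]; [|rewrite altsum_S].
- simpl; rewrite Rmult_0_r, Rplus_0_l, Rmult_1_l; auto.
- apply Rle_trans with (1 := Rabs_triang _ _); rewrite Rabs_mult, S_INR, pow_1_abs.
  set (u := (INR L + 1) * PI).
  pose proof (Rabs_triang (f u) (f (- u))); pose proof (H u); pose proof (H (- u)); lra.
Qed.

Lemma cos_shift t k : cos (t + INR k * PI) = (-1) ^ k * cos t.
Proof.
induction k as [|k IH]; [simpl; rewrite Rmult_0_l, Rplus_0_r; ring|].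
rewrite S_INR; replace (t + (INR k + 1) * PI) with (t + INR k * PI + PI) by ring.
rewrite neg_cos, IH; simpl; ring.
Qed.

Lemma sign_pow_odd k D : ((-1) ^ k) ^ (2 * D + 1) = (-1) ^ k.
Proof.
rewrite <- pow_mult; replace (k * (2 * D + 1))%nat with (2 * (k * D) + k)%nat by lia.
rewrite pow_add, pow_1_even; ring.
Qed.

(* As the exponent is odd, the kernel carries the sign of the alternating sum from one cell of the
   lattice to the next. *)
Lemma kernel_shift t k D : cos (t + INR k * PI) ^ (2 * D + 1) = (-1) ^ k * cos t ^ (2 * D + 1).
Proof. rewrite cos_shift, Rpow_mult_distr, sign_pow_odd; reflexivity. Qed.

Lemma sign_sqr k : (-1) ^ k * (-1) ^ k = 1.
Proof. rewrite <- pow_add; replace (k + k)%nat with (2 * k)%nat by lia; apply pow_1_even. Qed.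

Lemma kernel_shift_neg t k D : cos (t + - (INR k * PI)) ^ (2 * D + 1) = (-1) ^ k * cos t ^ (2 * D + 1).
Proof.
pose proof (kernel_shift (t + - (INR k * PI)) k D) as E.
replace (t + - (INR k * PI) + INR k * PI) with t in E by ring.
rewrite E, <- Rmult_assoc, sign_sqr; ring.
Qed.

Lemma bdlip_cos_pow m : bdlip distR (fun t => cos t ^ m).
Proof.
induction m as [|m IH]; simpl.
- exists 1; split; [lra|split; intros]; [rewrite Rabs_R1; lra|].
  rewrite Rminus_diag, Rabs_R0; pose proof (distR_ge0 p q); lra.
- apply (bdlip_mul distR cos (fun t => cos t ^ m)); auto.
  apply (bdlip_ext distR (fun x => cos (1 * x))); [intros; rewrite Rmult_1_l; auto|apply bdlip_cos].
Qed.

Section Smoothing.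
Variable D : nat.
Let n := (2 * D + 1)%nat.
Let K t := cos t ^ n.

Lemma contK : cont K.
Proof. apply cont_cos_pow. Qed.

Lemma mass_gt0 : 0 < mass n.
Proof. apply mass_lower. Qed.

Lemma cell_shift f c e : cont f -> (forall t, K (t + c) = e * K t) ->
  Int (fun x => f x * K x) (c - PI / 2) (c + PI / 2) =
  Int (fun y => e * f (y + c) * K y) (- (PI / 2)) (PI / 2).
Proof.
intros cf He.
pose proof (Int_affine (fun x => f x * K x) 1 c (- (PI / 2)) (PI / 2) (contM _ _ cf contK)) as E.
replace (1 * - (PI / 2) + c) with (c - PI / 2) in E by ring.
replace (1 * (PI / 2) + c) with (c + PI / 2) in E by ring.
rewrite <- E, Rmult_1_l; apply Int_eq; intros y.
rewrite Rmult_1_l, He; ring.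
Qed.

Lemma cont_shift f c : cont f -> cont (fun y => f (y + c)).
Proof. intros cf; apply (cont_comp (fun y => y + c) f); auto; apply contD; [apply cont_id|apply cont_const]. Qed.

(** In the cell around [c] the kernel is [e] times its central copy. Replacing [f (y + c)] by [f c]
    there costs [Lam * |y|], which integrates to the first moment. *)
Lemma cell_smooth f Lam c e : cont f -> Rabs e = 1 ->
  (forall x y, Rabs (f x - f y) <= Lam * Rabs (x - y)) ->
  (forall t, K (t + c) = e * K t) ->
  Rabs (mass n * (e * f c) - Int (fun x => f x * K x) (c - PI / 2) (c + PI / 2)) <= Lam * moment n.
Proof.
intros cf e1 HL He; rewrite (cell_shift f c e) by auto.
pose proof contK as cK; pose proof (cont_shift f c cf) as cs.
assert (cAK : cont (fun y => Rabs y * K y)).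
{ apply contM; auto; intros x; apply continuity_pt_filterlim, Rcontinuity_abs. }
assert (cg : cont (fun y => e * f (y + c) * K y)) by (apply contM; auto; apply contZ; auto).
rewrite Rmult_comm; unfold mass; rewrite <- IntZ by auto.
rewrite <- IntB; [|apply contZ; auto|auto].
assert (H : forall t, - (PI / 2) <= t <= PI / 2 ->
  Rabs (e * f c * cos t ^ n - e * f (t + c) * K t) <= Lam * (Rabs t * K t)).
{ intros t ht; unfold K.
  replace (e * f c * cos t ^ n - e * f (t + c) * cos t ^ n) with (e * ((f c - f (t + c)) * cos t ^ n)) by ring.
  assert (p : 0 <= cos t ^ n) by (apply pow_le, cos_ge0_half; auto).
  rewrite !Rabs_mult, e1, (Rabs_pos_eq (cos t ^ n)), Rmult_1_l, <- Rmult_assoc by auto.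
  apply Rmult_le_compat_r; auto.
  apply Rle_trans with (1 := HL _ _); right; f_equal.
  replace (c - (t + c)) with (- t) by ring; apply Rabs_Ropp. }
unfold moment; rewrite <- IntZ by auto.
apply Rabs_le; split.
- match goal with |- - ?X <= _ => replace (- X) with ((-1) * X) by ring end.
  rewrite <- IntZ by (apply contZ; auto).
  apply Int_le; auto using half_le.
  + do 2 apply contZ; auto.
  + apply contB; auto; apply contZ; auto.
  + intros t ht; specialize (H t ht); apply Rabs_le_between in H; unfold K in *; lra.
- apply Int_le; auto using half_le.
  + apply contB; auto; apply contZ; auto.
  + apply contZ; auto.
  + intros t ht; specialize (H t ht); apply Rabs_le_between in H; unfold K in *; lra.
Qed.

Lemma cell_bound f M c e : cont f -> Rabs e = 1 -> (forall x, Rabs (f x) <= M) ->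
  (forall t, K (t + c) = e * K t) ->
  Rabs (Int (fun x => f x * K x) (c - PI / 2) (c + PI / 2)) <= M * mass n.
Proof.
intros cf e1 HM He; rewrite (cell_shift f c e) by auto.
pose proof contK as cK; pose proof (cont_shift f c cf) as cs.
assert (cg : cont (fun y => e * f (y + c) * K y)) by (apply contM; auto; apply contZ; auto).
assert (H : forall t, - (PI / 2) <= t <= PI / 2 -> Rabs (e * f (t + c) * K t) <= M * K t).
{ intros t ht; unfold K.
  assert (p : 0 <= cos t ^ n) by (apply pow_le, cos_ge0_half; auto).
  rewrite !Rabs_mult, e1, (Rabs_pos_eq (cos t ^ n)), Rmult_1_l by auto.
  apply Rmult_le_compat_r; auto. }
unfold mass; rewrite <- IntZ by auto.
apply Rabs_le; split.
- match goal with |- - ?X <= _ => replace (- X) with ((-1) * X) by ring end.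
  rewrite <- IntZ by (apply contZ; auto).
  apply Int_le; auto using half_le.
  + do 2 apply contZ; auto.
  + intros t ht; specialize (H t ht); apply Rabs_le_between in H; unfold K in *; lra.
- apply Int_le; auto using half_le.
  + apply contZ; auto.
  + intros t ht; specialize (H t ht); apply Rabs_le_between in H; unfold K in *; lra.
Qed.

Lemma Int_radius_S h L : cont h ->
  Int h (- radius (S L)) (radius (S L)) = Int h (- radius L) (radius L) +
   (Int h (INR (S L) * PI - PI / 2) (INR (S L) * PI + PI / 2) +
    Int h (- (INR (S L) * PI) - PI / 2) (- (INR (S L) * PI) + PI / 2)).
Proof.
intros ch.
rewrite <- (Int_cat h _ (- radius L) (radius (S L))), <- (Int_cat h (- radius L) (radius L)) by auto.
replace (INR (S L) * PI - PI / 2) with (radius L) by (unfold radius; rewrite S_INR; field).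
replace (- (INR (S L) * PI) + PI / 2) with (- radius L) by (unfold radius; rewrite S_INR; field).
replace (INR (S L) * PI + PI / 2) with (radius (S L)) by reflexivity.
replace (- (INR (S L) * PI) - PI / 2) with (- radius (S L)) by (unfold radius; ring).
ring.
Qed.

Lemma altsum_smooth f Lam L : cont f ->
  (forall x y, Rabs (f x - f y) <= Lam * Rabs (x - y)) ->
  Rabs (mass n * altsum f L - Int (fun x => f x * K x) (- radius L) (radius L)) <=
  (2 * INR L + 1) * (Lam * moment n).
Proof.
intros cf HL; pose proof (contM _ _ cf contK) as cfK.
induction L as [|L IH].
- assert (E := cell_smooth f Lam 0 1 cf Rabs_R1 HL ltac:(intros; rewrite Rplus_0_r; ring)).
  simpl altsum; unfold radius; simpl INR.
  replace (- (0 * PI + PI / 2)) with (0 - PI / 2) by ring; replace (0 * PI + PI / 2) with (0 + PI / 2) by ring.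
  rewrite Rmult_1_l in E; lra.
- rewrite altsum_S, Int_radius_S by auto.
  assert (E1 := cell_smooth f Lam _ _ cf (pow_1_abs (S L)) HL (fun t => kernel_shift t (S L) D)).
  assert (E2 := cell_smooth f Lam _ _ cf (pow_1_abs (S L)) HL (fun t => kernel_shift_neg t (S L) D)).
  set (e := (-1) ^ S L) in *; rewrite S_INR; rewrite S_INR in E1, E2.
  set (c := (INR L + 1) * PI) in *.
  set (I1 := Int (fun x => f x * K x) (c - PI / 2) (c + PI / 2)) in *.
  set (I2 := Int (fun x => f x * K x) (- c - PI / 2) (- c + PI / 2)) in *.
  set (I0 := Int (fun x => f x * K x) (- radius L) (radius L)) in *.
  replace (mass n * (altsum f L + e * (f c + f (- c))) - (I0 + (I1 + I2))) with
    ((mass n * altsum f L - I0) + ((mass n * (e * f c) - I1) + (mass n * (e * f (- c)) - I2))) by ring.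
  apply Rle_trans with (1 := Rabs_triang _ _).
  pose proof (Rabs_triang (mass n * (e * f c) - I1) (mass n * (e * f (- c)) - I2)); lra.
Qed.

Lemma Int_kernel_bound f M L : cont f -> (forall x, Rabs (f x) <= M) ->
  Rabs (Int (fun x => f x * K x) (- radius L) (radius L)) <= (2 * INR L + 1) * (M * mass n).
Proof.
intros cf HM; pose proof (contM _ _ cf contK) as cfK.
induction L as [|L IH].
- assert (E := cell_bound f M 0 1 cf Rabs_R1 HM ltac:(intros; rewrite Rplus_0_r; ring)).
  unfold radius; simpl INR.
  replace (- (0 * PI + PI / 2)) with (0 - PI / 2) by ring; replace (0 * PI + PI / 2) with (0 + PI / 2) by ring.
  lra.
- rewrite Int_radius_S by auto.
  assert (E1 := cell_bound f M _ _ cf (pow_1_abs (S L)) HM (fun t => kernel_shift t (S L) D)).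
  assert (E2 := cell_bound f M _ _ cf (pow_1_abs (S L)) HM (fun t => kernel_shift_neg t (S L) D)).
  rewrite S_INR; rewrite S_INR in E1, E2.
  set (c := (INR L + 1) * PI) in *.
  set (I1 := Int (fun x => f x * K x) (c - PI / 2) (c + PI / 2)) in *.
  set (I2 := Int (fun x => f x * K x) (- c - PI / 2) (- c + PI / 2)) in *.
  set (I0 := Int (fun x => f x * K x) (- radius L) (radius L)) in *.
  apply Rle_trans with (1 := Rabs_triang _ _).
  pose proof (Rabs_triang I1 I2); lra.
Qed.

(** The sums are replaced by integrals one variable at a time, from the innermost: [G] has [z]
    smoothed and [H] also [y]. Each integration multiplies the Lipschitz constant by at most
    [(2 * L + 1) * mass n], each remaining sum has [2 * L + 1] terms, and the three replacements end
    up costing the same. *)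
Lemma altsum3_smooth (F : R * R * R -> R) Lam L :
  bdlip (distprod (distprod distR)) F -> (forall p q, Rabs (F p - F q) <= Lam * distprod (distprod distR) p q) ->
  let B := radius L in
  Rabs (mass n ^ 3 * altsum (fun x => altsum (fun y => altsum (fun z => F (x, y, z)) L) L) L -
    Int (fun x => Int (fun y => Int (fun z => F (x, y, z) * K z) (- B) B * K y) (- B) B * K x) (- B) B)
  <= 3 * (2 * INR L + 1) ^ 3 * (Lam * moment n * mass n ^ 2).
Proof.
intros HF HL B.
assert (m0 := mass_gt0); pose proof contK as cK.
set (l := 2 * INR L + 1) in *.
assert (l0 : 0 <= l) by (unfold l; pose proof (pos_INR L); lra).
assert (B0 : - B <= B) by (unfold B; pose proof (radius_ge0 L); lra).
assert (D0 := distprod_refl distR distR_refl).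
assert (blK : bdlip distR K) by apply bdlip_cos_pow.
assert (cz : forall x y, cont (fun z => F (x, y, z)))
  by (intros x y; apply bdlip_cont; exact (bdlip_slice (distprod distR) _ (x, y) D0 HF)).
set (G := fun p : R * R => Int (fun z => F (p, z) * K z) (- B) B).
assert (HG : bdlip (distprod distR) G).
{ apply (bdlip_Int (distprod distR) (fun p => F p * K (snd p))); auto.
  apply (bdlip_mul _ F (fun p => K (snd p))); auto.
  apply (bdlip_snd (distprod distR) K); auto; apply distprod_ge0, distR_ge0. }
assert (cy : forall x, cont (fun y => G (x, y)))
  by (intros x; apply bdlip_cont; exact (bdlip_slice distR _ x distR_refl HG)).
assert (LG : forall p q, Rabs (G p - G q) <= l * (Lam * distprod distR p q * mass n)).
{ intros [x y] [x' y']; unfold G; rewrite <- IntB by (apply contM; auto).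
  rewrite (Int_eq _ (fun z => (F (x, y, z) - F (x', y', z)) * K z)) by (intros; ring).
  apply Int_kernel_bound; [apply contB; auto|].
  intros z; apply Rle_trans with (1 := HL _ _); right; f_equal.
  unfold distprod; simpl; rewrite Rminus_diag, Rabs_R0; ring. }
set (H := fun x => Int (fun y => G (x, y) * K y) (- B) B).
assert (HH : bdlip distR H).
{ apply (bdlip_Int distR (fun p => G p * K (snd p))); auto using distR_refl.
  apply (bdlip_mul _ G (fun p => K (snd p))); auto.
  apply (bdlip_snd distR K); auto; apply distR_ge0. }
assert (LH : forall x x', Rabs (H x - H x') <= l * (l * (Lam * Rabs (x - x') * mass n) * mass n)).
{ intros x x'; unfold H; rewrite <- IntB by (apply contM; auto).
  rewrite (Int_eq _ (fun y => (G (x, y) - G (x', y)) * K y)) by (intros; ring).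
  apply Int_kernel_bound; [apply contB; auto|].
  intros y; apply Rle_trans with (1 := LG _ _); right; unfold distprod, distR; simpl.
  rewrite Rminus_diag, Rabs_R0; ring. }
set (v := moment n) in *; set (w := mass n) in *.
assert (T1 : forall x y, Rabs (w * altsum (fun z => F (x, y, z)) L - G (x, y)) <= l * (Lam * v)).
{ intros x y; apply altsum_smooth; auto.
  intros z z'; apply Rle_trans with (1 := HL _ _); right; unfold distprod, distR; simpl.
  rewrite !Rminus_diag, Rabs_R0; ring. }
assert (T2 : forall x, Rabs (w * altsum (fun y => G (x, y)) L - H x) <= l * (l * (Lam * w) * v)).
{ intros x; apply altsum_smooth; auto.
  intros y y'; apply Rle_trans with (1 := LG _ _); right; unfold distprod, distR; simpl.
  rewrite !Rminus_diag, Rabs_R0; ring. }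
assert (T3 : Rabs (w * altsum H L - Int (fun x => H x * K x) (- B) B) <= l * (l * (l * (Lam * w) * w) * v)).
{ apply altsum_smooth; [apply bdlip_cont; auto|].
  intros x x'; apply Rle_trans with (1 := LH _ _); right; ring. }
assert (U1 : Rabs (altsum (fun x => altsum (fun y => w * altsum (fun z => F (x, y, z)) L - G (x, y)) L) L)
   <= l * (l * (l * (Lam * v)))).
{ apply altsum_bound; intros x; apply altsum_bound; intros y; apply T1. }
assert (U2 : Rabs (altsum (fun x => w * altsum (fun y => G (x, y)) L - H x) L) <= l * (l * (l * (Lam * w) * v)))
  by (apply altsum_bound, T2).
assert (E1 : altsum (fun x => altsum (fun y => w * altsum (fun z => F (x, y, z)) L - G (x, y)) L) L =
  w * altsum (fun x => altsum (fun y => altsum (fun z => F (x, y, z)) L) L) L -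
   altsum (fun x => altsum (fun y => G (x, y)) L) L).
{ rewrite <- altsumZ, <- altsumB.
  f_equal; apply functional_extensionality; intros x; rewrite <- altsumZ, <- altsumB; reflexivity. }
rewrite altsumB, altsumZ in U2; rewrite E1 in U1.
change (Rabs (w ^ 3 * altsum (fun x => altsum (fun y => altsum (fun z => F (x, y, z)) L) L) L -
   Int (fun x => H x * K x) (- B) B) <= 3 * l ^ 3 * (Lam * v * w ^ 2)).
set (S3 := altsum (fun x => altsum (fun y => altsum (fun z => F (x, y, z)) L) L) L) in *.
set (S2 := altsum (fun x => altsum (fun y => G (x, y)) L) L) in *.
set (S1 := altsum H L) in *; set (S0 := Int (fun x => H x * K x) (- B) B) in *.
replace (w ^ 3 * S3 - S0) with (w ^ 2 * (w * S3 - S2) + (w * (w * S2 - S1) + (w * S1 - S0))) by ring.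
apply Rle_trans with (1 := Rabs_triang _ _).
pose proof (Rabs_triang (w * (w * S2 - S1)) (w * S1 - S0)) as T.
rewrite Rabs_mult, (Rabs_pos_eq (w ^ 2)) by nra.
rewrite Rabs_mult, (Rabs_pos_eq w) in T by lra.
apply (Rmult_le_compat_l (w ^ 2)) in U1; [|nra].
apply (Rmult_le_compat_l w) in U2; [|lra].
nra.
Qed.
End Smoothing.

(** * The bound for the first Riesz sums *)

Notation dist3 := (distprod (distprod distR)).

Definition Int3 B (f : R * R * R -> R) :=
  Int (fun x => Int (fun y => Int (fun z => f (x, y, z)) (- B) B) (- B) B) (- B) B.

Lemma bdlip3_z f x y : bdlip dist3 f -> cont (fun z => f (x, y, z)).
Proof. intros H; apply bdlip_cont; exact (bdlip_slice (distprod distR) _ (x, y) (distprod_refl distR distR_refl) H). Qed.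

Lemma bdlip3_Int f B : 0 <= B -> bdlip dist3 f -> bdlip (distprod distR) (fun p => Int (fun z => f (p, z)) (- B) B).
Proof. intros; apply (bdlip_Int (distprod distR) f); auto using distprod_refl, distR_refl; lra. Qed.

Lemma bdlip3_y f B x : 0 <= B -> bdlip dist3 f -> cont (fun y => Int (fun z => f (x, y, z)) (- B) B).
Proof. intros; apply bdlip_cont; exact (bdlip_slice distR _ x distR_refl (bdlip3_Int f B H H0)). Qed.

Lemma bdlip3_x f B : 0 <= B -> bdlip dist3 f ->
  cont (fun x => Int (fun y => Int (fun z => f (x, y, z)) (- B) B) (- B) B).
Proof.
intros; apply bdlip_cont, (bdlip_Int distR (fun p => Int (fun z => f (p, z)) (- B) B)); auto using distR_refl; [lra|].
apply bdlip3_Int; auto.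
Qed.

Lemma Int3_ext B f g : (forall p, f p = g p) -> Int3 B f = Int3 B g.
Proof. intros H; do 3 (apply Int_eq; intro); apply H. Qed.

Lemma Int3D B f g : 0 <= B -> bdlip dist3 f -> bdlip dist3 g ->
  Int3 B (fun p => f p + g p) = Int3 B f + Int3 B g.
Proof.
intros B0 bf bg; unfold Int3; rewrite <- IntD by (apply bdlip3_x; auto).
apply Int_eq; intros x; rewrite <- IntD by (apply bdlip3_y; auto).
apply Int_eq; intros y; rewrite <- IntD by (apply bdlip3_z; auto); reflexivity.
Qed.

Lemma Int3Z B c f : 0 <= B -> bdlip dist3 f -> Int3 B (fun p => c * f p) = c * Int3 B f.
Proof.
intros B0 bf; unfold Int3; rewrite <- IntZ by (apply bdlip3_x; auto).
apply Int_eq; intros x; rewrite <- IntZ by (apply bdlip3_y; auto).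
apply Int_eq; intros y; rewrite <- IntZ by (apply bdlip3_z; auto); reflexivity.
Qed.

Lemma bdlip_sum {T} (d : T -> T -> R) (f : nat -> T -> R) m : (forall j, bdlip d (f j)) ->
  bdlip d (fun p => sum_f_R0 (fun j => f j p) m).
Proof. intros H; induction m; simpl; auto; apply bdlip_add; auto. Qed.

Lemma Int3_sum B f m : 0 <= B -> (forall j, bdlip dist3 (f j)) ->
  Int3 B (fun p => sum_f_R0 (fun j => f j p) m) = sum_f_R0 (fun j => Int3 B (f j)) m.
Proof.
intros B0 H; induction m; simpl; auto.
rewrite Int3D, IHm; auto; apply bdlip_sum; auto.
Qed.

Definition freq m j := INR m - 2 * INR j.

Lemma bdlip_coord (u : R * R * R -> R) (f : R -> R) :
  (forall p q, Rabs (u p - u q) <= dist3 p q) -> bdlip distR f -> bdlip dist3 (fun p => f (u p)).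
Proof. intros H; apply (bdlip_comp dist3 distR u f 1); [lra|intros; unfold distR; rewrite Rmult_1_l; auto]. Qed.

(** The kernel in a single coordinate [u] is expanded into cosines; the uniform bound on the
    coefficients comes out as [mass m / PI]. Leaving [u] general lets the three coordinates be
    treated in turn. *)
Lemma Int3_kernel_bound B f u m : 0 <= B -> bdlip dist3 f ->
  (forall p q, Rabs (u p - u q) <= dist3 p q) ->
  Rabs (Int3 B (fun p => f p * cos (u p) ^ m)) <=
  mass m / PI * sum_f_R0 (fun j => Rabs (Int3 B (fun p => f p * cos (freq m j * u p)))) m.
Proof.
intros B0 bf Hu.
rewrite (Int3_ext B _ (fun p => sum_f_R0 (fun j => coef m j * (f p * cos (freq m j * u p))) m)).
2: { intros p; rewrite cos_pow_expand, scal_sum; apply sum_eq; intros j _; unfold freq; ring. }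
assert (bc : forall j, bdlip dist3 (fun p => f p * cos (freq m j * u p))).
{ intros j; apply (bdlip_mul _ f (fun p => cos (freq m j * u p))); auto.
  apply (bdlip_coord u (fun x => cos (freq m j * x))); auto; apply bdlip_cos. }
rewrite (Int3_sum B (fun j p => coef m j * (f p * cos (freq m j * u p)))); auto.
2: intros j; apply (bdlip_scal _ _ (fun p => f p * cos (freq m j * u p))); auto.
apply Rle_trans with (1 := Rsum_abs _ _).
rewrite scal_sum; apply sum_Rle; intros j _.
rewrite (Int3Z B (coef m j) (fun p => f p * cos (freq m j * u p))) by auto.
rewrite Rabs_mult, Rmult_comm; apply Rmult_le_compat_l; [apply Rabs_pos|apply coef_bound].
Qed.

Definition coordx (p : R * R * R) := fst (fst p).
Definition coordy (p : R * R * R) := snd (fst p).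
Definition coordz (p : R * R * R) := snd p.

Lemma coordx_lip p q : Rabs (coordx p - coordx q) <= dist3 p q.
Proof.
unfold coordx, distprod, distR; pose proof (Rabs_pos (snd (fst p) - snd (fst q))).
pose proof (Rabs_pos (snd p - snd q)); lra.
Qed.

Lemma coordy_lip p q : Rabs (coordy p - coordy q) <= dist3 p q.
Proof.
unfold coordy, distprod, distR; pose proof (Rabs_pos (fst (fst p) - fst (fst q))).
pose proof (Rabs_pos (snd p - snd q)); lra.
Qed.

Lemma coordz_lip p q : Rabs (coordz p - coordz q) <= dist3 p q.
Proof.
unfold coordz, distprod, distR; pose proof (Rabs_pos (fst (fst p) - fst (fst q))).
pose proof (Rabs_pos (snd (fst p) - snd (fst q))); lra.
Qed.

(** An odd exponent produces odd frequencies only, so none of them vanishes. *)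
Lemma freq_ge1 D j : 1 <= Rabs (freq (2 * D + 1) j).
Proof.
unfold freq; rewrite plus_INR, mult_INR; simpl INR.
replace (2 * INR D + 1 - 2 * INR j) with (1 + 2 * (INR D - INR j)) by ring.
destruct (Nat.le_gt_cases j D) as [h|h].
- apply le_INR in h; rewrite Rabs_pos_eq; lra.
- assert (INR D + 1 <= INR j) by (rewrite <- S_INR; apply le_INR; lia).
  rewrite Rabs_left1; lra.
Qed.

Lemma cos_abs x y : cos (Rabs x * y) = cos (x * y).
Proof.
unfold Rabs; destruct Rcase_abs; auto.
rewrite <- cos_neg; f_equal; ring.
Qed.

Lemma sum_prod_bound (a : nat -> R) (g : nat -> R) C m :
  (forall j, g j <= C * a j) -> sum_f_R0 g m <= C * sum_f_R0 a m.
Proof.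
intros H; rewrite scal_sum; apply sum_Rle; intros j _; rewrite Rmult_comm; apply H.
Qed.

(** The kernels are expanded one coordinate after the other, [A1] having all three expanded and [A3]
    only the first. The bound of [ball_transform_bound] is a product over the coordinates, so each
    summation yields one factor [freq_sum D]. *)
Lemma kernel_transform_bound S B D : 1 <= S <= B ->
  let n := (2 * D + 1)%nat in
  Rabs (Int3 B (fun p => ball_bump (S ^ 2) p * cos (coordx p) ^ n * cos (coordy p) ^ n * cos (coordz p) ^ n)) <=
  (mass n / PI) ^ 3 * (336 * S ^ 2) * freq_sum D ^ 3.
Proof.
intros SB n.
assert (B0 : 0 <= B) by lra.
assert (bF := bdlip_ball S ltac:(lra)).
assert (w0 : 0 <= mass n / PI).
{ apply Rle_trans with (2 := coef_bound n 0); apply Rabs_pos. }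
assert (S2 : 0 <= S ^ 2) by nra.
assert (bK : forall u, (forall p q, Rabs (u p - u q) <= dist3 p q) -> bdlip dist3 (fun p => cos (u p) ^ n)).
{ intros u Hu; apply (bdlip_coord u (fun x => cos x ^ n)); auto; apply bdlip_cos_pow. }
assert (bC : forall u q, (forall p q, Rabs (u p - u q) <= dist3 p q) -> bdlip dist3 (fun p => cos (q * u p))).
{ intros u q Hu; apply (bdlip_coord u (fun x => cos (q * x))); auto; apply bdlip_cos. }
set (F := ball_bump (S ^ 2)) in *.
set (w := mass n / PI) in *.
assert (A1 : forall j k l, Rabs (Int3 B (fun p => F p * cos (freq n j * coordx p) * cos (freq n k * coordy p) * cos (freq n l * coordz p)))
   <= 336 * S ^ 2 * / Rabs (freq n j) * / Rabs (freq n k) * / Rabs (freq n l)).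
{ intros j k l.
  rewrite (Int3_ext B _ (fun p => F p * (cos (Rabs (freq n j) * coordx p) * (cos (Rabs (freq n k) * coordy p) * cos (Rabs (freq n l) * coordz p)))))
    by (intros; rewrite !cos_abs; ring).
  apply Rle_trans with (1 := ball_transform_bound S B _ _ _ SB (freq_ge1 D j) (freq_ge1 D k) (freq_ge1 D l)).
  assert (e : forall i, Rabs (freq n i) <> 0) by (intros i; pose proof (freq_ge1 D i); unfold n; lra).
  change (2 * D + 1)%nat with n; right; field; auto. }
assert (A2 : forall j k, Rabs (Int3 B (fun p => F p * cos (freq n j * coordx p) * cos (freq n k * coordy p) * cos (coordz p) ^ n))
   <= w * freq_sum D * (336 * S ^ 2) * / Rabs (freq n j) * / Rabs (freq n k)).
{ intros j k.
  apply Rle_trans with (1 := Int3_kernel_bound B _ coordz n B0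
     (bdlip_mul _ _ _ (bdlip_mul _ _ _ bF (bC coordx (freq n j) coordx_lip)) (bC coordy (freq n k) coordy_lip)) coordz_lip).
  fold w; rewrite !Rmult_assoc; apply Rmult_le_compat_l; auto.
  rewrite (Rmult_comm (freq_sum D)).
  apply Rle_trans with ((336 * S ^ 2 * / Rabs (freq n j) * / Rabs (freq n k)) * freq_sum D); [|right; ring].
  apply sum_prod_bound; intros l; apply A1. }
assert (A3 : forall j, Rabs (Int3 B (fun p => F p * cos (freq n j * coordx p) * cos (coordy p) ^ n * cos (coordz p) ^ n))
   <= w ^ 2 * freq_sum D ^ 2 * (336 * S ^ 2) * / Rabs (freq n j)).
{ intros j.
  rewrite (Int3_ext B _ (fun p => F p * cos (freq n j * coordx p) * cos (coordz p) ^ n * cos (coordy p) ^ n)) by (intros; ring).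
  apply Rle_trans with (1 := Int3_kernel_bound B _ coordy n B0
     (bdlip_mul _ _ _ (bdlip_mul _ _ _ bF (bC coordx (freq n j) coordx_lip)) (bK coordz coordz_lip)) coordy_lip).
  fold w; replace (w ^ 2 * freq_sum D ^ 2 * (336 * S ^ 2) * / Rabs (freq n j)) with
    (w * (w * freq_sum D * (336 * S ^ 2) * / Rabs (freq n j) * freq_sum D)) by ring.
  apply Rmult_le_compat_l; auto; apply sum_prod_bound; intros k.
  rewrite (Int3_ext B _ (fun p => F p * cos (freq n j * coordx p) * cos (freq n k * coordy p) * cos (coordz p) ^ n)) by (intros; ring).
  apply A2. }
rewrite (Int3_ext B _ (fun p => F p * cos (coordy p) ^ n * cos (coordz p) ^ n * cos (coordx p) ^ n)) by (intros; ring).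
apply Rle_trans with (1 := Int3_kernel_bound B _ coordx n B0
   (bdlip_mul _ _ _ (bdlip_mul _ _ _ bF (bK coordy coordy_lip)) (bK coordz coordz_lip)) coordx_lip).
fold w; replace (w ^ 3 * (336 * S ^ 2) * freq_sum D ^ 3) with
    (w * (w ^ 2 * freq_sum D ^ 2 * (336 * S ^ 2) * freq_sum D)) by ring.
apply Rmult_le_compat_l; auto; apply sum_prod_bound; intros j.
rewrite (Int3_ext B _ (fun p => F p * cos (freq n j * coordx p) * cos (coordy p) ^ n * cos (coordz p) ^ n)) by (intros; ring).
apply A3.
Qed.

(** As the lattice has step [PI], the radius is [S = PI * sqrt N]. With [w] the mass of the kernel,
    smoothing costs [648 * N * w ^ 3] and the transform gives [336 * 216 * N * (1 + k) ^ 3 * w ^ 3].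
    The powers of [w] cancel, and 80000 exceeds the sum of the constants. *)
Lemma ball_altsum_bound N k : (1 <= N)%nat -> (N <= 2 ^ k)%nat ->
  Rabs (altsum (fun x => altsum (fun y => altsum (fun z =>
     ball_bump (PI ^ 2 * INR N) (x, y, z)) N) N) N) <= 80000 * INR N * (1 + INR k) ^ 3.
Proof.
intros N1 Nk.
(* With [D = N ^ 6] the smoothing error, of order [N ^ 4 / sqrt D], is [O(N)]. *)
set (S := PI * sqrt (INR N)); set (D := (N ^ 6)%nat); set (n := (2 * D + 1)%nat); set (B := radius N).
assert (n1 : 1 <= INR N) by (apply (le_INR 1); auto).
assert (pi3 : 3 <= PI <= 4) by (pose proof PI_4; pose proof PI2_3_2; lra).
assert (s1 : 1 <= sqrt (INR N)) by (apply Rle_trans with (sqrt 1); [rewrite sqrt_1; lra|apply sqrt_le_1_alt; auto]).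
assert (sq : sqrt (INR N) ^ 2 = INR N) by (apply pow2_sqrt; lra).
assert (sN : sqrt (INR N) <= INR N) by nra.
assert (S2 : PI ^ 2 * INR N = S ^ 2) by (unfold S; rewrite Rpow_mult_distr, sq; reflexivity).
assert (SB : 1 <= S <= B).
{ unfold S, B, radius; split; [nra|]. assert (PI * sqrt (INR N) <= PI * INR N) by (apply Rmult_le_compat_l; lra); lra. }
rewrite S2.
set (T := altsum _ N).
assert (bF := bdlip_ball S ltac:(lra)).
pose proof (altsum3_smooth D (ball_bump (S ^ 2)) (2 * S) N bF (fun p q => ball_bump_lip S p q ltac:(lra))) as A.
cbv zeta in A; fold T n B in A.
set (X := Int _ (- B) B) in A.
assert (EX : X = Int3 B (fun p => ball_bump (S ^ 2) p * cos (coordx p) ^ n * cos (coordy p) ^ n * cos (coordz p) ^ n)).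
{ unfold X, Int3; apply Int_eq; intros x.
  rewrite Rmult_comm, <- IntZ.
  2: { apply contM; [|apply cont_cos_pow].
    apply (bdlip3_y (fun p => ball_bump (S ^ 2) p * cos (coordz p) ^ n)); [lra|].
    apply (bdlip_mul _ _ (fun p => cos (coordz p) ^ n)); auto.
    apply (bdlip_coord coordz (fun x => cos x ^ n)); [apply coordz_lip|apply bdlip_cos_pow]. }
  apply Int_eq; intros y; rewrite <- Rmult_assoc, Rmult_comm, <- Rmult_assoc, <- IntZ.
  2: { apply contM; [|apply cont_cos_pow]; apply bdlip3_z; auto. }
  apply Int_eq; intros z; unfold coordx, coordy, coordz; simpl fst; simpl snd; ring. }
pose proof (kernel_transform_bound S B D SB) as E; cbv zeta in E; fold n in E.
rewrite <- EX in E.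
destruct (mass_lower D) as [w0 w2]; fold n in w0, w2.
assert (v2 : moment n <= 2 / (2 * INR D + 1)).
{ unfold n; replace (2 * D + 1)%nat with (Datatypes.S (2 * D)) by lia.
  replace (2 * INR D) with (INR (2 * D)) by (rewrite mult_INR; reflexivity); apply moment_upper. }
assert (d0 : INR D = INR N ^ 6) by (unfold D; apply pow_INR).
assert (dN : 1 <= INR N ^ 6) by (apply pow_R1_Rle; auto).
set (w := mass n) in *; set (v := moment n) in *.
(* [v / w <= N ^ -3] *)
assert (vw : INR N ^ 3 * v <= w).
{ assert (N3 : 1 <= INR N ^ 3) by (apply pow_R1_Rle; auto).
  rewrite d0 in *; replace (INR N ^ 6) with (INR N ^ 3 * INR N ^ 3) in * by ring.
  set (t := INR N ^ 3) in *.
  assert (tv : v * (2 * (t * t) + 1) <= 2).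
  { apply (Rmult_le_compat_r (2 * (t * t) + 1)) in v2; [|nra].
    unfold Rdiv in v2; rewrite Rmult_assoc, Rinv_l in v2 by nra; lra. }
  apply Rnot_lt_le; intros lt.
  assert (v0 : 0 < v) by nra.
  assert (w ^ 2 < (t * v) ^ 2) by nra.
  set (q := 2 * (t * t) + 1) in *.
  assert (q0 : 0 < q) by (unfold q; nra).
  assert (4 < (t * v) ^ 2 * q) by nra.
  assert ((t * v) ^ 2 * q * q <= t ^ 2 * 4).
  { replace ((t * v) ^ 2 * q * q) with (t ^ 2 * (v * q) ^ 2) by ring.
    apply Rmult_le_compat_l; [nra|]. assert (0 < v * q) by nra. nra. }
  assert (t ^ 2 <= q) by (unfold q; nra).
  nra. }
(* Since [D = N ^ 6], the sum is at most [2 + ln 3 + 6 * ln N], and [ln N <= k * ln 2 <= k]. *)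
assert (H6 : freq_sum D <= 6 * (1 + INR k)).
{ apply Rle_trans with (1 := freq_sum_bound D); rewrite d0.
  assert (Nk' : INR N <= 2 ^ k) by (change 2 with (INR 2); rewrite <- pow_INR; apply le_INR; auto).
  assert (l2 : ln 2 <= 1).
  { rewrite <- (ln_exp 1); apply ln_le; [lra|]; pose proof (exp_ineq1_le 1); lra. }
  assert (l3 : ln 3 <= 2).
  { rewrite <- (ln_exp 2); apply ln_le; [lra|]; pose proof (exp_ineq1_le 2); lra. }
  assert (lN : ln (INR N) <= INR k).
  { apply Rle_trans with (ln (2 ^ k)); [apply ln_le; lra|].
    rewrite ln_pow by lra; pose proof (pos_INR k); nra. }
  assert (ln (2 * INR N ^ 6 + 1) <= ln (3 * INR N ^ 6)) by (apply ln_le; lra).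
  rewrite ln_mult, ln_pow in H by lra; simpl (INR 6) in H; lra. }
assert (H0 : 0 <= freq_sum D).
{ apply cond_pos_sum; intros j; left; apply Rinv_0_lt_compat.
  pose proof (freq_ge1 D j) as h; unfold freq in h; lra. }
assert (k0 := pos_INR k).
assert (H3 : freq_sum D ^ 3 <= 216 * (1 + INR k) ^ 3).
{ replace (216 * (1 + INR k) ^ 3) with ((6 * (1 + INR k)) ^ 3) by ring; apply pow_incr; auto. }
assert (K1 : 1 <= (1 + INR k) ^ 3) by (apply pow_R1_Rle; lra).
assert (X1 : Rabs X <= w ^ 3 * (72576 * INR N * (1 + INR k) ^ 3)).
{ apply Rle_trans with (1 := E).
  replace ((w / PI) ^ 3 * (336 * S ^ 2) * freq_sum D ^ 3) with
    (w ^ 3 * (336 * (INR N / PI) * freq_sum D ^ 3)) by (rewrite <- S2; field; lra).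
  apply Rmult_le_compat_l; [apply pow_le; lra|].
  assert (INR N / PI <= INR N).
  { apply Rmult_le_reg_r with PI; [lra|]; unfold Rdiv; rewrite Rmult_assoc, Rinv_l by lra; nra. }
  assert (0 <= INR N / PI) by (apply Rmult_le_pos; [lra|left; apply Rinv_0_lt_compat; lra]).
  assert (INR N / PI * freq_sum D ^ 3 <= INR N * (216 * (1 + INR k) ^ 3)).
  { apply Rmult_le_compat; auto; apply pow_le; auto. }
  lra. }
assert (Y1 : 3 * (2 * INR N + 1) ^ 3 * (2 * S * v * w ^ 2) <= w ^ 3 * (648 * INR N)).
{ assert ((2 * INR N + 1) ^ 3 <= 27 * INR N ^ 3).
  { replace (27 * INR N ^ 3) with ((3 * INR N) ^ 3) by ring; apply pow_incr; lra. }
  assert (S <= 4 * INR N) by (unfold S; nra).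
  destruct (Rle_or_lt v 0) as [vn|vp].
  - apply Rle_trans with 0.
    + assert (0 <= 3 * (2 * INR N + 1) ^ 3) by (apply Rmult_le_pos; [lra|apply pow_le; lra]).
      assert (2 * S * v * w ^ 2 <= 0); [|nra].
      replace (2 * S * v * w ^ 2) with (v * (2 * S * w ^ 2)) by ring.
      assert (0 <= 2 * S * w ^ 2) by (apply Rmult_le_pos; [lra|apply pow_le; lra]); nra.
    + apply Rmult_le_pos; [apply pow_le; lra|lra].
  - apply Rle_trans with (3 * (27 * INR N ^ 3) * (2 * (4 * INR N) * v * w ^ 2)).
    + apply Rmult_le_compat; auto.
      * apply Rmult_le_pos; [lra|apply pow_le; lra].
      * apply Rmult_le_pos; [nra|apply pow_le; lra].
      * lra.
      * apply Rmult_le_compat_r; [apply pow_le; lra|nra].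
    + replace (3 * (27 * INR N ^ 3) * (2 * (4 * INR N) * v * w ^ 2)) with
        ((648 * INR N * w ^ 2) * (INR N ^ 3 * v)) by ring.
      replace (w ^ 3 * (648 * INR N)) with ((648 * INR N * w ^ 2) * w) by ring.
      apply Rmult_le_compat_l; auto.
      apply Rmult_le_pos; [lra|apply pow_le; lra]. }
assert (Z : w ^ 3 * Rabs T <= w ^ 3 * (80000 * INR N * (1 + INR k) ^ 3)).
{ assert (w3 : 0 < w ^ 3) by (apply pow_lt; auto).
  replace (w ^ 3 * Rabs T) with (Rabs (w ^ 3 * T)) by (rewrite Rabs_mult, (Rabs_pos_eq (w ^ 3)); lra).
  replace (w ^ 3 * T) with ((w ^ 3 * T - X) + X) by ring.
  apply Rle_trans with (1 := Rabs_triang _ _).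
  apply Rle_trans with (w ^ 3 * (648 * INR N) + w ^ 3 * (72576 * INR N * (1 + INR k) ^ 3)); [lra|].
  rewrite <- Rmult_plus_distr_l; apply Rmult_le_compat_l; [lra|].
  assert (0 <= INR N * ((1 + INR k) ^ 3 - 1)) by (apply Rmult_le_pos; lra).
  nra. }
apply Rmult_le_reg_l in Z; auto; apply pow_lt; auto.
Qed.

(** * From the lattice of step [PI] to sums over natural numbers *)

Lemma altsum_ext f g L : (forall x, f x = g x) -> altsum f L = altsum g L.
Proof. intros H; replace g with f; [reflexivity|apply functional_extensionality, H]. Qed.

Lemma ball_bump_opp Q x y z : ball_bump Q (- x, y, z) = ball_bump Q (x, y, z) /\
  ball_bump Q (x, - y, z) = ball_bump Q (x, y, z) /\ ball_bump Q (x, y, - z) = ball_bump Q (x, y, z).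
Proof. unfold ball_bump; simpl fst; simpl snd; repeat split; f_equal; ring. Qed.

(** Truncated subtraction of natural numbers acts as the positive part. *)
Lemma ball_bump_lattice N i j k :
  ball_bump (PI ^ 2 * INR N) (INR i * PI, INR j * PI, INR k * PI) =
  PI ^ 2 * INR (N - (i * i + j * j + k * k)).
Proof.
unfold ball_bump; simpl fst; simpl snd.
replace (PI ^ 2 * INR N - (INR i * PI) ^ 2 - (INR j * PI) ^ 2 - (INR k * PI) ^ 2) with
  (PI ^ 2 * (INR N - INR (i * i + j * j + k * k))) by (rewrite !plus_INR, !mult_INR; ring).
assert (p2 : 0 <= PI ^ 2) by apply pow2_ge_0.
destruct (Nat.le_gt_cases (i * i + j * j + k * k) N) as [h|h].
- rewrite minus_INR by auto; apply le_INR in h; apply pos_eq; nra.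
- replace (N - (i * i + j * j + k * k))%nat with 0%nat by lia.
  rewrite Rmult_0_r; apply pos_eq0; apply lt_INR in h; nra.
Qed.

(** An index [i > 0] stands for the two points [i] and [-i], hence the factor 2. *)
Fixpoint lattice_sum (g : nat -> R) (L : nat) : R :=
  match L with
  | O => g 0%nat
  | S l => lattice_sum g l + 2 * (-1) ^ S l * g (S l)
  end.

Lemma lattice_sum_ext g g' L : (forall i, g i = g' i) -> lattice_sum g L = lattice_sum g' L.
Proof. intros H; induction L as [|L IH]; simpl lattice_sum; [apply H|rewrite IH, H; reflexivity]. Qed.

Lemma lattice_sumZ c g L : lattice_sum (fun i => c * g i) L = c * lattice_sum g L.
Proof. induction L as [|L IH]; simpl lattice_sum; [ring|rewrite IH; ring]. Qed.

Lemma altsum_even f L : (forall x, f (- x) = f x) ->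
  altsum f L = lattice_sum (fun i => f (INR i * PI)) L.
Proof.
intros H; induction L as [|L IH].
- simpl; rewrite Rmult_0_l; reflexivity.
- rewrite altsum_S, IH, H; cbn [lattice_sum]; ring.
Qed.

Lemma lattice_bound : exists C : nat, forall N k, (1 <= N)%nat -> (N <= 2 ^ k)%nat ->
  Rabs (lattice_sum (fun i => lattice_sum (fun j => lattice_sum (fun l =>
    INR (N - (i * i + j * j + l * l))) N) N) N) <= INR C * INR N * INR (S k) ^ 3.
Proof.
(* Passing through [Z] keeps the constant from being written as a unary numeral. *)
exists (Z.to_nat 80000); intros N k N1 Nk.
rewrite (INR_IZR_INZ (Z.to_nat _)), Z2Nat.id, S_INR, (Rplus_comm (INR k)) by lia.
pose proof (ball_altsum_bound N k N1 Nk) as B.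
rewrite altsum_even in B.
2: { intros x; apply altsum_ext; intros y; apply altsum_ext; intros z; apply ball_bump_opp. }
rewrite (lattice_sum_ext _ (fun i => lattice_sum (fun j => lattice_sum (fun l =>
    PI ^ 2 * INR (N - (i * i + j * j + l * l))) N) N)) in B.
2: { intros i; rewrite altsum_even by (intros y; apply altsum_ext; intros z; apply ball_bump_opp).
  apply lattice_sum_ext; intros j; rewrite altsum_even by (intros z; apply ball_bump_opp).
  apply lattice_sum_ext; intros l; apply ball_bump_lattice. }
rewrite (lattice_sum_ext _ (fun i => PI ^ 2 * lattice_sum (fun j => lattice_sum (fun l =>
    INR (N - (i * i + j * j + l * l))) N) N)) in B.
2: { intros i; rewrite <- lattice_sumZ; apply lattice_sum_ext; intros j; apply lattice_sumZ. }
rewrite lattice_sumZ, Rabs_mult in B.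
apply Rle_trans with (2 := B).
assert (p1 : 1 <= PI ^ 2) by (pose proof PI2_3_2; nra).
rewrite (Rabs_pos_eq (PI ^ 2)) by lra.
match goal with |- Rabs ?X <= _ => pose proof (Rabs_pos X); nra end.
Qed.

End RieszBound.

Require Import Defs.
From mathcomp Require Import all_boot all_order all_algebra.
From mathcomp Require Import all_classical all_reals all_analysis.
From mathcomp Require Import Rstruct.
From mathcomp Require Import ring lra zify.

Set Implicit Arguments.
Unset Strict Implicit.
Unset Printing Implicit Defensive.

Import Order.TTheory GRing.Theory Num.Theory.
Import numFieldNormedType.Exports.
Local Open Scope classical_set_scope.
Local Open Scope ring_scope.

(** * Alternating sums of k-monotone sequences *)

(* [i] stands for both [i] and [-i]. *)
Definition sign_weight (R : pzRingType) (i : nat) : R := (-1) ^+ i *+ (i != 0).+1.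

Definition symsum (R : pzRingType) (L : nat) (g : nat -> R) : R :=
  \sum_(i < L.+1) sign_weight R i * g i.

Definition symsum3 (R : pzRingType) (I J K : nat) (phi : nat -> R) : R :=
  symsum I (fun i => symsum J (fun j => symsum K (fun k =>
    phi (i ^ 2 + j ^ 2 + k ^ 2)%N))).

Section Symsum.
Context {R : comPzRingType}.
Implicit Types (g phi : nat -> R).

Lemma eq_symsum L g g' : g =1 g' -> symsum L g = symsum L g'.
Proof. by move=> e; apply: eq_bigr => i _; rewrite e. Qed.

Lemma symsumC I J (g : nat -> nat -> R) :
  symsum I (fun i => symsum J (g i)) = symsum J (fun j => symsum I (g^~ j)).
Proof.
rewrite /symsum; under eq_bigr => i _ do rewrite mulr_sumr.
rewrite exchange_big; apply: eq_bigr => j _ /=; rewrite mulr_sumr.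
by apply: eq_bigr => i _; rewrite mulrCA.
Qed.

Lemma symsum3C12 I J K phi : symsum3 I J K phi = symsum3 J I K phi.
Proof.
rewrite /symsum3 symsumC; apply: eq_symsum => j; apply: eq_symsum => i.
by apply: eq_symsum => k; rewrite (addnC (j ^ 2)%N).
Qed.

Lemma symsum3C23 I J K phi : symsum3 I J K phi = symsum3 I K J phi.
Proof.
apply: eq_symsum => i; rewrite symsumC; apply: eq_symsum => k.
by apply: eq_symsum => j; rewrite addnAC.
Qed.

Lemma symsum_comb L g1 g2 c1 c2 :
  symsum L (fun i => c1 * g1 i + c2 * g2 i) = c1 * symsum L g1 + c2 * symsum L g2.
Proof.
rewrite /symsum !mulr_sumr -big_split /=; apply: eq_bigr => i _.
by rewrite mulrDr; congr (_ + _); rewrite mulrCA.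
Qed.

Lemma symsum_alt L g : symsum L g = (\sum_(i < L.+1) (-1) ^+ i * g i) *+ 2 - g 0%N.
Proof.
rewrite /symsum big_ord_recl [in RHS]big_ord_recl /sign_weight /= expr0 !mul1r mulrnDl.
rewrite [in RHS]addrC mulr2n addrA addrA addNr add0r -sumrMnl; congr (_ + _).
by apply: eq_bigr => i _; rewrite mulrnAl.
Qed.
End Symsum.

Section Monotone.
Context {R : realFieldType}.
Implicit Types (phi psi : nat -> R) (m n h : nat).

Fixpoint kmono m phi : Prop :=
  match m with
  | 0%N => forall n, 0 <= phi n
  | m'.+1 => (forall n, 0 <= phi n) /\ kmono m' (fun n => phi n - phi n.+1)
  end.

Lemma kmono_ge0 m phi n : kmono m phi -> 0 <= phi n.
Proof. by case: m => [|m] //= []. Qed.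

Lemma eq_kmono m phi psi : phi =1 psi -> kmono m phi -> kmono m psi.
Proof.
elim: m phi psi => [|m IH] phi psi e /=; first by move=> p n; rewrite -e.
move=> [p c]; split=> [n|]; first by rewrite -e.
by apply: IH c => n /=; rewrite !e.
Qed.

Lemma kmonoS m phi : kmono m.+1 phi -> kmono m phi.
Proof. by elim: m phi => [|m IH] phi [p c] //; split=> //; apply: IH. Qed.

Lemma kmono0 m : kmono m (fun=> 0).
Proof. by elim: m => [|m IH] //=; split=> //; apply: eq_kmono IH => n; rewrite subrr. Qed.

Lemma kmonoD m phi psi : kmono m phi -> kmono m psi -> kmono m (fun n => phi n + psi n).
Proof.
elim: m phi psi => [|m IH] phi psi /=; first by move=> p q n; rewrite addr_ge0.
move=> [p c] [q d]; split=> [n|]; first by rewrite addr_ge0.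
by apply: eq_kmono (IH _ _ c d) => n /=; rewrite opprD addrACA.
Qed.

Lemma kmono_shift m phi h : kmono m phi -> kmono m (fun n => phi (n + h)%N).
Proof.
elim: m phi => [|m IH] phi /=; first by move=> p n.
by move=> [p c]; split=> [n //|]; apply: eq_kmono (IH _ c) => n /=; rewrite addSn.
Qed.

(** The difference of a product is the difference of [phi] times [psi], plus the shifted [phi] times
    the difference of [psi]; both products fall under the induction hypothesis. *)
Lemma kmonoM m phi psi : kmono m phi -> kmono m psi -> kmono m (fun n => phi n * psi n).
Proof.
elim: m phi psi => [|m IH] phi psi; first by move=> p q n; rewrite mulr_ge0.
move=> c d; have [/= [p c'] [q d']] := (c, d).
split=> [n|]; first by rewrite mulr_ge0.
have e := kmonoD (IH _ _ c' (kmonoS d)) (IH _ _ (kmono_shift 1 (kmonoS c)) d').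
by apply: eq_kmono e => n /=; rewrite addn1; ring.
Qed.

Lemma kmono_dif m phi h : kmono m.+1 phi -> kmono m (fun n => phi n - phi (n + h)%N).
Proof.
move=> c; elim: h => [|h IH].
  by apply: eq_kmono (kmono0 m) => n /=; rewrite addn0 subrr.
have [_ d] := c; apply: eq_kmono (kmonoD IH (kmono_shift h d)) => n /=.
by rewrite addnS; ring.
Qed.

Lemma kmono_le m phi n n' : kmono m.+1 phi -> (n <= n')%N -> phi n' <= phi n.
Proof.
by move=> c nn'; rewrite -subr_ge0; have := kmono_ge0 n (kmono_dif (n' - n) c); rewrite subnKC.
Qed.

(** The hypothesis passes to differences: from order [m + 1], [phi 0 - phi 1] is at least
    [(2 ^ (m + 1) - 1) * phi 1], hence at least [2 ^ m * phi 1], which dominates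
    [2 ^ m * (phi 1 - phi 2)]. *)
Lemma kmono_extend m phi : kmono m (fun n => phi n.+1) -> phi 1%N *+ 2 ^ m <= phi 0%N -> kmono m phi.
Proof.
elim: m phi => [|m IH] phi /=.
  by rewrite expn0 mulr1n => p le0 [|n] //; apply: le_trans le0.
move=> [p c] le0; have p1 := p 0%N.
have le01 : phi 1%N <= phi 0%N.
  by apply: le_trans le0; rewrite -mulr_natr ler_peMr // ler1n expn_gt0.
split=> [[|n] //|]; first exact: le_trans le01.
apply: IH => //=.
apply: (@le_trans _ _ (phi 1%N *+ 2 ^ m)).
  by rewrite lerMn2r gerBl p orbT.
rewrite lerBrDr; apply: le_trans le0; rewrite expnS mul2n -addnn mulrnDr lerD2l.
by rewrite -mulr_natr ler_peMr // ler1n expn_gt0.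
Qed.

(** * Leibniz' criterion for k-monotone sequences *)

Definition alt_sum (o : nat -> nat) (J : nat) phi n : R :=
  \sum_(j < J.+1) (-1) ^+ j * phi (n + o j)%N.

(** Leibniz' criterion at the level of monotonicity, at the price of one order. Peeling off the
    first term leaves minus the sum with offsets [o \o S]; the two conclusions are proved together,
    because each for [J.+1] follows from the other one for [J]. *)
Lemma alt_sum_kmono m o J phi : {homo o : i j / (i <= j)%N} -> kmono m.+1 phi ->
  kmono m (alt_sum o J phi) /\ kmono m (fun n => phi (n + o 0%N)%N - alt_sum o J phi n).
Proof.
move=> + c; elim: J o => [|J IH] o o_mono.
  have e n : alt_sum o 0 phi n = phi (n + o 0%N)%N by rewrite /alt_sum big_ord1 expr0 mul1r.
  split; first by apply: eq_kmono (kmono_shift (o 0%N) (kmonoS c)) => n; rewrite e.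
  by apply: eq_kmono (kmono0 m) => n; rewrite e subrr.
have e n : alt_sum o J.+1 phi n = phi (n + o 0%N)%N - alt_sum (o \o S) J phi n.
  rewrite /alt_sum big_ord_recl expr0 mul1r; congr (_ + _); rewrite -sumrN.
  by apply: eq_bigr => j _; rewrite /= exprS mulN1r mulNr.
have [|c1 c2] := IH (o \o S); first by move=> i j ij; apply: o_mono.
split; last by apply: eq_kmono c1 => n; rewrite e opprB addrC subrK.
have le01 : (o 0 <= o 1)%N by apply: o_mono.
apply: eq_kmono (kmonoD (kmono_shift (o 0%N) (kmono_dif (o 1%N - o 0%N) c)) c2) => n /=.
by rewrite e -addnA subnKC // addrA subrK.
Qed.

Lemma sqn_homo I : {homo (fun j => (I + j) ^ 2)%N : i j / (i <= j)%N}.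
Proof. by move=> i j ij; rewrite leq_sqr leq_add2l. Qed.

(** The difference is, up to sign, twice an alternating sum that starts at [(I + 1) ^ 2], hence is
    at most twice its first term. Monotonicity then replaces [(I + 1) ^ 2] by [I]. *)
Lemma symsum_tail_kmono phi I I' : kmono 1 phi -> (I <= I')%N ->
  `|symsum I' (fun i => phi (i ^ 2)%N) - symsum I (fun i => phi (i ^ 2)%N)| <= phi I *+ 2.
Proof.
move=> c le_I; have [->|lt_I] := eqVneq I I'.
  by rewrite subrr normr0 mulrn_wge0 // (kmono_ge0 _ c).
have {}lt_I : (I < I')%N by rewrite ltn_neqAle lt_I.
have [J eJ] : exists J, I'.+1 = (I.+1 + J.+1)%N by exists (I' - I.+1)%N; lia.
have -> : symsum I' (fun i => phi (i ^ 2)%N) - symsum I (fun i => phi (i ^ 2)%N) =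
    (-1) ^+ I.+1 * alt_sum (fun j => (I.+1 + j) ^ 2)%N J phi 0 *+ 2.
  rewrite /symsum eJ big_split_ord /= addrC addrK /alt_sum mulr_sumr -sumrMnl.
  by apply: eq_bigr => j _; rewrite /sign_weight /= add0n exprD mulrnAl mulrA.
have [/(_ 0%N) a0 /(_ 0%N) a1] := alt_sum_kmono J (@sqn_homo I.+1) c.
rewrite normrMn normrM normrX normrN1 expr1n mul1r lerMn2r /= ger0_norm //.
rewrite subr_ge0 in a1.
by apply: le_trans a1 _; apply: (kmono_le c); nia.
Qed.

Definition alt_squares K phi := alt_sum (fun j => j ^ 2)%N K phi.

Lemma alt_squares_kmono m K phi : kmono m.+1 phi -> kmono m (alt_squares K phi).
Proof. by move=> c; have [] := alt_sum_kmono K (@sqn_homo 0) c. Qed.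

Lemma alt_squares_le m K phi n : kmono m.+1 phi -> alt_squares K phi n <= phi n.
Proof.
move=> c; have [_ /(kmono_ge0 n)] := alt_sum_kmono K (@sqn_homo 0) c.
by rewrite (_ : (n + (0 + 0) ^ 2)%N = n) ?addn0 // subr_ge0.
Qed.

Lemma symsum_alt_squares K phi n :
  symsum K (fun k => phi (n + k ^ 2)%N) = 2 * alt_squares K phi n + (-1) * phi n.
Proof. by rewrite symsum_alt /alt_squares /alt_sum addn0 mulN1r mulr_natl. Qed.

(** Each inner sum is [2 * alt_squares - phi], so the double inner sum has four terms with
    coefficients 4, -2, -2 and 1, each contributing at most [2 * phi I] per unit; hence
    [18 = 2 * (4 + 2 + 2 + 1)]. Two orders of monotonicity go to the inner sums and the third to the
    tail. *)
Lemma symsum3_tail_fst phi I I' J K : kmono 3 phi -> (I <= I')%N ->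
  `|symsum3 I' J K phi - symsum3 I J K phi| <= phi I *+ 18.
Proof.
move=> c le_I.
pose T psi := symsum I' (fun i => psi (i ^ 2)%N) - symsum I (fun i => psi (i ^ 2)%N).
have e L : symsum3 L J K phi =
    4 * symsum L (fun i => alt_squares J (alt_squares K phi) (i ^ 2)%N) +
    (- 2) * symsum L (fun i => alt_squares K phi (i ^ 2)%N) +
    ((- 2) * symsum L (fun i => alt_squares J phi (i ^ 2)%N) + symsum L (fun i => phi (i ^ 2)%N)).
  rewrite -symsum_comb -[symsum L (fun i => phi _)]mul1r -symsum_comb.
  rewrite -[X in X + _]mul1r -[X in _ + X]mul1r -symsum_comb; apply: eq_symsum => i.
  rewrite (@eq_symsum _ _ _ (fun j => 2 * alt_squares K phi (i ^ 2 + j ^ 2)%N + (-1) * phi (i ^ 2 + j ^ 2)%N)).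
    by rewrite symsum_comb !symsum_alt_squares; ring.
  by move=> j; rewrite symsum_alt_squares.
have -> : symsum3 I' J K phi - symsum3 I J K phi =
    4 * T (alt_squares J (alt_squares K phi)) - 2 * T (alt_squares K phi) - 2 * T (alt_squares J phi) + T phi.
  by rewrite !e /T; ring.
have b psi : kmono 1 psi -> psi I <= phi I -> `|T psi| <= phi I *+ 2.
  by move=> cpsi le_psi; apply: le_trans (symsum_tail_kmono cpsi le_I) _; rewrite lerMn2r le_psi.
have b1 : `|T (alt_squares J (alt_squares K phi))| <= phi I *+ 2.
  by apply: b; [do 2 apply: alt_squares_kmono|apply: le_trans (alt_squares_le _ _ (alt_squares_kmono _ c)) (alt_squares_le _ _ c)].
have b2 : `|T (alt_squares K phi)| <= phi I *+ 2 by apply: b; [exact: kmonoS (alt_squares_kmono _ c)|exact: alt_squares_le c].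
have b3 : `|T (alt_squares J phi)| <= phi I *+ 2 by apply: b; [exact: kmonoS (alt_squares_kmono _ c)|exact: alt_squares_le c].
have b4 : `|T phi| <= phi I *+ 2 by apply: b => //; exact: kmonoS (kmonoS c).
move: b1 b2 b3 b4; rewrite !ler_norml => /andP[? ?] /andP[? ?] /andP[? ?] /andP[? ?].
by apply/andP; split; lra.
Qed.

(** The sides grow one at a time, each brought into first position by symmetry; [54 = 3 * 18]. *)
Lemma symsum3_tail phi m I J K I' J' K' : kmono 3 phi ->
  (m <= I <= I')%N -> (m <= J <= J')%N -> (m <= K <= K')%N ->
  `|symsum3 I' J' K' phi - symsum3 I J K phi| <= phi m *+ 54.
Proof.
move=> c /andP[mI II] /andP[mJ JJ] /andP[mK KK].
have le L : (m <= L)%N -> phi L *+ 18 <= phi m *+ 18 by move=> mL; rewrite lerMn2r (kmono_le c mL) orbT.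
have t1 := le_trans (symsum3_tail_fst J' K' c II) (le _ mI).
have t2 : `|symsum3 I J' K' phi - symsum3 I J K' phi| <= phi m *+ 18.
  by rewrite !(symsum3C12 I); apply: le_trans (symsum3_tail_fst _ _ c JJ) (le _ mJ).
have t3 : `|symsum3 I J K' phi - symsum3 I J K phi| <= phi m *+ 18.
  rewrite !(symsum3C23 I J) !(symsum3C12 I).
  by apply: le_trans (symsum3_tail_fst _ _ c KK) (le _ mK).
move: t1 t2 t3; rewrite !ler_norml => /andP[? ?] /andP[? ?] /andP[? ?].
by apply/andP; split; lra.
Qed.
End Monotone.

(** * Sums over boxes and spheres of integer points *)

(** As [Negz i] is [- (i + 1)], there are [L] negative entries against [L + 1] nonnegative ones. *)
Definition intball (L : nat) : seq int :=
  [seq Posz i | i <- iota 0 L.+1] ++ [seq Negz i | i <- iota 0 L].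

Lemma mem_intball L i : (i \in intball L) = (`|i| <= L%:Z).
Proof.
rewrite mem_cat; case: i => n.
- have -> : (Posz n \in [seq Negz i | i <- iota 0 L]) = false by apply/mapP => -[].
  by rewrite orbF mem_map ?mem_iota ?ltnS // => ? ? [].
- have -> : (Negz n \in [seq Posz i | i <- iota 0 L.+1]) = false by apply/mapP => -[].
  by rewrite mem_map ?mem_iota // => ? ? [].
Qed.

Lemma uniq_intball L : uniq (intball L).
Proof.
rewrite cat_uniq !map_inj_uniq ?iota_uniq ?andbT; try by move=> ? ? [].
by apply/hasPn => _ /mapP[i _ ->]; apply/mapP => -[].
Qed.

Definition box (I J K : nat) : seq (int * int * int) :=
  [seq (p, k) | p <- [seq (i, j) | i <- intball I, j <- intball J], k <- intball K].

Lemma mem_box I J K p : (p \in box I J K) =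
  [&& `|p.1.1| <= I%:Z, `|p.1.2| <= J%:Z & `|p.2| <= K%:Z].
Proof.
case: p => [[i j] k]; rewrite /= -!mem_intball andbA /box.
apply/idP/idP => [/allpairsP[[p k'] [/allpairsP[[i' j'] [iI jJ ->]] kK [-> -> ->]]]|].
  by rewrite iI jJ.
move=> /andP[/andP[iI jJ] kK]; apply/allpairsP; exists (i, j, k); split=> //.
by apply/allpairsP; exists (i, j).
Qed.

Lemma uniq_box I J K : uniq (box I J K).
Proof. by do 2 (apply: allpairs_uniq; rewrite ?uniq_intball //; last by move=> [? ?] [? ?] _ _ [-> ->]). Qed.

Section BoxSums.
Context {R : realType}.
Implicit Types (phi g : nat -> R).

Lemma expN1_absz (i : int) : (-1 : R) ^ i = (-1) ^+ `|i|%N.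
Proof. by case: i => n //; rewrite /exprz -exprVn invrN1. Qed.

Lemma sum_intball L g : \sum_(i <- intball L) (-1) ^ i * g `|i|%N = symsum L g.
Proof.
rewrite symsum_alt big_cat !big_map /= mulr2n -addrA.
have e m : \sum_(i <- iota 0 m) (-1) ^+ i * g i = \sum_(i < m) (-1) ^+ i * g i.
  by rewrite -(big_mkord xpredT (fun i => (-1) ^+ i * g i)) /index_iota subn0.
rewrite -(e L.+1); congr (_ + _).
rewrite (e L.+1) big_ord_recl expr0 mul1r addrC addKr.
rewrite -(big_mkord xpredT (fun i => (-1) ^+ i.+1 * g i.+1)) /index_iota subn0.
by apply: eq_bigr => i _; rewrite expN1_absz.
Qed.

Lemma sum_box I J K phi :
  \sum_(p <- box I J K) (-1) ^ (p.1.1 + p.1.2 + p.2) * phi `|sqsum p|%N = symsum3 I J K phi.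
Proof.
rewrite /box big_allpairs_dep big_allpairs_dep /symsum3 -sum_intball.
apply: eq_bigr => i _; rewrite -sum_intball mulr_sumr; apply: eq_bigr => j _.
rewrite -sum_intball !mulr_sumr; apply: eq_bigr => k _.
rewrite !expfzDr ?oppr_eq0 ?oner_eq0 // !mulrA; congr (_ * phi _).
rewrite /sqsum /= -!abszX; lia.
Qed.

(** A square has the parity of its root, so the sign is constant on each sphere. This is what allows
    sums over points to be grouped with multiplicities [r3]. *)
Lemma sign_sqsum p : (-1 : R) ^ (p.1.1 + p.1.2 + p.2) = (-1) ^+ `|sqsum p|%N.
Proof.
case: p => [[i j] k]; rewrite /sqsum /= !expfzDr ?oppr_eq0 ?oner_eq0 // !expN1_absz.
have -> : `|(i ^+ 2 + j ^+ 2 + k ^+ 2)%R|%N = (`|i| ^ 2 + `|j| ^ 2 + `|k| ^ 2)%N.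
  by rewrite -!abszX; lia.
have e n : (-1 : R) ^+ (n ^ 2)%N = (-1) ^+ n by rewrite -[LHS]signr_odd oddX /= signr_odd.
by rewrite !exprD !e.
Qed.

(** Since [|i| <= i ^ 2], the sphere of squared radius [n] lies inside the cube of half-side [n]. *)
Lemma r3_box n L : (n <= L)%N ->
  (r3 n)%:R = \sum_(p <- box L L L | `|sqsum p|%N == n) (1 : R).
Proof.
move=> nL; rewrite /r3.
rewrite card_fset_sum1 natr_sum -(fsbig_finite _ _ (finite_sphere n)) /=.
rewrite -[RHS]big_filter [RHS]fsbig_seq ?filter_uniq ?uniq_box //; apply: eq_fsbigl.
have le_sq (i : int) : `|i| <= i ^+ 2 by nia.
apply/seteqP; split=> p pn.
  suff : p \in [seq p <- box L L L | `|sqsum p|%N == n] by [].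
  have {}pn : sqsum p = n%:Z := pn.
  rewrite mem_filter mem_box pn eqxx /=.
  have bound (x y z i j k : int) : `|i| <= x -> `|j| <= y -> `|k| <= z ->
    x + y + z = n%:Z -> [&& `|i| <= L%:Z, `|j| <= L%:Z & `|k| <= L%:Z] by lia.
  exact: bound (le_sq _) (le_sq _) (le_sq _) pn.
have : p \in [seq p <- box L L L | `|sqsum p|%N == n] := pn.
by rewrite mem_filter => /andP[/eqP <- _]; rewrite /= gez0_abs // !addr_ge0 // sqr_ge0.
Qed.

(** The cube contains every sphere of index below [N] entirely, and [phi] vanishes on the points of
    the cube outside these spheres. *)
Lemma sum_r3 N L phi : (N <= L)%N -> (forall n, (N <= n)%N -> phi n = 0) ->
  \sum_(n < N) (-1) ^+ n * (r3 n)%:R * phi n = symsum3 L L L phi.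
Proof.
move=> NL phi0; rewrite -sum_box.
transitivity (\sum_(n < N) \sum_(p <- box L L L)
    if `|sqsum p|%N == n then (-1) ^+ n * phi n else 0).
  apply: eq_bigr => n _; rewrite -big_mkcond (r3_box (L := L)); last first.
    by apply: leq_trans NL; apply: ltnW.
  by rewrite mulrAC mulr_sumr; apply: eq_bigr => p _; rewrite mulr1.
rewrite exchange_big /=; apply: eq_bigr => p _; rewrite sign_sqsum.
have [ltN|leN] := ltnP `|sqsum p|%N N.
  by rewrite -big_mkcond (big_pred1 (Ordinal ltN)).
rewrite phi0 // mulr0 big1 // => n _; case: eqP => // e.
by move: leN; rewrite e leqNgt ltn_ord.
Qed.

(** The value [phi 0] is free: [symsum3] counts the origin once, and the subtraction removes it. *)
Lemma box_sum_symsum3 (a s : R) I J K phi :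
  (forall n, phi n.+1 = (a ^+ 2 + n.+1%:R) `^ (- s)) ->
  box_sum a s (I, J, K) = symsum3 I J K phi - phi 0%N.
Proof.
move=> e; rewrite -sum_box (bigD1_seq (0, 0, 0)) ?uniq_box ?mem_box //=.
rewrite !addr0 expr0z mul1r !mul0n addrAC subrr add0r.
rewrite -[RHS]big_filter [RHS]fsbig_seq ?filter_uniq ?uniq_box // /box_sum.
rewrite (_ : punctured_box _ _ _ = [set` [seq p <- box I J K | p != (0, 0, 0)]]).
  apply: eq_fsbigr => p; rewrite inE /= mem_filter => /andP[p0 _].
  have sq0 : 0 < sqsum p.
    by case: p p0 => [[i j] k]; rewrite /sqsum !xpair_eqE /=; nia.
  congr (_ * _); rewrite -[in LHS](gtz0_abs sq0).
  by case: `|sqsum p|%N (absz_gt0 (sqsum p)) => [|n _]; [lia|rewrite e powRN].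
apply/seteqP; split=> p pn.
  suff : p \in [seq p <- box I J K | p != (0, 0, 0)] by [].
  by rewrite mem_filter mem_box; case: pn => -> -> -> ->.
have : p \in [seq p <- box I J K | p != (0, 0, 0)] := pn.
by rewrite mem_filter mem_box => /and4P[].
Qed.
End BoxSums.

(** * Differences of real powers *)

Section PowerDifferences.
Context {R : realType} (c : R) (c_ge0 : 0 <= c).
Implicit Types (s x : R) (k n : nat).

Definition rpow s x : R := (c + x) `^ (- s).

Fixpoint rdif k s x : R :=
  match k with
  | 0%N => rpow s x
  | k'.+1 => rdif k' s x - rdif k' s (x + 1)
  end.

Lemma rpow_gt0 s x : 0 < x -> 0 < rpow s x.
Proof. by move=> x0; apply: powR_gt0; rewrite ltr_wpDl. Qed.

Lemma rpow_le s x y : 0 <= s -> 0 < x -> x <= y -> rpow s y <= rpow s x.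
Proof.
move=> s0 x0 xy; rewrite /rpow !powRN lef_pV2 ?posrE ?powR_gt0 ?ltr_wpDl //.
  by apply: ge0_ler_powR; rewrite // ?nnegrE ?lerD2l // addr_ge0 // ltW // (lt_le_trans x0).
exact: lt_le_trans xy.
Qed.

Lemma rpowD s t x : 0 < x -> rpow (s + t) x = rpow s x * rpow t x.
Proof.
move=> x0; rewrite /rpow opprD powRD //.
by apply/implyP => _; rewrite gt_eqF // ltr_wpDl.
Qed.

Lemma is_derive_rdif k s x : 0 < x -> is_derive x (1 : R) (rdif k s) (- s * rdif k (s + 1) x).
Proof.
elim: k s x => [|k IH] s x x0.
  rewrite /= /rpow.
  have cx : 0 < c + x by rewrite ltr_wpDl.
  pose h := (fun y : R => c + y).
  have H1 : is_derive x (1 : R) h (0 + 1) by apply: is_deriveD.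
  have H2 := is_derive1_powR (- s) cx.
  have := is_derive1_comp (f := fun y : R => y `^ (- s)) (g := h) H2 H1.
  rewrite add0r mulr1 (_ : - s - 1 = - (s + 1)) // opprD //.
have d1 := IH s x x0.
have d2 : is_derive (x + 1) (1 : R) (rdif k s) (- s * rdif k (s + 1) (x + 1)) by apply: IH; lra.
have H1 : is_derive x (1 : R) (fun y : R => y + 1) (1 + 0) by apply: is_deriveD.
have d3 := is_derive1_comp (f := rdif k s) (g := fun y => y + 1) d2 H1.
have := is_deriveB d1 d3.
by rewrite addr0 mulr1 -mulrBr.
Qed.

(** The mean value theorem trades one difference for a factor [s] and one more unit of exponent,
    because differences commute with the derivative. *)
Lemma rdif_MVT k s x : 0 < x -> exists2 y, x <= y <= x + 1 & rdif k.+1 s x = s * rdif k (s + 1) y.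
Proof.
move=> x0; have lt1 : x < x + 1 by rewrite ltrDl.
have [y yx||y yx e] := @MVT R (rdif k s) (fun y => - s * rdif k (s + 1) y) x (x + 1) lt1.
- by apply: is_derive_rdif; apply: lt_trans x0 _; rewrite (itvP yx).
- apply: derivable_within_continuous => y yx.
  have y0 : 0 < y by apply: lt_le_trans x0 _; rewrite (itvP yx).
  by have [] := is_derive_rdif k s y0.
exists y; first by rewrite !ltW ?(itvP yx).
by move: e; rewrite addrAC subrr add0r mulr1 mulNr /=; lra.
Qed.

(** Iterating [rdif_MVT] produces the rising factorial of [s]; the intermediate points lie to the
    right of [x], where the power is smaller. *)
Lemma rdif_bound k s x : 0 <= s -> 0 < x ->
  0 <= rdif k s x <= (\prod_(i < k) (s + i%:R)) * rpow (s + k%:R) x.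
Proof.
elim: k s x => [|k IH] s x s0 x0.
  by rewrite big_ord0 mul1r addr0 /= lexx andbT ltW // rpow_gt0.
have [y /andP[xy _] ->] := rdif_MVT k s x0.
have y0 := lt_le_trans x0 xy.
have s1 : 0 <= s + 1 by lra.
have /andP[d0 d1] := IH _ _ s1 y0.
rewrite mulr_ge0 //= big_ord_recl addr0 -mulrA ler_wpM2l //.
have -> : s + k.+1%:R = s + 1 + k%:R by rewrite -natr1; ring.
apply: le_trans d1 _.
rewrite [in leRHS](eq_bigr (fun i : 'I_k => s + 1 + i%:R)); last first.
  by move=> i _; rewrite lift0 -natr1; ring.
apply: ler_wpM2l; last by apply: rpow_le => //; rewrite addr_ge0.
by apply: prodr_ge0 => i _; rewrite addr_ge0.
Qed.

Lemma kmono_rdif m k s : 0 <= s -> kmono m (fun n => rdif k s n.+1%:R).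
Proof.
move=> s0; elim: m k => [|m IH] k /=.
  by move=> n; have /andP[] := rdif_bound k s0 (ltr0Sn R n).
split=> [n|]; first by have /andP[] := rdif_bound k s0 (ltr0Sn R n).
by apply: eq_kmono (IH k.+1) => n /=; rewrite -[n.+2%:R]natr1.
Qed.

Lemma rpow_cvg0 s : 0 < s -> rpow s n.+1%:R @[n --> \oo] --> (0 : R).
Proof.
move=> s0.
apply: (@squeeze_cvgr _ _ _ _ (fun=> 0) (fun n : nat => n.+1%:R^-1 `^ s)).
- apply: nearW => n; rewrite ltW ?rpow_gt0 //= /rpow.
  have -> : n.+1%:R^-1 `^ s = (n.+1%:R `^ s)^-1.
    by rewrite -powRN -mulN1r powRrM powR_inv1.
  rewrite powRN lef_pV2 ?posrE ?powR_gt0 ?ltr_wpDl //.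
  by apply: ge0_ler_powR; rewrite ?nnegrE ?lerDr // ?ltW // ltr_wpDl.
- exact: cvg_cst.
- have /cvg_at_rightP := powR_cvg0 s0; apply; split; first exact: harmonic_gt0.
  exact: cvg_harmonic.
Qed.
End PowerDifferences.

(* The origin is left out of the sums of the theorem: the value at 0 is arbitrary, and this one makes
   the sequence 3-monotone, see [kmono_extend]. *)
Definition power_seq (R : realType) (a s : R) (n : nat) : R :=
  if n is 0%N then rpow (a ^+ 2) s 1 *+ 8 else rpow (a ^+ 2) s n%:R.

Section Pfun.
Context {R : realType} (a s : R) (s_gt0 : 0 < s).
Let c_ge0 : 0 <= a ^+ 2 := sqr_ge0 a.
Let f := power_seq a s.

Lemma power_seq_kmono : kmono 3 f.
Proof.
apply: kmono_extend => //=.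
by apply: eq_kmono (kmono_rdif c_ge0 3 0 (ltW s_gt0)) => n.
Qed.

Lemma power_seq_cvg0 : f n @[n --> \oo] --> (0 : R).
Proof. by rewrite -cvg_shiftS; exact: (rpow_cvg0 c_ge0 s_gt0). Qed.
End Pfun.

(** * Riesz means by summation by parts *)

(** This is [N] times the first Riesz mean, and also the sum of the partial sums of [b]
    ([riesz_sum_series]); so [b] is recovered by a second difference. *)
Definition riesz_sum (R : pzRingType) (b : nat -> R) (N : nat) : R :=
  \sum_(n < N) (N - n)%:R * b n.

Section SummationByParts.
Context {R : comPzRingType}.
Implicit Types b f : nat -> R.

Lemma riesz_sumS b N : riesz_sum b N.+1 = riesz_sum b N + \sum_(n < N.+1) b n.
Proof.
rewrite /riesz_sum !big_ord_recr /= subSn // subnn -[X in _ + X = _]addr0 mul1r addrA.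
rewrite addr0 addrA -big_split /=; congr (_ + _); apply: eq_bigr => n _.
by rewrite subSn 1?ltnW // -natr1 mulrDl mul1r.
Qed.

Lemma riesz_sum_series b N : riesz_sum b N = \sum_(j < N.+1) \sum_(k < j) b k.
Proof.
elim: N => [|N IH]; first by rewrite /riesz_sum big_ord0 big_ord1 big_ord0.
by rewrite riesz_sumS IH [RHS]big_ord_recr.
Qed.

Lemma riesz_sum_dif2 b N : b N.+1 = riesz_sum b N.+2 - riesz_sum b N.+1 *+ 2 + riesz_sum b N.
Proof. by rewrite !riesz_sumS !big_ord_recr /=; ring. Qed.

Let u b f k := riesz_sum b k.+1 * (f k - f k.+1 *+ 2 + f k.+2).
Let w b f k := riesz_sum b k.+1 * (f k - f k.+2).

Lemma sum_by_parts2 b f N : \sum_(n < N.+2) b n * f n =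
  \sum_(k < N) u b f k + riesz_sum b N.+1 * (f N - f N.+1 *+ 2) + riesz_sum b N.+2 * f N.+1.
Proof.
elim: N => [|N IH].
  rewrite big_ord0 add0r !big_ord_recr big_ord0 /= add0r /riesz_sum !big_ord_recr !big_ord0 /=.
  by rewrite ?subn0 ?subSnn; ring.
by rewrite big_ord_recr IH /= [X in _ = X + _ + _]big_ord_recr /= (riesz_sum_dif2 b N.+1) /u; ring.
Qed.

(** Passing from [N] to [N.+1] adds to the left side a partial sum, which [sum_by_parts2] expresses
    by second differences of [f]. These accumulate in [u], and the boundary terms combine into
    differences of [f] over a step of 2, collected in [w]. *)
Lemma riesz_sum_by_parts b f N : riesz_sum (fun n => b n * f n) N.+1 =
  riesz_sum (u b f) N + \sum_(k < N) w b f k + riesz_sum b N.+1 * f N.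
Proof.
elim: N => [|N IH].
  by rewrite /riesz_sum !big_ord_recr !big_ord0 /= !subn0; ring.
rewrite riesz_sumS sum_by_parts2 IH (riesz_sumS (u b f)) [\sum_(k < N.+1) w b f k]big_ord_recr.
by rewrite [\sum_(n < N.+1) u b f n]big_ord_recr /= /u /w; ring.
Qed.
End SummationByParts.

Section CesaroConvergence.
Context {R : realType} (a s C : R) (b : nat -> R).
Hypothesis s_gt0 : 0 < s.
Hypothesis C_ge0 : 0 <= C.
Hypothesis b_bound : forall n, `|riesz_sum b n.+1| <= C * n.+1%:R `^ (1 + s / 2).
Let f := power_seq a s.
Let c := a ^+ 2.
Let c_ge0 : 0 <= c := sqr_ge0 a.
(** The decay [s] is split in two halves: one absorbs the excess growth of the Riesz sums, the other
    gives convergence. *)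
Let d := s / 2.
Let d_gt0 : 0 < d. Proof. by rewrite /d divr_gt0. Qed.
Let u k := riesz_sum b k.+1 * (f k - f k.+1 *+ 2 + f k.+2).
Let w k := riesz_sum b k.+1 * (f k - f k.+2).

Lemma powR_rpow_bound t k : 0 <= t -> k.+2%:R `^ t * rpow c t k.+1%:R <= 2 `^ t.
Proof.
move=> t0; have ck : 0 < c + k.+1%:R by rewrite ltr_wpDl.
rewrite /rpow powRN ler_pdivrMr ?powR_gt0 // -(powRM _ _ (ltW ck)) //.
apply: ge0_ler_powR; rewrite ?nnegrE ?mulr_ge0 ?(ltW ck) //.
have : k.+2%:R <= 2%:R * k.+1%:R :> R by rewrite -natrM ler_nat; lia.
by move: c_ge0; lra.
Qed.

(** The integral test in discrete form: by the mean value theorem the powers of exponent [1 + d] are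
    dominated by a telescoping sequence. *)
Lemma rpow_telescope k : rpow c (1 + d) k.+2%:R <= d^-1 * (rpow c d k.+1%:R - rpow c d k.+2%:R).
Proof.
have [y /andP[y1 y2]] := rdif_MVT c_ge0 0 d (ltr0Sn R k); rewrite /= natr1 => ->.
rewrite mulrA mulVf ?gt_eqF // mul1r addrC; apply: rpow_le => //.
- by rewrite addr_ge0 // ltW.
- by apply: lt_le_trans y1.
- by rewrite -natr1.
Qed.

Let K := C * (2 `^ (1 + d) * (s * (s + 1))).

(** The second difference decays with exponent [s + 2 = (1 + d) + (1 + d)]: one part cancels the
    growth of the Riesz sum, the other is summable. The index [k.+1] avoids the conventional value
    [f 0]. *)
Lemma u_bound k : `|u k.+1| <= K * rpow c (1 + d) k.+1%:R.
Proof.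
have k0 : 0 < k.+1%:R :> R by [].
have e : f k.+1 - f k.+2 *+ 2 + f k.+3 = rdif c 2 s k.+1%:R.
  by rewrite /f /power_seq /= !natr1; ring.
have /andP[r0 r1] := rdif_bound c_ge0 2 (ltW s_gt0) k0.
rewrite /u normrM e (ger0_norm r0).
apply: le_trans (ler_pM _ _ (b_bound k.+1) r1) _ => //.
rewrite !big_ord_recl big_ord0 /= addr0 mulr1 (_ : s + 2%:R = (1 + d) + (1 + d)); last by rewrite /d; lra.
rewrite rpowD //.
have h := powR_rpow_bound k (_ : 0 <= 1 + d).
rewrite /K.
have -> : C * k.+2%:R `^ (1 + s / 2) * (s * (s + (bump 0 0)%:R) * (rpow c (1 + d) k.+1%:R * rpow c (1 + d) k.+1%:R)) =
  C * ((k.+2%:R `^ (1 + d) * rpow c (1 + d) k.+1%:R) * (s * (s + 1))) * rpow c (1 + d) k.+1%:R.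
  by rewrite /bump /d /=; ring.
apply: ler_wpM2r; first by rewrite ltW // rpow_gt0.
apply: ler_wpM2l => //; apply: ler_wpM2r; last by apply: h; rewrite addr_ge0 // ltW.
by rewrite mulr_ge0 ?addr_ge0 // ltW.
Qed.

(** Here a difference over two steps decays with exponent [s + 1 = (1 + d) + d]; only [d] survives
    the growth, so [w] tends to 0. *)
Lemma w_bound k : `|w k.+1| <= C * (2 `^ (1 + d) * (s *+ 2)) * rpow c d k.+1%:R.
Proof.
have k0 : 0 < k.+1%:R :> R by [].
have e : f k.+1 - f k.+3 = rdif c 1 s k.+1%:R + rdif c 1 s k.+2%:R.
  by rewrite /f /power_seq /= !natr1; ring.
have /andP[r0 r1] := rdif_bound c_ge0 1 (ltW s_gt0) k0.
have /andP[r0' r1'] := rdif_bound c_ge0 1 (ltW s_gt0) (ltr0Sn R k.+1).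
rewrite !big_ord_recl big_ord0 addr0 mulr1 in r1 r1'.
have s1 : 0 <= s + 1 by rewrite addr_ge0 // ltW.
have le2 : rpow c (s + 1) k.+2%:R <= rpow c (s + 1) k.+1%:R by apply: rpow_le; rewrite ?ler_nat.
have r2 : rdif c 1 s k.+1%:R + rdif c 1 s k.+2%:R <= s *+ 2 * rpow c (s + 1) k.+1%:R.
  rewrite mulr2n mulrDl lerD //; apply: le_trans r1' _; apply: ler_wpM2l => //; exact: ltW.
rewrite /w normrM e (ger0_norm (addr_ge0 r0 r0')).
apply: le_trans (ler_pM _ _ (b_bound k.+1) r2) _ => //; first exact: addr_ge0.
rewrite (_ : s + 1 = (1 + d) + d); last by rewrite /d; lra.
rewrite rpowD //.
have h := powR_rpow_bound k (_ : 0 <= 1 + d).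
have -> : C * k.+2%:R `^ (1 + s / 2) * (s *+ 2 * (rpow c (1 + d) k.+1%:R * rpow c d k.+1%:R)) =
  C * ((k.+2%:R `^ (1 + d) * rpow c (1 + d) k.+1%:R) * (s *+ 2)) * rpow c d k.+1%:R.
  by rewrite /d; ring.
apply: ler_wpM2r; first by rewrite ltW // rpow_gt0.
apply: ler_wpM2l => //; apply: ler_wpM2r; last by apply: h; rewrite addr_ge0 // ltW.
by rewrite mulrn_wge0 // ltW.
Qed.

Lemma K_ge0 : 0 <= K.
Proof. by rewrite /K !mulr_ge0 // ?powR_ge0 ?addr_ge0 // ltW. Qed.

Lemma is_cvg_series_u : cvgn (series u).
Proof.
apply: normed_cvg; apply: nondecreasing_is_cvgn.
  by apply: nondecreasing_series => n _ _; exact: normr_ge0.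
have bnd n : \sum_(k < n.+2) `|u k| <=
    `|u 0%N| + `|u 1%N| + K * d^-1 * (rpow c d 1 - rpow c d n.+1%:R).
  elim: n => [|n IH].
    by rewrite !big_ord_recl big_ord0 subrr mulr0 !addr0.
  rewrite big_ord_recr /=; apply: le_trans (lerD IH (u_bound n.+1)) _.
  rewrite -addrA lerD2l.
  have -> : K * d^-1 * (rpow c d 1 - rpow c d n.+2%:R) = K * d^-1 * (rpow c d 1 - rpow c d n.+1%:R) +
      K * (d^-1 * (rpow c d n.+1%:R - rpow c d n.+2%:R)) by ring.
  by rewrite lerD2l ler_wpM2l ?K_ge0 ?rpow_telescope.
exists (`|u 0%N| + `|u 1%N| + K * d^-1 * rpow c d 1) => _ [n _ <-] /=.
have le2 : (n <= n.+2)%N by lia.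
apply: (@le_trans _ _ (\sum_(k < n.+2) `|u k|)).
  rewrite -(big_mkord xpredT (fun k => `|u k|)) (big_cat_nat (n := n)) //=.
  by rewrite lerDl sumr_ge0.
apply: le_trans (bnd n) _; rewrite lerD2l; apply: ler_wpM2l.
  by apply: mulr_ge0 K_ge0 _; rewrite invr_ge0 ltW.
by rewrite gerBl ltW // rpow_gt0.
Qed.

Lemma cvg0_le_rpow (g : nat -> R) M : (forall k, `|g k.+1| <= M * rpow c d k.+1%:R) ->
  g n @[n --> \oo] --> (0 : R).
Proof.
move=> H; rewrite -cvg_shiftS; apply: norm_cvg0.
apply: (@squeeze_cvgr _ _ _ _ (fun=> 0) (fun n : nat => M * rpow c d n.+1%:R)).
- by apply: nearW => n; rewrite normr_ge0 H.
- exact: cvg_cst.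
- by rewrite -[X in _ --> X](mulr0 M); apply: cvgMr; exact: rpow_cvg0.
Qed.

(** Dividing [riesz_sum_by_parts] by [N.+1] gives the Cesaro mean of the convergent series of [u],
    the Cesaro mean of [w], which tends to 0, and the remainder [z]. *)
Lemma riesz_sum_mean_cvg :
  cvg ((riesz_sum (fun n => b n * f n) N.+1 / N.+1%:R) @[N --> \oo]).
Proof.
have cu := cesaro is_cvg_series_u.
have w0 : w n @[n --> \oo] --> (0 : R) by apply: cvg0_le_rpow; exact: w_bound.
have cw := cesaro w0.
(* The subtracted term compensates for the last term [w N], present in the mean of [w] over [N.+1]
   terms but absent from the identity. *)
pose z k := riesz_sum b k.+1 * f k / k.+1%:R - w k / k.+1%:R.
have z0 : z n @[n --> \oo] --> (0 : R).
  apply: (@cvg0_le_rpow _ (C * 2 `^ d + C * (2 `^ (1 + d) * (s *+ 2)))) => k.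
  apply: le_trans (ler_normB _ _) _; rewrite mulrDl; apply: lerD.
    have k2 : 0 < k.+2%:R :> R by [].
    rewrite normrM normrM normfV (ger0_norm (ltW k2)).
    have -> : `|f k.+1| = rpow c s k.+1%:R by rewrite ger0_norm // ltW // rpow_gt0.
    rewrite (_ : rpow c s k.+1%:R = rpow c d k.+1%:R * rpow c d k.+1%:R); last first.
      by rewrite -rpowD // /d; congr rpow; lra.
    apply: (@le_trans _ _ (C * k.+2%:R `^ (1 + d) * (rpow c d k.+1%:R * rpow c d k.+1%:R) / k.+2%:R)).
      apply: ler_wpM2r; first by rewrite invr_ge0 ltW.
      apply: ler_wpM2r; last exact: b_bound.
      by apply: mulr_ge0; rewrite ltW // rpow_gt0.
    rewrite powRD; last by rewrite pnatr_eq0 implybT.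
    rewrite powRr1 // (_ : C * (k.+2%:R * k.+2%:R `^ d) * (rpow c d k.+1%:R * rpow c d k.+1%:R) / k.+2%:R =
      C * (k.+2%:R `^ d * rpow c d k.+1%:R) * rpow c d k.+1%:R); last by field; rewrite gt_eqF.
    apply: ler_wpM2r; first by rewrite ltW // rpow_gt0.
    by apply: ler_wpM2l => //; apply: powR_rpow_bound; exact: ltW.
  apply: le_trans (w_bound k); rewrite normrM normfV (ger0_norm (ler0n _ _)).
  by rewrite ler_pdivrMr ?ltr0n // ler_peMr // ler1n.
suff -> : (fun N => riesz_sum (fun n => b n * f n) N.+1 / N.+1%:R) =
    arithmetic_mean (series u) + arithmetic_mean w + z by exact: cvgP (cvgD (cvgD cu cw) z0).
apply/funext => N.
have e : riesz_sum (fun n => b n * f n) N.+1 =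
    \sum_(j < N.+1) \sum_(k < j) u k + \sum_(k < N) w k + riesz_sum b N.+1 * f N.
  by rewrite riesz_sum_by_parts riesz_sum_series.
have eu : arithmetic_mean (series u) N = N.+1%:R^-1 * \sum_(j < N.+1) \sum_(k < j) u k.
  by rewrite /arithmetic_mean !seriesEord.
have ew : arithmetic_mean w N = N.+1%:R^-1 * (\sum_(k < N) w k + w N).
  by rewrite /arithmetic_mean /= seriesEord /= big_ord_recr.
by rewrite e !fctE eu ew /z; ring.
Qed.
End CesaroConvergence.

(** * Comparison of boxes and spheres *)

Section Weights.
Context {R : realType}.

Definition triangle (N n : nat) : R := \sum_(M < N) (M.+1 - n)%:R / M.+1%:R.

(** A single function [(1 - n / M)_+] is not 3-monotone in general, since its second difference is a
    point mass. Summing over [M] spreads these masses into [1 / (n + 1)] for [n < N], which is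
    nonincreasing. *)
Lemma triangle_kmono N : kmono 3 (triangle N).
Proof.
have d1 n : triangle N n - triangle N n.+1 = \sum_(M < N) (n <= M)%:R / M.+1%:R.
  rewrite /triangle -sumrB; apply: eq_bigr => M _; rewrite -mulrBl -natrB; last by lia.
  by congr (_%:R / _); lia.
have d2 n : \sum_(M < N) (n <= M)%:R / M.+1%:R - \sum_(M < N) (n.+1 <= M)%:R / M.+1%:R =
    (n < N)%:R / n.+1%:R :> R.
  rewrite -sumrB (eq_bigr (fun M : 'I_N => if M == n :> nat then n.+1%:R^-1 else 0)).
    rewrite -big_mkcond /=; have [ltN|leN] := ltnP n N.
      by rewrite (big_pred1 (Ordinal ltN)) ?mul1r.
    rewrite big1 ?mul0r // => M /eqP e; move: leN; rewrite -e leqNgt ltn_ord //.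
  move=> M _; rewrite -mulrBl -natrB; last by lia.
  case: eqP => [->|ne]; first by rewrite leqnn ltnn mul1r.
  by rewrite (_ : (_ - _)%N = 0%N) ?mul0r //; lia.
split=> [n|]; first by apply: sumr_ge0.
split=> [n|]; first by rewrite d1; apply: sumr_ge0.
split=> n; rewrite !d1 !d2 // subr_ge0.
have [ltN|_] := ltnP n.+1 N; last by rewrite mul0r mulr_ge0.
by rewrite (ltnW ltN) !mul1r lef_pV2 ?posrE // ler_nat.
Qed.

Lemma triangle_le N n : triangle N n <= N%:R.
Proof.
rewrite /triangle; have -> : N%:R = \sum_(M < N) (1 : R) by rewrite sumr_const card_ord.
by apply: ler_sum => M _; rewrite ler_pdivrMr // mul1r ler_nat leq_subr.
Qed.

(* The average over [1 <= M <= N.+1] of [(1 - n / M)_+]; in [triangle] the subtraction of natural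
   numbers is the positive part. *)
Definition weight (N n : nat) : R := N.+1%:R^-1 * triangle N.+1 n.

Lemma kmonoZ m k (phi : nat -> R) : 0 <= k -> kmono m phi -> kmono m (fun n => k * phi n).
Proof.
move=> k0; elim: m phi => [|m IH] phi /=; first by move=> p n; rewrite mulr_ge0.
move=> [p c]; split=> [n|]; first by rewrite mulr_ge0.
by apply: eq_kmono (IH _ c) => n; rewrite mulrBr.
Qed.

Lemma weight_kmono N : kmono 3 (weight N).
Proof. by apply: kmonoZ (triangle_kmono _). Qed.

Lemma weight_le1 N n : weight N n <= 1.
Proof. by rewrite /weight mulrC ler_pdivrMr // mul1r triangle_le. Qed.

Lemma weight_out N n : (N < n)%N -> weight N n = 0.
Proof.
move=> Nn; rewrite /weight /triangle big1 ?mulr0 // => M _.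
by rewrite (_ : (_ - _)%N = 0%N) ?mul0r //; have := ltn_ord M; lia.
Qed.

Lemma weight_cvg n : weight N n @[N --> \oo] --> (1 : R).
Proof.
have h : (M.+1 - n)%:R / M.+1%:R @[M --> \oo] --> (1 : R).
  apply: (@squeeze_cvgr _ _ _ _ (fun M : nat => 1 - n%:R * M.+1%:R^-1) (fun=> 1)).
  - apply: nearW => M; rewrite ler_pdivlMr // ler_pdivrMr // mulrBl -mulrA mulVf ?gt_eqF //.
    by rewrite mulr1 !mul1r lerBlDr -natrD !ler_nat; lia.
  - have : (1 - n%:R * M.+1%:R^-1) @[M --> \oo] --> (1 - n%:R * 0 : R).
      by apply: cvgB; [exact: cvg_cst|apply: cvgMr; exact: cvg_harmonic].
    by rewrite mulr0 subr0.
  - exact: cvg_cst.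
suff -> : weight^~ n = arithmetic_mean (fun M : nat => (M.+1 - n)%:R / M.+1%:R) by exact: cesaro h.
by apply/funext => N; rewrite /arithmetic_mean /= seriesEord.
Qed.

Lemma symsum_cvg L (g : nat -> nat -> R) (h : nat -> R) :
  (forall i, g N i @[N --> \oo] --> h i) -> symsum L (g N) @[N --> \oo] --> symsum L h.
Proof.
move=> H; apply: cvg_big => [|i _]; first exact: add_continuous.
by apply: cvgMr; exact: H.
Qed.
End Weights.

Section Limits.
Context {R : realType} (b f : nat -> R) (l : R).
Hypothesis f_kmono : kmono 3 f.
Hypothesis b_sum : forall N L phi, (N <= L)%N -> (forall n, (N <= n)%N -> phi n = 0) ->
  \sum_(n < N) b n * phi n = symsum3 L L L phi.
Hypothesis mean_cvg : (riesz_sum (fun n => b n * f n) N.+1 / N.+1%:R) @[N --> \oo] --> l.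

Let tau N := riesz_sum (fun n => b n * f n) N.+1 / N.+1%:R.

(** The weight vanishes beyond [N], so a cube of half-side [L > N] sees complete spheres. Exchanging
    the sum over points with the average over [M] gives the means [tau]. *)
Lemma weighted_symsum3 N L : (N < L)%N ->
  symsum3 L L L (fun n => f n * weight N n) = arithmetic_mean tau N.
Proof.
move=> NL; rewrite -(@b_sum N.+1) //; last by move=> n Nn; rewrite weight_out ?mulr0.
rewrite /arithmetic_mean /= seriesEord /= mulr_sumr.
under eq_bigr => n _ do rewrite /weight /triangle mulrCA !mulr_sumr.
rewrite exchange_big /=; apply: eq_bigr => M _; rewrite /tau /riesz_sum.
rewrite mulr_suml mulr_sumr.
rewrite [RHS](big_ord_widen N.+1 (fun i => N.+1%:R^-1 * ((M.+1 - i)%:R * (b i * f i) / M.+1%:R))) //.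
rewrite [RHS]big_mkcond /=; apply: eq_bigr => n _; case: ltnP => Mn; first by ring.
by rewrite (_ : (_ - _)%N = 0%N) ?mul0r ?mulr0 //; lia.
Qed.

(** For each [N], the weighted sums over the given box and over a cube large enough for
    [weighted_symsum3] differ by at most [54 * f m], because [weight] is at most 1. This is uniform
    in [N]. On the fixed box the weights tend to 1, while the averages of [tau] tend to [l], so the
    bound passes to the limit. *)
Lemma symsum3_dist m I J K : (m <= I)%N -> (m <= J)%N -> (m <= K)%N ->
  `|symsum3 I J K f - l| <= f m *+ 54.
Proof.
move=> mI mJ mK.
have c1 : symsum3 I J K (fun n => f n * weight N n) @[N --> \oo] --> symsum3 I J K f.
  do 3 apply: symsum_cvg => ?.
  by rewrite -[X in _ --> X]mulr1; apply: cvgMr; exact: weight_cvg.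
have c2 : `|symsum3 I J K (fun n => f n * weight N n) - arithmetic_mean tau N| @[N --> \oo] -->
    `|symsum3 I J K f - l|.
  by apply: cvg_norm; apply: cvgB c1 (cesaro mean_cvg).
apply: (cvgr_to_le c2); apply: nearW => N.
pose L := maxn N.+1 (maxn I (maxn J K)).
rewrite -(@weighted_symsum3 N L); last by rewrite leq_max leqnn.
rewrite distrC; apply: le_trans (symsum3_tail (m := m) _ _ _ _) _.
- exact: kmonoM f_kmono (weight_kmono N).
- by rewrite mI /= /L; lia.
- by rewrite mJ /= /L; lia.
- by rewrite mK /= /L; lia.
by rewrite lerMn2r /= ler_piMr ?weight_le1 // (kmono_ge0 _ f_kmono).
Qed.
End Limits.

Definition signed_r3 (R : pzRingType) (n : nat) : R := (-1) ^+ n * (r3 n)%:R.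

Lemma r3_0 (R : realType) : (r3 0)%:R = 1 :> R.
Proof. by rewrite (r3_box (leqnn 0)) big_cons big_nil addr0. Qed.

Section Main.
Context {R : realType} (a s : R) (s_gt0 : 0 < s).
Let f := power_seq a s.
Let b := signed_r3 R.

(** The term [n = N.+1] of the left side is 0, and the term [n = 0] of the Riesz mean is [f 0],
    because [r3 0 = 1]. *)
Lemma cesaro_sum_riesz_sum N :
  cesaro_sum a s N.+1 = riesz_sum (fun n => b n * f n) N.+1 / N.+1%:R - f 0%N.
Proof.
rewrite /riesz_sum mulr_suml big_ord_recl subn0 /b /signed_r3 r3_0 expr0 !mul1r.
rewrite mulrAC mulfV ?pnatr_eq0 // mul1r addrAC subrr add0r.
rewrite /cesaro_sum big_nat_recr //= mulfV ?pnatr_eq0 // subrr mulr0 mul0r addr0.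
rewrite big_add1 /= big_mkord; apply: eq_bigr => n _.
have -> : bump 0 n = n.+1 by [].
rewrite natrB; last by have := ltn_ord n; lia.
rewrite /f /power_seq /rpow powRN.
have N0 : N.+1%:R != 0 :> R by rewrite pnatr_eq0.
set p := (_ `^ s)^-1; move: N.+1%:R N0 => x x0.
by field.
Qed.

Lemma box_sum_power_seq I J K : box_sum a s (I, J, K) = symsum3 I J K f - f 0%N.
Proof. exact: box_sum_symsum3. Qed.

(** The conventional value [f 0] is subtracted from both the box sums and the means, so it cancels
    in their distance, which is at most [54 * f m] and tends to 0. *)
Lemma cesaro_madelung C : 0 <= C ->
  (forall n, `|riesz_sum b n.+1| <= C * n.+1%:R `^ (1 + s / 2)) ->
  cvg (cesaro_sum a s N @[N --> \oo]) /\
  madelung a s = lim (cesaro_sum a s N @[N --> \oo]).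
Proof.
move=> C0 bC; have cl := riesz_sum_mean_cvg s_gt0 C0 bC (a := a).
set l := lim _ in cl.
have cc : cesaro_sum a s N @[N --> \oo] --> l - f 0%N.
  rewrite -cvg_shiftS.
  rewrite (_ : [sequence _]_n = fun N => riesz_sum (fun n => b n * f n) N.+1 / N.+1%:R - f 0%N).
    by apply: cvgB => //; exact: cvg_cst.
  by apply/funext => N; exact: cesaro_sum_riesz_sum.
split; first exact: cvgP cc.
rewrite (cvg_lim _ cc) //; apply: cvg_lim => //.
apply/cvgrPdist_le => e e0.
have f0 : f n *+ 54 @[n --> \oo] --> (0 : R).
  by rewrite -(mul0rn R 54); apply: cvgMn; exact: power_seq_cvg0.
have [m _ hm] : \forall n \near \oo, `|0 - f n *+ 54| <= e by move/cvgrPdist_le : f0; apply.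
apply/near_oo3; exists m => I J K mI mJ mK.
rewrite box_sum_power_seq opprB addrA subrK -opprB normrN.
apply: le_trans (symsum3_dist (power_seq_kmono a s_gt0) _ cl mI mJ mK) _.
  by move=> N L phi NL phi0; exact: sum_r3.
apply: le_trans (hm m (leqnn m)); rewrite sub0r normrN; exact: ler_norm.
Qed.
End Main.

(** * Conclusion *)

Lemma lattice_sumE (g : nat -> Rdefinitions.R) L : RieszBound.lattice_sum g L = symsum L g.
Proof.
elim: L => [|L IH]; first by rewrite /symsum big_ord1 /sign_weight mul1r.
transitivity (RieszBound.lattice_sum g L + 2%:R * (-1) ^+ L.+1 * g L.+1); first by rewrite -RpowE.
by rewrite IH [RHS]big_ord_recr /sign_weight /= mulr_natl.
Qed.

Lemma riesz_sum_signed_r3E (R : realType) N :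
  riesz_sum (signed_r3 R) N = symsum3 N N N (fun n => (N - n)%:R).
Proof.
rewrite -(@sum_r3 _ N) //; last by move=> n Nn; rewrite (_ : (N - n)%N = 0%N) //; lia.
by apply: eq_bigr => n _; rewrite mulrC.
Qed.

Lemma riesz_sum_intr (R : pzRingType) N : riesz_sum (signed_r3 R) N = (riesz_sum (signed_r3 int) N)%:~R.
Proof.
rewrite /riesz_sum rmorph_sum /=; apply: eq_bigr => n _.
by rewrite /signed_r3 !rmorphM /= rmorphXn /= rmorphN1 !rmorph_nat.
Qed.

(** The Riesz sums of [signed_r3] are integers, so the estimate over the standard library reals
    descends to [int], from where it maps to any [realType]. *)
Lemma riesz_sum_int_bound : exists C : nat, forall N k, (0 < N)%N -> (N <= 2 ^ k)%N ->
  `|riesz_sum (signed_r3 int) N| <= (C * N * k.+1 ^ 3)%:Z.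
Proof.
have [C bound] := RieszBound.lattice_bound; exists C => N k N0 Nk.
rewrite -(ler_int Rdefinitions.R) intr_norm -riesz_sum_intr riesz_sum_signed_r3E.
have pow2E : Nat.pow 2 k = (2 ^ k)%N by elim: (k) => //= n ->; rewrite expnS; lia.
have Nk' : Peano.le N (Nat.pow 2 k) by rewrite pow2E; apply/ssrnat.leP.
have /RleP := bound N k (elimT ssrnat.leP N0) Nk'.
rewrite lattice_sumE RabsE RpowE !INRE !RmultE.
congr (`|_| <= _); last by rewrite -pmulrn -natrX -!natrM.
apply: eq_symsum => i; rewrite lattice_sumE; apply: eq_symsum => j.
by rewrite lattice_sumE; apply: eq_symsum => l; rewrite INRE.
Qed.

(** A cube of a logarithm is absorbed by any power [d > 0]: with [k] the binary logarithm of [n.+1]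
    rounded up, [(k + 1) ^ 3] is at most [(q ^ k / e) ^ 3 = (2 ^ k) ^ d / e ^ 3]. *)
Lemma riesz_sum_bound (R : realType) (d : R) : 0 < d -> exists2 C, 0 <= C &
  forall n, `|riesz_sum (signed_r3 R) n.+1| <= C * n.+1%:R `^ (1 + d).
Proof.
move=> d0; have [C bound] := riesz_sum_int_bound.
(* The choice of [q] gives [q ^ 3 = 2 ^ d]; that of [e] makes the linear sequence [e * (k + 1)]
   start below [q ^ k] and grow by at most [q - 1] at each step. *)
pose q : R := 2 `^ (d / 3); pose e := Num.min 1 (q - 1).
have q1 : 1 < q.
  have d3 : 0 < d / 3 by rewrite divr_gt0.
  by have := gt0_ltr_powR d3 (ler01 : 1 \is Num.nneg) (ler0n R 2 : 2 \is Num.nneg) (ltr1n R 2); rewrite powR1.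
have e0 : 0 < e by rewrite lt_min ltr01 subr_gt0.
have le_q k : e * k.+1%:R <= q ^+ k.
  elim: k => [|k IH]; first by rewrite mulr1 expr0 ge_min lexx.
  have q_ge1 : 1 <= q ^+ k by rewrite exprn_ege1 // ltW.
  rewrite exprS -[k.+2%:R]natr1 mulrDr mulr1.
  have -> : q * q ^+ k = q ^+ k + (q - 1) * q ^+ k by ring.
  apply: lerD => //; apply: (@le_trans _ _ (q - 1)); first by rewrite ge_min lexx orbT.
  by rewrite ler_peMr // subr_ge0 ltW.
have q3 : q ^+ 3 = 2 `^ d.
  by rewrite -powR_mulrn ?powR_ge0 // -powRrM divfK ?pnatr_eq0.
have qk k : (q ^+ k) ^+ 3 = (2 ^ k)%:R `^ d.
  by rewrite -exprM mulnC exprM q3 natrX -(powR_mulrn k (powR_ge0 2 d)) -(powR_mulrn k (ler0n R 2)) -!powRrM mulrC.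
exists (C%:R * (2 `^ d / e ^+ 3)).
  by rewrite mulr_ge0 // divr_ge0 ?powR_ge0 // exprn_ge0 // ltW.
(* Rounding up the logarithm at most doubles the number, which accounts for the factor [2 ^ d] in
   the constant. *)
have up m : (2 ^ up_log 2 m.+1 <= 2 * m.+1)%N.
  case: m => [|m]; first by rewrite up_log1.
  have /andP[] := @up_log_bounds 2 m.+2 isT isT.
  by case: (up_log 2 m.+2) => [|k] lo _; rewrite ?expnS ?leq_mul2l /= ltnW.
move=> n; pose k := up_log 2 n.+1.
have lo : (2 ^ k <= 2 * n.+1)%N := up n.
have hi : (n.+1 <= 2 ^ k)%N by exact: up_logP.
have q_ge0 : 0 <= q := powR_ge0 _ _.
have key : k.+1%:R ^+ 3 <= 2 `^ d / e ^+ 3 * n.+1%:R `^ d.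
  rewrite mulrAC ler_pdivlMr ?exprn_gt0 // mulrC -exprMn.
  apply: (@le_trans _ _ ((q ^+ k) ^+ 3)).
    by rewrite ler_pXn2r ?nnegrE ?exprn_ge0 // mulr_ge0 // ltW.
  by rewrite qk -powRM // -natrM; apply: ge0_ler_powR; rewrite ?nnegrE ?ler_nat // ltW.
rewrite riesz_sum_intr -intr_norm.
apply: (@le_trans _ _ ((C * n.+1 * k.+1 ^ 3)%:Z%:~R)); first by rewrite ler_int bound.
rewrite -pmulrn natrM natrM natrX powRD; last by rewrite pnatr_eq0 implybT.
rewrite powRr1 //.
have -> : C%:R * (2 `^ d / e ^+ 3) * (n.+1%:R * n.+1%:R `^ d) =
  C%:R * n.+1%:R * (2 `^ d / e ^+ 3 * n.+1%:R `^ d) by ring.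
by rewrite ler_wpM2l // mulr_ge0.
Qed.

Theorem theorem1p2 (R : realType) (a s : R) (s_gt0 : 0 < s) :
  cvg (cesaro_sum a s N @[N --> \oo]) /\
  madelung a s = lim (cesaro_sum a s N @[N --> \oo]).
Proof.
have s2_gt0 : 0 < s / 2 by rewrite divr_gt0.
have [C C0 bound] := @riesz_sum_bound R (s / 2) s2_gt0.
exact: cesaro_madelung bound.
Qed.
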